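(* Let $\mathcal H_1,\mathcal H_2$ be Hilbert spaces, $A$ a self-adjoint operator in $\mathcal H_1$ bounded from below, $B$ a densely defined closable operator from $\mathcal H_2$ to $\mathcal H_1$, and $D$ a self-adjoint operator in $\mathcal H_2$ bounded from above; let $\mathfrak a$, $\mathfrak d$ be the closed quadratic forms associated with $A$, $D$. Assume that $\mathrm{dom}(\mathfrak a)\subset\mathrm{dom}(B^* )$ and that either (I) $\mathrm{dom}(B)\subset\mathrm{dom}(D)$ and $\mathrm{dom}(B)$ is a core for $D$, or (II) $\mathrm{dom}(\mathfrak d)\subset\mathrm{dom}(B)$. Let $\mathcal M$ be the closure of $\mathcal M_0=\begin{pmatrix}A&B\\-B^*&D\end{pmatrix}$ with $\mathrm{dom}(\mathcal M_0)=(\mathrm{dom}(A)\cap\mathrm{dom}(B^* ))\times(\mathrm{dom}(B)\cap\mathrm{dom}(D))$ in $\mathcal H_1\oplus\mathcal H_2$. Let $a\in\mathbb R$, $b\ge0$ be such that $\|B^*x\|^2\le a\|x\|^2+b\,\mathfrak a[x]$ for all $x\in\mathrm{dom}(\mathfrak a)$, let $\delta_+=\max\sigma(D)$ and $\mu=\delta_++b+\sqrt{\max\{b\delta_++b^2+a,0\}}$. Assume that $A$ has compact resolvent and that $\mathcal H_1$ is infinite-dimensional, and let $\nu_1\le\nu_2\le\cdots$ be the eigenvalues of $A$ counted according to multiplicities. Then $(\mu,\infty)\cap\sigma(\mathcal M)$ consists of a sequence of eigenvalues that tends to $\infty$. Let $\gamma_0\in(\mu,\infty)$, let $\kappa=\kappa_-(S(\gamma_0))$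 (which is finite) and let $(\lambda_n)_{n=1}^\infty$ be the eigenvalues of $\mathcal M$ in $[\gamma_0,\infty)$ in non-decreasing order and repeated according to multiplicities. Then $$\nu_{\kappa+n}-b-\frac{b^2+b\delta_++a}{\nu_{\kappa+n}-\delta_+}+\mathcal O\Bigl(\frac1{\nu_{\kappa+n}^2}\Bigr)\le\lambda_n\le\nu_{\kappa+n},\qquad n\to\infty.$$ If, in addition, $D$ is bounded, $\delta_-=\min\sigma(D)$, and $\hat a\in\mathbb R$, $\hat b\ge0$ are such that $\|B^*x\|^2\ge\hat a\|x\|^2+\hat b\,\mathfrak a[x]$ for all $x\in\mathrm{dom}(\mathfrak a)$, then $$\lambda_n\le\nu_{\kappa+n}-\hat b-\frac{\hat b^2+\hat b\delta_-+\hat a}{\nu_{\kappa+n}-\delta_-}+\mathcal O\Bigl(\frac1{\nu_{\kappa+n}^2}\Bigr),\qquad n\to\infty.$$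
   Context: Hilbert spaces are non-zero and complex; inner products are linear in the first argument. $\mathfrak a$ has domain $\mathrm{dom}(|A|^{1/2})$, with sesquilinear form $\mathfrak a[x,y]$ and $\mathfrak a[x]=\mathfrak a[x,x]$; $\mathfrak d$ has domain $\mathrm{dom}(|D|^{1/2})$. Under the stated assumptions $\mathcal M_0$ is closable and such $a,b$ exist. For $\lambda\in(\mu,\infty)$ let $\mathfrak s(\lambda)[x,y]=\mathfrak a[x,y]-\lambda\langle x,y\rangle+\langle(D-\lambda)^{-1}B^*x,B^*y\rangle$, $x,y\in\mathrm{dom}(\mathfrak a)$; this is a closed symmetric form bounded from below, and $S(\lambda)$ is the associated self-adjoint operator in $\mathcal H_1$ (the Schur complement). For a self-adjoint operator $T$, $\kappa_-(T)$ denotes the dimension of the spectral subspace of $T$ corresponding to $(-\infty,0)$. An inequality containing $\mathcal O(\nu_{\kappa+n}^{-2})$ as $n\to\infty$ means that it holds for all sufficiently large $n$ with that term replaced by some sequence $r_n$ satisfying $|r_n|\le C\nu_{\kappa+n}^{-2}$ for a constant $C$. *)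

(* Defs.v *)
From HB Require Import structures.
From mathcomp Require Import all_boot all_order all_algebra.
From mathcomp Require Import complex.
From mathcomp Require Import all_classical all_reals all_analysis.

Set Implicit Arguments.
Unset Strict Implicit.
Unset Printing Implicit Defensive.

Import Order.TTheory GRing.Theory Num.Theory.
Import numFieldNormedType.Exports.

Local Open Scope classical_set_scope.
Local Open Scope ring_scope.
Local Open Scope complex_scope.

(* Non-zero complex Hilbert spaces; {dot H for _} is linear in its first
   argument and conjugate-linear in the second one. *)
HB.mixin Record isHilbert (R : realType) (H : Type)
    of CompleteNormedModule R[i] H := {
  inner_subproof : {dot H for (Num.conj : R[i] -> R[i])} ;
  inner_norm_subproof : forall x : H, `|x| ^+ 2 = inner_subproof x x ;
  hilbert_neq0 : exists x : H, x != 0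
}.

#[short(type="hilbertType")]
HB.structure Definition Hilbert (R : realType) :=
  {H of isHilbert R H & CompleteNormedModule R[i] H}.

Definition inner {R : realType} {H : hilbertType R} :
  {dot H for (Num.conj : R[i] -> R[i])} := @inner_subproof R H.

Notation "''[' x , y ]" := (inner x y) (format "''[' x ,  y ]") : ring_scope.

(* The norm of a normed module over R[i] takes its values in R[i]. *)
Definition rnorm (R : realType) (E : normedModType R[i]) (x : E) : R :=
  complex.Re `|x|.

Definition has_dim (K : fieldType) (V : lmodType K) (W : set V) (n : nat) :=
  exists e : 'I_n -> V,
    W = [set x | exists c : 'I_n -> K, x = \sum_i c i *: e i] /\
    forall c : 'I_n -> K, \sum_i c i *: e i = 0 -> forall i, c i = 0.

Definition infinite_dimensional (K : fieldType) (V : lmodType K) :=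
  ~ exists n, has_dim [set: V] n.

(* An operator from E to F, with a domain that need not be all of E, is given
   by its graph, a subset of E * F.  The norm of E * F in the library is the
   maximum norm, which is equivalent to the norm of the orthogonal sum; the
   graph closure and the spectrum below are the same for both. *)
Section Operators.
Context {R : realType}.
Implicit Types E F : normedModType R[i].

Definition linear_operator E F (T : set (E * F)) :=
  [/\ T (0, 0),
      forall (c : R[i]) p q, T p -> T q -> T (c *: p + q) &
      forall y, T (0, y) -> y = 0].

Definition op_dom E F (T : set (E * F)) : set E := [set x | exists y, T (x, y)].

(* The value at x; it is 0 when x lies outside the domain. *)
Definition op_app E F (T : set (E * F)) (x : E) : F := xget 0 [set y | T (x, y)].

Definition op_inverse E F (T : set (E * F)) : set (F * E) :=
  [set p | T (p.2, p.1)].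

Definition op_shift E (T : set (E * E)) (z : R[i]) : set (E * E) :=
  [set p | T (p.1, p.2 + z *: p.1)].

Definition op_restriction E F (T : set (E * F)) (X : set E) : set (E * F) :=
  [set p | T p /\ X p.1].

Definition closable E F (T : set (E * F)) :=
  forall y, closure T (0, y) -> y = 0.

Definition op_core E F (T : set (E * F)) (X : set E) :=
  X `<=` op_dom T /\ closure (op_restriction T X) = T.

Definition bounded_operator E F (T : set (E * F)) :=
  exists c : R, forall p, T p -> rnorm p.2 <= c * rnorm p.1.

Definition resolvent_set E (T : set (E * E)) : set R[i] :=
  [set z | (forall y, exists! x, op_shift T z (x, y)) /\
           bounded_operator (op_inverse (op_shift T z))].

Definition spectrum E (T : set (E * E)) : set R[i] := ~` resolvent_set T.

Definition real_spectrum E (T : set (E * E)) : set R :=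
  [set t | spectrum T t%:C].

Definition op_eigenspace E (T : set (E * E)) (z : R[i]) : set E :=
  [set x | T (x, z *: x)].

Definition op_eigenvalue E (T : set (E * E)) (z : R[i]) :=
  exists2 x, x != 0 & op_eigenspace T z x.

(* lam lists the eigenvalues of T in J in non-decreasing order, each of them as
   often as its multiplicity dim ker (T - t). *)
Definition eigenvalue_sequence E (T : set (E * E)) (J : set R) (lam : R^nat) :=
  [/\ nondecreasing_seq lam,
      forall n, J (lam n) &
      forall t, J t -> exists2 k, has_dim (op_eigenspace T t%:C) k &
                                  ([set n | lam n = t] #= `I_k)%card].

Definition compact_resolvent E (T : set (E * E)) :=
  exists2 z, resolvent_set T z &
    compact (closure [set x | exists2 y, op_shift T z (x, y) & rnorm y <= 1]).

(* The block matrix with rows (T11, T12) and (- T21, T22). *)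
Definition block_operator E F (T11 : set (E * E)) (T12 : set (F * E))
    (T21 : set (E * F)) (T22 : set (F * F)) : set ((E * F) * (E * F)) :=
  [set p : (E * F) * (E * F) | exists u v w z,
     [/\ T11 (p.1.1, u), T12 (p.1.2, v), T21 (p.1.1, w), T22 (p.1.2, z) &
         p.2 = (u + v, - w + z)]].

End Operators.

Section HilbertOperators.
Context {R : realType}.
Implicit Types H K : hilbertType R.

Definition adjoint H K (T : set (H * K)) : set (K * H) :=
  [set q : K * H | forall p : H * K, T p -> '[p.2, q.1] = '[p.1, q.2]].

Definition selfadjoint H (T : set (H * H)) :=
  [/\ linear_operator T, dense (op_dom T) & adjoint T = T].

Definition bounded_from_below H (T : set (H * H)) :=
  exists c : R, forall p, T p ->
    c * rnorm p.1 ^+ 2 <= complex.Re '[p.2, p.1].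

Definition bounded_from_above H (T : set (H * H)) :=
  exists c : R, forall p, T p ->
    complex.Re '[p.2, p.1] <= c * rnorm p.1 ^+ 2.

(* E is the resolution of the identity of T, with m x the measure
   J |-> <E J x, x>. *)
Definition spectral_measure H (T : set (H * H)) (E : set R -> H -> H)
    (m : H -> {measure set (measurableTypeR R) -> \bar R}) :=
  [/\ forall J : set (measurableTypeR R), measurable J ->
        [/\ linear (E J), forall x, E J (E J x) = E J x &
            forall x y, '[E J x, y] = '[x, E J y]],
      (forall x, E setT x = x) /\
      (forall J J' : set (measurableTypeR R), measurable J -> measurable J' ->
        forall x, E (J `&` J') x = E J (E J' x)),
      forall x (J : set (measurableTypeR R)), measurable J ->
        m x J = (complex.Re '[E J x, x])%:E,
      op_dom T = [set x | (\int[m x]_t (t ^+ 2)%:E < +oo)%E] &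
      forall p, T p ->
        (complex.Re '[p.2, p.1])%:E = (\int[m p.1]_t t%:E)%E].

Definition dom_sqrt_abs H (T : set (H * H)) : set H :=
  [set x | exists E m, spectral_measure T E m /\
                       (\int[m x]_t `|t|%:E < +oo)%E].

Definition kappa_minus H (T : set (H * H)) (k : nat) :=
  exists E m, spectral_measure T E m /\ has_dim (range (E [set t | t < 0])) k.

End HilbertOperators.

(* Only the values on the domain are meaningful. *)
Record qform (R : realType) (H : hilbertType R) := QForm {
  fdom : set H ;
  fval :> H -> H -> R[i]
}.

Section Forms.
Context {R : realType}.
Implicit Types H : hilbertType R.

Definition quad H (q : qform H) (x : H) : R := complex.Re (q x x).

Definition symmetric_form H (q : qform H) :=
  [/\ fdom q 0,
      forall (c : R[i]) x y, fdom q x -> fdom q y -> fdom q (c *: x + y),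
      forall (c : R[i]) x y z, fdom q x -> fdom q y -> fdom q z ->
        q (c *: x + y) z = c * q x z + q y z &
      forall x y, fdom q x -> fdom q y -> q x y = Num.conj (q y x)].

Definition semibounded_form H (q : qform H) :=
  exists c : R, (forall x, fdom q x -> c * rnorm x ^+ 2 <= quad q x) \/
                (forall x, fdom q x -> quad q x <= c * rnorm x ^+ 2).

Definition closed_form H (q : qform H) :=
  forall (u : nat -> H) (x : H), (forall n, fdom q (u n)) ->
    u @ \oo --> x ->
    (forall e : R, 0 < e -> exists N, forall n k, (N <= n)%N -> (N <= k)%N ->
       `|quad q (u n - u k)| < e) ->
    fdom q x /\ quad q (u n - x) @[n --> \oo] --> (0 : R).

(* The operator associated with q in the sense of the first representation
   theorem. *)
Definition form_operator H (q : qform H) : set (H * H) :=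
  [set p : H * H | fdom q p.1 /\ forall y, fdom q y -> q p.1 y = '[p.2, y]].

Definition closed_form_of H (T : set (H * H)) (q : qform H) :=
  [/\ symmetric_form q, semibounded_form q, closed_form q,
      fdom q = dom_sqrt_abs T & form_operator q = T].

Definition schur_form (H1 H2 : hilbertType R) (fa : qform H1)
    (B : set (H2 * H1)) (D : set (H2 * H2)) (lambda : R) : qform H1 :=
  QForm (fdom fa) (fun x y =>
    fa x y - lambda%:C * '[x, y] +
    '[op_app (op_inverse (op_shift D lambda%:C)) (op_app (adjoint B) x),
      op_app (adjoint B) y]).

Definition schur_complement (H1 H2 : hilbertType R) (fa : qform H1)
    (B : set (H2 * H1)) (D : set (H2 * H2)) (lambda : R) : set (H1 * H1) :=
  form_operator (schur_form fa B D lambda).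

End Forms.

Definition is_max (R : realType) (X : set R) (x : R) := X x /\ ubound X x.
Definition is_min (R : realType) (X : set R) (x : R) := X x /\ lbound X x.

(* Main.v *)
(** For [t > mu] the kernel of the block operator minus [t] is isomorphic to that
    of the Schur complement form [s(t)], and [t] lies in the resolvent set when
    that kernel vanishes. If [s(t)[x] <= 0], the relative bound on [B^*] gives
    [||(D - t)^-1 B^* x|| < ||x||], so [t |-> s(t)[x]] decreases strictly once it
    is nonpositive. Hence the negative index of [s(t)] grows exactly by the
    eigenvalues passed, and the [n]-th eigenvalue in [[gamma0, oo)] is below [t]
    iff that index is at least [kappa + n]. The bound
    [-<(D - t)^-1 w, w> <= |w|^2 / (t - delta_+)], its converse with [delta_-] for
    bounded [D], and the two bounds on [|B^* x|^2] compare [s(t)] with affine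
    functions of the form of [A]. The min-max principle then turns this into
    quadratic inequalities relating [lambda_n] and [nu_(kappa+n)]. *)
Require Import Defs.
From HB Require Import structures.
From mathcomp Require Import all_boot all_order all_algebra.
From mathcomp Require Import complex finmap.
From mathcomp Require Import all_classical all_reals all_analysis measurable_realfun.
From mathcomp Require Import ring lra.

Set Implicit Arguments.
Unset Strict Implicit.
Unset Printing Implicit Defensive.

Import Order.TTheory GRing.Theory Num.Theory.
Import numFieldNormedType.Exports.

Local Open Scope classical_set_scope.
Local Open Scope ring_scope.
Local Open Scope complex_scope.

(** * Symmetric forms *)

(** No spectral theorem is invoked; everything is read off from quadratic forms. All forms on H1
    share the domain of [fa] and are compared with one fixed form g = fa + c that dominates the
    squared norm. The compact resolvent of A becomes norm compactness of g-bounded sets, and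
    minimising Rayleigh quotients then produces an eigenbasis for the Schur forms s(t) and for the
    forms of A - t alike. Bounds on (D - t)^{-1} come from the numerical range of D and
    Cauchy-Schwarz. The negative index is handled as the relation [neg_dim q k] (at least k negative
    directions), because the same k vectors then witness every comparison of forms. Two notions need
    separate work. The closure of the block operator comes without a formula, so it is identified
    with a weak operator whose first row is tested against the form domain; this is where the
    alternatives (I) and (II) enter. And [kappa_minus] accepts any spectral measure, so one is built
    from an eigenbasis, and every other one is shown to give the same dimension. *)

Lemma Re_conj (R : realType) (c : R[i]) : complex.Re (Num.conj c) = complex.Re c.
Proof. by case: c. Qed.

Lemma Im_conj (R : realType) (c : R[i]) : complex.Im (Num.conj c) = - complex.Im c.
Proof. by case: c. Qed.

Lemma ReD (R : realType) (c d : R[i]) : complex.Re (c + d) = complex.Re c + complex.Re d.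
Proof. by case: c; case: d. Qed.

Lemma ImD (R : realType) (c d : R[i]) : complex.Im (c + d) = complex.Im c + complex.Im d.
Proof. by case: c; case: d. Qed.

Lemma ReM (R : realType) (c d : R[i]) :
  complex.Re (c * d) = complex.Re c * complex.Re d - complex.Im c * complex.Im d.
Proof. by case: c; case: d. Qed.

Lemma ReN (R : realType) (c : R[i]) : complex.Re (- c) = - complex.Re c.
Proof. by case: c. Qed.

Lemma ImN (R : realType) (c : R[i]) : complex.Im (- c) = - complex.Im c.
Proof. by case: c. Qed.

Lemma Re_sum (R : realType) (I : Type) (r : seq I) (P : pred I) (F : I -> R[i]) :
  complex.Re (\sum_(i <- r | P i) F i) = \sum_(i <- r | P i) complex.Re (F i).
Proof. by elim/big_ind2: _ => // x1 x2 y1 y2 <- <-; rewrite ReD. Qed.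

Lemma conj_real (R : realType) (t : R) : Num.conj (t%:C) = t%:C :> R[i].
Proof. by apply/eqP; rewrite eq_complex /= oppr0 !eqxx. Qed.

Definition abs2 (R : realType) (c : R[i]) : R :=
  complex.Re c ^+ 2 + complex.Im c ^+ 2.

Lemma abs2_ge0 (R : realType) (c : R[i]) : 0 <= abs2 c.
Proof. by rewrite addr_ge0 ?sqr_ge0. Qed.

Lemma abs2_eq0 (R : realType) (c : R[i]) : abs2 c = 0 -> c = 0.
Proof.
case: c => x y /eqP; rewrite /abs2 /= paddr_eq0 ?sqr_ge0// !sqrf_eq0.
by case/andP => /eqP -> /eqP ->.
Qed.

Lemma abs2_gt0 (R : realType) (c : R[i]) : c != 0 -> 0 < abs2 c.
Proof.
by move=> c0; rewrite lt_def abs2_ge0 andbT; apply: contra c0 => /eqP/abs2_eq0 ->.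
Qed.

Lemma abs2M (R : realType) (c d : R[i]) : abs2 (c * d) = abs2 c * abs2 d.
Proof. by case: c d => x y [z t]; rewrite /abs2 /=; ring. Qed.

Lemma mulc_conj (R : realType) (c : R[i]) : c * Num.conj c = (abs2 c)%:C.
Proof.
case: c => x y; apply/eqP; rewrite eq_complex /abs2 /=; apply/andP.
by split; apply/eqP; ring.
Qed.

(** Real parts are enough: multiplying the second argument by i recovers the imaginary part, so
    identities tested against a whole complex subspace are proved for [rq] and lifted afterwards. *)
Definition rq (R : realType) (H : hilbertType R) (q : qform H) (x y : H) : R :=
  complex.Re (q x y).

Section FormAlgebra.
Context {R : realType} {H : hilbertType R} {q : qform H}.
Hypothesis hq : Defs.symmetric_form q.

Lemma fdom0 : fdom q 0. Proof. by case: hq. Qed.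

Lemma fdomP c x y : fdom q x -> fdom q y -> fdom q (c *: x + y).
Proof. by case: hq => _ h _ _; exact: h. Qed.

Lemma fdomD x y : fdom q x -> fdom q y -> fdom q (x + y).
Proof. by move=> hx hy; rewrite -[x]scale1r; exact: fdomP. Qed.

Lemma fdomZ c x : fdom q x -> fdom q (c *: x).
Proof. by move=> hx; rewrite -[_ *: _]addr0; apply: fdomP => //; exact: fdom0. Qed.

Lemma fdomN x : fdom q x -> fdom q (- x).
Proof. by rewrite -scaleN1r; exact: fdomZ. Qed.

Lemma fdomB x y : fdom q x -> fdom q y -> fdom q (x - y).
Proof. by move=> hx hy; apply: fdomD => //; exact: fdomN. Qed.

Lemma fdom_sum (I : Type) (r : seq I) (P : pred I) (F : I -> H) :
  (forall i, P i -> fdom q (F i)) -> fdom q (\sum_(i <- r | P i) F i).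
Proof. by move=> hF; elim/big_ind: _ => //; [exact: fdom0|exact: fdomD]. Qed.

Lemma formPl c x y z : fdom q x -> fdom q y -> fdom q z ->
  q (c *: x + y) z = c * q x z + q y z.
Proof. by case: hq => _ _ h _; exact: h. Qed.

Lemma formC x y : fdom q x -> fdom q y -> q x y = Num.conj (q y x).
Proof. by case: hq => _ _ _ h; exact: h. Qed.

Lemma formDl x y z : fdom q x -> fdom q y -> fdom q z ->
  q (x + y) z = q x z + q y z.
Proof. by move=> *; rewrite -[x]scale1r formPl// mul1r scale1r. Qed.

Lemma form0l z : fdom q z -> q 0 z = 0.
Proof.
move=> hz; apply: (addIr (q 0 z)); rewrite add0r -formDl ?addr0//; exact: fdom0.
Qed.

Lemma formZl c x z : fdom q x -> fdom q z -> q (c *: x) z = c * q x z.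
Proof.
move=> hx hz; rewrite -[c *: x]addr0 formPl ?form0l ?addr0//; exact: fdom0.
Qed.

Lemma formZr c x z : fdom q x -> fdom q z -> q x (c *: z) = Num.conj c * q x z.
Proof.
by move=> hx hz; rewrite formC ?formZl ?rmorphM/= -?formC//; exact: fdomZ.
Qed.

Lemma form_suml (I : Type) (r : seq I) (P : pred I) (F : I -> H) z :
  (forall i, P i -> fdom q (F i)) -> fdom q z ->
  q (\sum_(i <- r | P i) F i) z = \sum_(i <- r | P i) q (F i) z.
Proof.
move=> hF hz; elim: r => [|a r ih]; first by rewrite !big_nil form0l.
rewrite !big_cons; case: ifP => // Pa; rewrite formDl ?ih//; first exact: hF.
exact: fdom_sum.
Qed.

Lemma rqC x y : fdom q x -> fdom q y -> rq q x y = rq q y x.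
Proof. by move=> hx hy; rewrite /rq formC// Re_conj. Qed.

Lemma rqDl x y z : fdom q x -> fdom q y -> fdom q z ->
  rq q (x + y) z = rq q x z + rq q y z.
Proof. by move=> *; rewrite /rq formDl// ReD. Qed.

Lemma rqDr x y z : fdom q x -> fdom q y -> fdom q z ->
  rq q x (y + z) = rq q x y + rq q x z.
Proof.
move=> hx hy hz; rewrite rqC ?rqDl//; last exact: fdomD.
by rewrite (rqC hy) // (rqC hz).
Qed.

Lemma rqZl (t : R) x z : fdom q x -> fdom q z -> rq q (t%:C *: x) z = t * rq q x z.
Proof. by move=> *; rewrite /rq formZl// ReM /= mul0r subr0. Qed.

Lemma rqZr (t : R) x z : fdom q x -> fdom q z -> rq q x (t%:C *: z) = t * rq q x z.
Proof. by move=> *; rewrite rqC ?rqZl// ?(@rqC x)//; exact: fdomZ. Qed.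

Lemma rqNl x z : fdom q x -> fdom q z -> rq q (- x) z = - rq q x z.
Proof.
move=> hx hz; have -> : - x = (-1)%:C *: x by rewrite rmorphN1 scaleN1r.
by rewrite rqZl// mulN1r.
Qed.

Lemma rqNr x z : fdom q x -> fdom q z -> rq q x (- z) = - rq q x z.
Proof. by move=> *; rewrite rqC ?rqNl// ?(@rqC x)//; exact: fdomN. Qed.

Lemma rqBl x y z : fdom q x -> fdom q y -> fdom q z ->
  rq q (x - y) z = rq q x z - rq q y z.
Proof. by move=> *; rewrite rqDl ?rqNl//; exact: fdomN. Qed.

Lemma rqBr x y z : fdom q x -> fdom q y -> fdom q z ->
  rq q x (y - z) = rq q x y - rq q x z.
Proof. by move=> *; rewrite rqDr ?rqNr//; exact: fdomN. Qed.

Lemma rqi x z : fdom q x -> fdom q z -> rq q x ('i *: z) = complex.Im (q x z).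
Proof.
move=> hx hz; rewrite /rq formZr// ReM Re_conj Im_conj /= mul0r add0r mulN1r.
by rewrite opprK.
Qed.

Lemma quad0 : quad q 0 = 0.
Proof. by rewrite /quad form0l//; exact: fdom0. Qed.

Lemma quadD x y : fdom q x -> fdom q y ->
  quad q (x + y) = quad q x + quad q y + 2 * rq q x y.
Proof.
move=> hx hy; rewrite -[quad q _]/(rq q _ _) rqDl ?rqDr//; try exact: fdomD.
rewrite (rqC hy hx) /quad -/(rq q x x) -/(rq q y y); ring.
Qed.

Lemma quadN x : fdom q x -> quad q (- x) = quad q x.
Proof.
move=> hx; rewrite -[quad q _]/(rq q _ _) rqNl ?rqNr ?opprK//; exact: fdomN.
Qed.

Lemma quadB x y : fdom q x -> fdom q y ->
  quad q (x - y) = quad q x + quad q y - 2 * rq q x y.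
Proof.
by move=> hx hy; rewrite quadD ?quadN ?rqNr ?mulrN//; exact: fdomN.
Qed.

Lemma quadZ c x : fdom q x -> quad q (c *: x) = abs2 c * quad q x.
Proof.
move=> hx; rewrite /quad formZl ?formZr ?mulrA ?mulc_conj//; last exact: fdomZ.
by rewrite ReM /= mul0r subr0.
Qed.

Lemma quadZr (t : R) x : fdom q x -> quad q (t%:C *: x) = t ^+ 2 * quad q x.
Proof. by move=> hx; rewrite quadZ// /abs2 /= (expr2 0) mul0r addr0. Qed.

Lemma form_diag_real x : fdom q x -> q x x = (quad q x)%:C.
Proof.
move=> hx; have := formC hx hx; rewrite /quad; case: (q x x) => s t /= [] /eqP.
by rewrite -addr_eq0 -mulr2n mulrn_eq0 /= => /eqP ->.
Qed.

Lemma parallelogram x y : fdom q x -> fdom q y ->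
  quad q (x + y) + quad q (x - y) = 2 * quad q x + 2 * quad q y.
Proof. by move=> hx hy; rewrite quadD// quadB//; ring. Qed.

(** Semidefiniteness is the setting, so [quad q y] may vanish for nonzero y. The degenerate case
    matters: it is applied below to q - m, which vanishes at a minimiser. *)
Lemma form_cauchy_schwarz x y : (forall x, fdom q x -> 0 <= quad q x) ->
  fdom q x -> fdom q y -> rq q x y ^+ 2 <= quad q x * quad q y.
Proof.
move=> q0 hx hy.
have pos (s t : R) : 0 <= s ^+ 2 * quad q x + t ^+ 2 * quad q y - 2 * (s * t * rq q x y).
  have : 0 <= quad q (s%:C *: x - t%:C *: y) by apply: q0; apply: fdomB; exact: fdomZ.
  rewrite quadB ?quadZr ?rqZl ?rqZr//; try exact: fdomZ.
  by rewrite -[s * t * _]mulrA.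
have [qy0|] := ltrP 0 (quad q y).
  have := pos (quad q y) (rq q x y).
  have -> : (quad q y ^+ 2 * quad q x + rq q x y ^+ 2 * quad q y -
     2 * (quad q y * rq q x y * rq q x y)) =
     quad q y * (quad q x * quad q y - rq q x y ^+ 2) by ring.
  by rewrite pmulr_rge0// subr_ge0.
move=> qy0; have {qy0} qy : quad q y = 0 by apply/eqP; rewrite eq_le qy0 q0.
have h : forall t, 0 <= quad q x - 2 * t * rq q x y.
  move=> t; have := pos 1 t; rewrite qy !expr1n mulr0 addr0 mul1r.
  by rewrite !mul1r !mulrA.
rewrite qy mulr0.
(* When [quad q y] = 0 the bound [h] is affine in t; this t makes the subtracted term equal to
   [quad q x] + 1, so [rq q x y] has to vanish. *)
have := h ((quad q x + 1) / 2 * (rq q x y)^-1).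
have [->|r0] := eqVneq (rq q x y) 0; first by rewrite expr0n.
have -> : 2 * ((quad q x + 1) / 2 / rq q x y) * rq q x y = quad q x + 1 by field.
lra.
Qed.

Lemma quadD_le x y : (forall x, fdom q x -> 0 <= quad q x) ->
  fdom q x -> fdom q y -> quad q (x + y) <= 2 * quad q x + 2 * quad q y.
Proof.
move=> q0 hx hy; rewrite -parallelogram// lerDl; apply: q0; exact: fdomB.
Qed.

End FormAlgebra.

(** * The inner product as a form *)

Definition inner_form (R : realType) (H : hilbertType R) : qform H :=
  QForm setT (fun x y => '[x, y]).

Definition ip (R : realType) (H : hilbertType R) (x y : H) : R :=
  complex.Re '[x, y].

Definition n2 (R : realType) (H : hilbertType R) (x : H) : R := ip x x.

Section Inner.
Context {R : realType} {H : hilbertType R}.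
Implicit Types x y z : H.

Lemma innerC x y : '[x, y] = Num.conj '[y, x].
Proof. by rewrite hermC expr0 mul1r. Qed.

Lemma innerZl c x y : '[c *: x, y] = c * '[x, y].
Proof. by rewrite linearZl_LR. Qed.

Lemma innerZr c x y : '[x, c *: y] = Num.conj c * '[x, y].
Proof. by rewrite linearZr_LR. Qed.

Lemma inner_form_sym : Defs.symmetric_form (inner_form H).
Proof.
split=> //=; first by move=> c x y z _ _ _; rewrite linearDl linearZl_LR.
by move=> x y _ _; exact: innerC.
Qed.

Lemma rnorm_ge0 x : 0 <= rnorm x.
Proof. by have := normr_ge0 x; rewrite lecE => /andP[]. Qed.

Lemma normE x : `|x| = (rnorm x)%:C.
Proof. by rewrite [LHS]complexE (ger0_Im (normr_ge0 x)) mulr0 addr0. Qed.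

Lemma rnorm2 x : rnorm x ^+ 2 = n2 x.
Proof.
have := inner_norm_subproof x; rewrite normE -rmorphXn => /(congr1 (@complex.Re R)).
by rewrite /n2 /ip /inner /= => <-.
Qed.

Lemma n2_ge0 x : 0 <= n2 x. Proof. by rewrite -rnorm2 sqr_ge0. Qed.

Lemma n2_eq0 x : n2 x = 0 -> x = 0.
Proof.
rewrite -rnorm2 => /eqP; rewrite sqrf_eq0 => /eqP h.
by apply/normr0_eq0; rewrite normE h.
Qed.

Lemma n2_gt0 x : x != 0 -> 0 < n2 x.
Proof. by move=> x0; rewrite lt_def n2_ge0 andbT; apply: contra x0 => /eqP/n2_eq0 ->. Qed.

Lemma innerxx x : '[x, x] = (n2 x)%:C.
Proof. exact: (form_diag_real inner_form_sym). Qed.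

Lemma ipC x y : ip x y = ip y x.
Proof. by rewrite /ip innerC Re_conj. Qed.
Lemma ipDl x y z : ip (x + y) z = ip x z + ip y z.
Proof. exact: (rqDl inner_form_sym). Qed.
Lemma ipDr x y z : ip x (y + z) = ip x y + ip x z.
Proof. exact: (rqDr inner_form_sym). Qed.
Lemma ipNl x z : ip (- x) z = - ip x z.
Proof. exact: (rqNl inner_form_sym). Qed.
Lemma ipBl x y z : ip (x - y) z = ip x z - ip y z.
Proof. exact: (rqBl inner_form_sym). Qed.
Lemma ipBr x y z : ip x (y - z) = ip x y - ip x z.
Proof. exact: (rqBr inner_form_sym). Qed.
Lemma ipZl (t : R) x z : ip (t%:C *: x) z = t * ip x z.
Proof. exact: (rqZl inner_form_sym). Qed.
Lemma ipZr (t : R) x z : ip x (t%:C *: z) = t * ip x z.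
Proof. exact: (rqZr inner_form_sym). Qed.
Lemma ip0l x : ip 0 x = 0. Proof. by rewrite /ip linear0l. Qed.
Lemma ip0r x : ip x 0 = 0. Proof. by rewrite /ip linear0r. Qed.
Lemma ipi x y : ip x ('i *: y) = complex.Im '[x, y].
Proof. exact: (rqi inner_form_sym). Qed.
Lemma n20 : n2 (0 : H) = 0. Proof. exact: ip0l. Qed.
Lemma n2D x y : n2 (x + y) = n2 x + n2 y + 2 * ip x y.
Proof. exact: (quadD inner_form_sym). Qed.
Lemma n2B x y : n2 (x - y) = n2 x + n2 y - 2 * ip x y.
Proof. exact: (quadB inner_form_sym). Qed.
Lemma n2N x : n2 (- x) = n2 x.
Proof. exact: (quadN inner_form_sym). Qed.
Lemma n2Z c x : n2 (c *: x) = abs2 c * n2 x.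
Proof. exact: (quadZ inner_form_sym). Qed.
Lemma n2Zr (t : R) x : n2 (t%:C *: x) = t ^+ 2 * n2 x.
Proof. exact: (quadZr inner_form_sym). Qed.
Lemma n2D_le x y : n2 (x + y) <= 2 * n2 x + 2 * n2 y.
Proof. by apply: (quadD_le inner_form_sym) => // z _; exact: n2_ge0. Qed.
Lemma ip_CS x y : ip x y ^+ 2 <= n2 x * n2 y.
Proof. by apply: (form_cauchy_schwarz inner_form_sym) => // z _; exact: n2_ge0. Qed.

Lemma inner_eq x y (z t : H) : (forall c, ip x (c *: z) = ip y (c *: t)) ->
  '[x, z] = '[y, t].
Proof.
move=> h; apply/eqP; rewrite eq_complex; apply/andP; split; apply/eqP.
  by have := h 1; rewrite !scale1r.
by have := h 'i; rewrite !ipi.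
Qed.

Lemma cvg_n2 (u : nat -> H) x :
  (forall e : R, 0 < e -> exists N, forall n, (N <= n)%N -> n2 (u n - x) < e) <->
  u @ \oo --> x.
Proof.
split=> [h|/cvgrPdist_lt h e e0].
  apply/cvgrPdist_lt => e e0.
  have e0' : 0 < complex.Re e by move: e0; rewrite ltcE => /andP[].
  have [N hN] := h (complex.Re e ^+ 2) (exprn_gt0 _ e0').
  exists N => // n /= Nn; have := hN n Nn.
  rewrite -rnorm2 ltr_sqr ?nnegrE ?rnorm_ge0 ?(ltW e0')//.
  rewrite distrC normE ltcE /= => ->; rewrite andbT.
  by move: e0; rewrite ltcE => /andP[].
have e0' : 0 < (Num.sqrt e)%:C by rewrite ltcR sqrtr_gt0.
have [N _ hN] := h _ e0'; exists N => n Nn; have := hN n Nn.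
rewrite distrC normE ltcR -rnorm2 -[X in _ -> _ < X](sqr_sqrtr (ltW e0)).
by rewrite ltr_sqr ?nnegrE ?rnorm_ge0 ?sqrtr_ge0.
Qed.

Lemma n2_complete (u : nat -> H) :
  (forall e : R, 0 < e -> exists N, forall n k, (N <= n)%N -> (N <= k)%N ->
     n2 (u n - u k) < e) -> exists x, u @ \oo --> x.
Proof.
move=> h; suff : cvg (u @ \oo) by move=> ?; exists (lim (u @ \oo)).
apply: cauchy_cvg; apply/cauchy_ballP => e e0.
have e0' : 0 < complex.Re e by move: e0; rewrite ltcE => /andP[].
have [N hN] := h (complex.Re e ^+ 2) (exprn_gt0 _ e0').
exists (u @` [set n | (N <= n)%N], u @` [set n | (N <= n)%N]).
  by split; exists N => // n /= Nn; exists n.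
move=> [_ _] [[n Nn <-] [k Nk <-]] /=; rewrite -ball_normE /ball_ /=.
have := hN n k Nn Nk.
rewrite -rnorm2 ltr_sqr ?nnegrE ?rnorm_ge0 ?(ltW e0')//.
rewrite normE ltcE /= => ->; rewrite andbT.
by move: e0; rewrite ltcE => /andP[].
Qed.

End Inner.

(** * Sums of forms and continuity in the form norm *)

Lemma sqr_small_eq0 (R : realType) (r : R) : (forall e, 0 < e -> r ^+ 2 < e) -> r = 0.
Proof.
move=> h; apply/eqP; rewrite -sqrf_eq0; apply/negPn/negP => r0.
by have := h (r ^+ 2); rewrite ltxx lt_def r0 sqr_ge0 => /(_ isT).
Qed.

Lemma ex_inv_lt (R : realType) (C e : R) : 0 < e ->
  exists N : nat, forall n, (N <= n)%N -> C / n.+1%:R < e.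
Proof.
move=> e0; exists (Num.truncn (`|C| / e)) => n Nn.
rewrite ltr_pdivrMr ?ltr0n//; apply: (le_lt_trans (ler_norm C)).
rewrite mulrC -ltr_pdivrMr//.
have h := truncnS_gt (`|C| / e).
by apply: (lt_le_trans h); rewrite ler_nat ltnS.
Qed.

(** One construction for the base form, the forms of A - t, resolvent regularisations and
    sign-flipped forms; the domain is that of [q], so [g] acts as a perturbation. *)
Definition fadd (R : realType) (H : hilbertType R) (q : qform H) (c : R)
    (g : qform H) : qform H :=
  QForm (fdom q) (fun x y => q x y + c%:C * g x y).

Section FormSum.
Context {R : realType} {H : hilbertType R}.
Implicit Types q g : qform H.

Lemma fadd_sym q c g : Defs.symmetric_form q -> Defs.symmetric_form g ->
  fdom q `<=` fdom g -> Defs.symmetric_form (fadd q c g).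
Proof.
move=> hq hg qg; split=> /=; first exact: fdom0 hq.
- by move=> *; apply: (fdomP hq).
- move=> a x y z hx hy hz; rewrite (formPl hq)// (formPl hg); try exact: qg.
  by rewrite !mulrDr !mulrA (mulrC _ a) addrACA.
- move=> x y hx hy; rewrite (formC hq)// (formC hg); try exact: qg.
  by rewrite rmorphD rmorphM /= conj_real.
Qed.

Lemma rq_fadd q c g x y : rq (fadd q c g) x y = rq q x y + c * rq g x y.
Proof. by rewrite /rq /= ReD ReM /= mul0r subr0. Qed.

Lemma quad_fadd q c g x : quad (fadd q c g) x = quad q x + c * quad g x.
Proof. exact: rq_fadd. Qed.

(** Cauchy-Schwarz asks for a nonnegative form, which [q] may fail to be; q + C g is one, and it is
    at most 2 C g. Removing the summand C g again accounts for the factor 10. *)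
Lemma form_bound q g (C : R) x y : Defs.symmetric_form q -> Defs.symmetric_form g ->
  fdom q = fdom g -> 0 <= C ->
  (forall x, fdom g x -> `|quad q x| <= C * quad g x) ->
  (forall x, fdom g x -> 0 <= quad g x) ->
  fdom g x -> fdom g y -> rq q x y ^+ 2 <= 10 * C ^+ 2 * (quad g x * quad g y).
Proof.
move=> hq hg qg C0 hC g0 hx hy.
have hs : Defs.symmetric_form (fadd q C g) by apply: fadd_sym => //; rewrite qg.
have s0 z : fdom (fadd q C g) z -> 0 <= quad (fadd q C g) z.
  rewrite /= qg quad_fadd => hz; have := hC z hz; rewrite ler_norml => /andP[? _]; lra.
have hle z : fdom g z -> quad (fadd q C g) z <= 2 * (C * quad g z).
  rewrite quad_fadd => hz; have := hC z hz; rewrite ler_norml => /andP[_ ?]; lra.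
have := form_cauchy_schwarz hs s0 (x := x) (y := y).
rewrite /= qg => /(_ hx hy); rewrite rq_fadd => h1.
have h2 := form_cauchy_schwarz hg g0 hx hy.
have h3 : quad (fadd q C g) x * quad (fadd q C g) y <=
    2 * (C * quad g x) * (2 * (C * quad g y)).
  by apply: ler_pM; rewrite ?hle ?s0 //= qg.
set r := rq q x y in h1 *; set s := rq g x y in h1 h2; set X := quad g x * quad g y in h2 *.
have {h1}h3 : (r + C * s) ^+ 2 <= 4 * C ^+ 2 * X.
  by apply: (le_trans h1); apply: (le_trans h3); rewrite /X le_eqVlt; apply/orP; left; apply/eqP; ring.
have h4 : C ^+ 2 * s ^+ 2 <= C ^+ 2 * X by rewrite ler_wpM2l// sqr_ge0.
(* The identity yields r^2 <= 2 (4 C^2 X) + 2 C^2 X. *)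
have -> : r ^+ 2 = 2 * (r + C * s) ^+ 2 + 2 * (C ^+ 2 * s ^+ 2) - (r + 2 * (C * s)) ^+ 2 by ring.
have := sqr_ge0 (r + 2 * (C * s)); lra.
Qed.

Lemma rq_cvg q g (C : R) (u : nat -> H) x y :
  Defs.symmetric_form q -> Defs.symmetric_form g ->
  fdom q = fdom g -> 0 <= C ->
  (forall x, fdom g x -> `|quad q x| <= C * quad g x) ->
  (forall x, fdom g x -> 0 <= quad g x) ->
  (forall n, fdom g (u n)) -> fdom g x -> fdom g y ->
  (forall e : R, 0 < e -> exists N, forall n, (N <= n)%N -> quad g (u n - x) < e) ->
  rq q (u n) y @[n --> \oo] --> rq q x y.
Proof.
move=> hq hg qg C0 hC g0 hu hx hy h; apply/cvgrPdist_lt => e e0.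
have y0 := g0 y hy.
have C2 := sqr_ge0 C.
set K := 10 * C ^+ 2 * quad g y + 1.
have K0 : 0 < K by rewrite ltr_wpDl// !mulr_ge0.
have [N hN] := h (e ^+ 2 / K) (divr_gt0 (exprn_gt0 _ e0) K0).
exists N => // n Nn /=; have := hN n Nn.
rewrite ltr_pdivlMr// => h1.
have hd : fdom g (u n - x) by exact: fdomB.
rewrite distrC -(rqBl hq) ?qg// -(ltr_sqr (x := `|_|)) ?nnegrE ?normr_ge0 ?(ltW e0)//.
rewrite real_normK ?num_real//.
apply: le_lt_trans h1; apply: (le_trans (form_bound hq hg qg C0 hC g0 hd hy)).
have -> : 10 * C ^+ 2 * (quad g (u n - x) * quad g y) =
  quad g (u n - x) * (10 * C ^+ 2 * quad g y) by ring.
by rewrite ler_wpM2l ?g0// lerDl.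
Qed.

Lemma quad_cvg q g (C : R) (u : nat -> H) x :
  Defs.symmetric_form q -> Defs.symmetric_form g ->
  fdom q = fdom g -> 0 <= C ->
  (forall x, fdom g x -> `|quad q x| <= C * quad g x) ->
  (forall x, fdom g x -> 0 <= quad g x) ->
  (forall n, fdom g (u n)) -> fdom g x ->
  (forall e : R, 0 < e -> exists N, forall n, (N <= n)%N -> quad g (u n - x) < e) ->
  quad q (u n) @[n --> \oo] --> quad q x.
Proof.
move=> hq hg qg C0 hC g0 hu hx h.
have -> : quad q x = 0 + 2 * rq q x x - quad q x.
  rewrite /quad -/(rq q x x); ring.
have -> : (fun n => quad q (u n)) =
    (fun n => quad q (u n - x) + 2 * rq q (u n) x - quad q x).
  by apply/funext => n; rewrite (quadB hq) ?qg//; ring.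
apply: cvgB; last exact: cvg_cst.
apply: cvgD; last by apply: cvgM; [exact: cvg_cst|exact: (rq_cvg hq hg qg C0 hC)].
apply/cvgrPdist_lt => e e0.
have [N hN] := h (e / (C + 1)) (divr_gt0 e0 (ltr_wpDl C0 ltr01)).
exists N => // n Nn /=; have := hN n Nn; rewrite ltr_pdivlMr ?ltr_wpDl// => h1.
have hd : fdom g (u n - x) by exact: fdomB.
rewrite sub0r normrN; apply: le_lt_trans (hC _ hd) _.
by apply: le_lt_trans h1; rewrite mulrDr mulr1 mulrC lerDl g0.
Qed.

Lemma form_eq_of_rq q x y : Defs.symmetric_form q -> fdom q x ->
  (forall u, fdom q u -> rq q x u = ip y u) ->
  forall u, fdom q u -> q x u = '[y, u].
Proof.
move=> hq hx h u hu; apply/eqP; rewrite eq_complex; apply/andP; split; apply/eqP.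
  exact: h.
by rewrite -(rqi hq)// h ?ipi//; exact: fdomZ.
Qed.

End FormSum.

(** * The form domain as a Hilbert space *)

Section Base.
Context {R : realType} {H : hilbertType R} {g : qform H}.
Hypothesis hg : Defs.symmetric_form g.
Hypothesis g_ge : forall x, fdom g x -> n2 x <= quad g x.
Hypothesis g_closed : closed_form g.

Lemma base_ge0 x : fdom g x -> 0 <= quad g x.
Proof. by move=> hx; apply: (le_trans (n2_ge0 x)); exact: g_ge. Qed.

(** The rate K / (n + 1) is what the parallelogram law gives for minimising sequences; closedness of
    [g] puts the norm limit back into the form domain. *)
Lemma base_complete (K : R) (u : nat -> H) : (forall n, fdom g (u n)) ->
  (forall n k, quad g (u n - u k) <= K / n.+1%:R + K / k.+1%:R) ->
  exists x, [/\ fdom g x,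
    forall e : R, 0 < e -> exists N, forall n, (N <= n)%N -> quad g (u n - x) < e &
    forall e : R, 0 < e -> exists N, forall n, (N <= n)%N -> n2 (u n - x) < e].
Proof.
move=> hu hK.
have cau (e : R) : 0 < e -> exists N, forall n k, (N <= n)%N -> (N <= k)%N ->
    quad g (u n - u k) < e.
  move=> e0; have e2 : 0 < e / 2 by lra.
  have [N hN] := ex_inv_lt K e2.
  exists N => n k Nn Nk; apply: (le_lt_trans (hK n k)).
  by rewrite [e]splitr ltrD ?hN.
have [|x ux] := @n2_complete R H u.
  move=> e e0; have [N hN] := cau e e0; exists N => n k Nn Nk.
  by apply: le_lt_trans (hN n k Nn Nk); apply: g_ge; exact: fdomB.
have [|hx h] := g_closed hu ux.
  move=> e e0; have [N hN] := cau e e0; exists N => n k Nn Nk.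
  by rewrite ger0_norm ?hN// base_ge0//; exact: fdomB.
have hc e : 0 < e -> exists N, forall n, (N <= n)%N -> quad g (u n - x) < e.
  move=> e0; move/cvgrPdist_lt/(_ e e0) : h => [N _ hN]; exists N => n Nn.
  have := hN n Nn; rewrite /= sub0r normrN; apply: le_lt_trans; exact: ler_norm.
exists x; split=> // e e0; have [N hN] := hc e e0; exists N => n Nn.
by apply: le_lt_trans (hN n Nn); apply: g_ge; exact: fdomB.
Qed.

(** Direct method: x minimises [quad q x - 2 * F x], whose Euler-Lagrange equation is the claim.
    Real linearity of [F] is assumed because the functionals used below are real parts. *)
Lemma riesz q (theta C K : R) (F : H -> R) :
  Defs.symmetric_form q -> fdom q = fdom g -> 0 < theta -> 0 <= K ->
  (forall x, fdom g x -> theta * quad g x <= quad q x <= C * quad g x) ->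
  (forall x y, fdom g x -> fdom g y -> F (x + y) = F x + F y) ->
  (forall (t : R) x, fdom g x -> F (t%:C *: x) = t * F x) ->
  (forall x, fdom g x -> F x ^+ 2 <= K * quad g x) ->
  exists2 x, fdom g x & forall u, fdom g u -> rq q x u = F u.
Proof.
move=> hq qg th0 K0 hth FD FZ FK.
have g0 := base_ge0.
have q0 x : fdom g x -> 0 <= quad q x.
  move=> hx; have /andP[h _] := hth x hx; apply: le_trans h.
  by rewrite mulr_ge0 ?(ltW th0)// g0.
have C0 x : fdom g x -> `|quad q x| <= `|C| * quad g x.
  move=> hx; rewrite ger0_norm ?q0//; have /andP[_ h] := hth x hx.
  by apply: (le_trans h); rewrite ler_wpM2r ?g0// ler_norm.
pose J x := quad q x - 2 * F x.
pose E := [set J x | x in fdom g].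
(* Completing the square: F^2 <= K g gives 2 F <= theta g + K / theta. *)
have Elb : lbound E (- (K / theta)).
  move=> _ [x hx <-]; rewrite /J; have /andP[h _] := hth x hx; have hF := FK x hx.
  rewrite leNgt; apply/negP => hlt.
  have h2 : theta * quad g x + K / theta < 2 * F x by lra.
  have h3 : 0 <= theta * quad g x + K / theta.
    by apply: addr_ge0; [apply: mulr_ge0; [exact: ltW|exact: g0]|apply: divr_ge0 => //; exact: ltW].
  have h4 : (theta * quad g x + K / theta) ^+ 2 < (2 * F x) ^+ 2.
    by rewrite ltr_sqr ?nnegrE// ltW// (le_lt_trans h3).
  have h5 : (theta * quad g x + K / theta) ^+ 2 =
    (theta * quad g x - K / theta) ^+ 2 + 4 * (K * quad g x).
    by field; rewrite gt_eqF.
  have h6 := FK x hx; have h7 := sqr_ge0 (theta * quad g x - K / theta).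
  have h8 : (2 * F x) ^+ 2 = 4 * F x ^+ 2 by ring.
  by move: h4; rewrite h5 h8; clear -h6 h7; lra.
have EI : has_inf E.
  split; last by exists (- (K / theta)).
  by exists (J 0), 0 => //; exact: fdom0.
have Em x : fdom g x -> inf E <= J x.
  by move=> hx; apply: ge_inf; [exact: EI.2|exists x].
have /choice[u hu] : forall n : nat, exists x, fdom g x /\ J x < inf E + n.+1%:R^-1.
  move=> n; have n0 : 0 < n.+1%:R^-1 :> R by rewrite invr_gt0 ltr0n.
  have [_ [x hx <-] hlt] := inf_adherent n0 EI.
  by exists x.
have uV n : fdom g (u n) by case: (hu n).
have uJ n : J (u n) < inf E + n.+1%:R^-1 by case: (hu n).
have [|x [hx ux _]] := @base_complete (2 / theta) u uV.
  move=> n k.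
  have hd : fdom g (u n - u k) by exact: fdomB.
  have hs : fdom g (u n + u k) by exact: fdomD.
  have hh : fdom g ((2^-1)%:C *: (u n + u k)) by exact: fdomZ.
  (* The midpoint of two almost minimisers cannot go below the infimum, so the parallelogram law
     bounds their difference. *)
  have : quad q (u n - u k) <= 2 / n.+1%:R + 2 / k.+1%:R.
    have := Em _ hh; rewrite /J (quadZr hq) ?qg// FZ// FD//.
    have := parallelogram hq (x := u n) (y := u k); rewrite qg => /(_ (uV n) (uV k)).
    have := uJ n; have := uJ k; rewrite /J.
    move: n.+1%:R^-1 k.+1%:R^-1 => p r; lra.
  have /andP[h _] := hth _ hd.
  move=> h'.
  have -> : 2 / theta / n.+1%:R + 2 / theta / k.+1%:R =
      (2 / n.+1%:R + 2 / k.+1%:R) / theta :> R by ring.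
  rewrite ler_pdivlMr// mulrC.
  exact: le_trans h h'.
exists x => // v hv.
have cv := rq_cvg hq hg qg (normr_ge0 C) C0 g0 uV hx hv ux.
apply/subr0_eq/sqr_small_eq0 => e e0.
have v0 : 0 < quad q v + 1 by rewrite ltr_wpDl// q0.
have bnd n : (rq q (u n) v - F v) ^+ 2 <= (quad q v + 1) / n.+1%:R.
  (* Moving [u n] by t v lowers J by at most 1 / (n + 1), which bounds r. The added 1 in the
     denominator covers [quad q v] = 0. *)
  set r := _ - _; set t := - r / (quad q v + 1).
  have htv : fdom g (t%:C *: v) by exact: fdomZ.
  have := Em _ (fdomD hg (uV n) htv); have := uJ n.
  move: n.+1%:R^-1 => p.
  rewrite /J FD// FZ// (quadD hq) ?qg// (quadZr hq) ?qg// (rqZr hq) ?qg//.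
  move=> h1 h2.
  have : 0 <= t ^+ 2 * quad q v + 2 * t * r + p by rewrite /r; lra.
  have -> : t ^+ 2 * quad q v + 2 * t * r + p =
    p - r ^+ 2 / (quad q v + 1) - t ^+ 2.
    by rewrite /t; field; rewrite gt_eqF.
  have := sqr_ge0 t => h3 h4.
  by rewrite mulrC -ler_pdivrMr//; lra.
have cr : (rq q (u n) v - F v) ^+ 2 @[n --> \oo] --> (rq q x v - F v) ^+ 2.
  by apply: cvgM; apply: cvgB => //; exact: cvg_cst.
have e2 : 0 < e / 2 by lra.
have [N hN] := ex_inv_lt (quad q v + 1) e2.
apply: (@le_lt_trans _ _ (e / 2)); last by lra.
rewrite -(cvg_lim _ cr)//; apply: limr_le; first by apply/cvg_ex; eexists; exact: cr.
by exists N => // n /= Nn; apply: (le_trans (bnd n)); apply: ltW; exact: hN.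
Qed.

(** Compactness of the embedding of the form domain into [H], stated for nested sets rather than
    sequences so that no subsequence has to be extracted. *)
Definition form_compact := forall (C : R) (S : nat -> set H),
  (forall n, S n !=set0) -> (forall n, S n.+1 `<=` S n) ->
  S 0%N `<=` [set x | fdom g x /\ quad g x <= C] ->
  exists x, forall n (e : R), 0 < e -> exists2 y, S n y & n2 (y - x) < e.

End Base.

(** * Eigenbases *)

Lemma cvg_le_inv (R : realType) (u : nat -> R) (l m K : R) :
  u n @[n --> \oo] --> l -> (forall n, u n <= m + K / n.+1%:R) -> l <= m.
Proof.
move=> ul h; apply/ler_addgt0Pr => e e0.
have [N hN] := ex_inv_lt K e0.
rewrite -(cvg_lim _ ul)//; apply: limr_le; first by apply/cvg_ex; exists l.
by exists N => // n /= Nn; apply: (le_trans (h n)); rewrite lerD2l ltW// hN.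
Qed.

Section Projection.
Context {R : realType} {H : hilbertType R}.
Implicit Types (e : nat -> H) (x y u : H).

Definition orthonormal_upto e N := forall i j, (i < N)%N -> (j < N)%N ->
  '[e i, e j] = (i == j)%:R.

Definition perp e N x := forall i, (i < N)%N -> '[x, e i] = 0.

Definition proj e N u := \sum_(i < N) '[u, e i] *: e i.

Lemma perpP e N c x y : perp e N x -> perp e N y -> perp e N (c *: x + y).
Proof. by move=> hx hy i iN; rewrite linearDl linearZl_LR /= hx// hy// mulr0 addr0. Qed.

Lemma perp0 e N : perp e N 0.
Proof. by move=> i _; rewrite linear0l. Qed.

Lemma perpD e N x y : perp e N x -> perp e N y -> perp e N (x + y).
Proof. by move=> hx hy; rewrite -[x]scale1r; exact: perpP. Qed.

Lemma perpZ e N c x : perp e N x -> perp e N (c *: x).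
Proof. by move=> hx; rewrite -[_ *: _]addr0; apply: perpP => //; exact: perp0. Qed.

Lemma inner_suml (I : Type) (r : seq I) (P : pred I) (F : I -> H) z :
  '[\sum_(i <- r | P i) F i, z] = \sum_(i <- r | P i) '[F i, z].
Proof. by rewrite linear_sumlz. Qed.

Lemma inner_comb e N (c : 'I_N -> R[i]) (j : 'I_N) : orthonormal_upto e N ->
  '[\sum_(i < N) c i *: e i, e j] = c j.
Proof.
move=> he; rewrite inner_suml (bigD1 j)//= linearZl_LR /= he// eqxx mulr1.
rewrite big1 ?addr0// => i ij; rewrite linearZl_LR /= he//.
by rewrite (negbTE (_ : nat_of_ord i != j)) ?mulr0//.
Qed.

Lemma proj_inner e N u j : orthonormal_upto e N -> (j < N)%N ->
  '[proj e N u, e j] = '[u, e j].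
Proof.
by move=> he jN; rewrite /proj (inner_comb (fun i => '[u, e i]) (Ordinal jN)).
Qed.

Lemma perp_proj e N u : orthonormal_upto e N -> perp e N (u - proj e N u).
Proof. by move=> he i iN; rewrite linearBl /= proj_inner// subrr. Qed.

Lemma comb_perp e N (c : 'I_N -> R[i]) x : perp e N x ->
  '[\sum_(i < N) c i *: e i, x] = 0.
Proof.
move=> hx; rewrite inner_suml big1// => i _.
by rewrite linearZl_LR /= innerC hx// rmorph0 mulr0.
Qed.

Lemma proj_perp e N u x : perp e N x -> '[proj e N u, x] = 0.
Proof. exact: comb_perp. Qed.

Lemma n2_comb e N (c : 'I_N -> R[i]) : orthonormal_upto e N ->
  n2 (\sum_(i < N) c i *: e i) = \sum_(i < N) abs2 (c i).
Proof.
move=> he; rewrite /n2 /ip inner_suml Re_sum; apply: eq_bigr => i _.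
by rewrite linearZl_LR /= innerC inner_comb// mulc_conj.
Qed.

Lemma bessel e N u : orthonormal_upto e N -> \sum_(i < N) abs2 '[u, e i] <= n2 u.
Proof.
move=> he; rewrite -(n2_comb (fun i => '[u, e (nat_of_ord i)]) he) -/(proj e N u).
have -> : n2 u = n2 (proj e N u) + n2 (u - proj e N u).
  have := n2D (proj e N u) (u - proj e N u); rewrite addrC subrK => ->.
  by rewrite /ip proj_perp ?mulr0 ?addr0//; exact: perp_proj.
by rewrite lerDl n2_ge0.
Qed.

Lemma ip_cvg (u : nat -> H) x y : u @ \oo --> x -> ip (u n) y @[n --> \oo] --> ip x y.
Proof.
move=> /cvg_n2 h; apply: (rq_cvg inner_form_sym inner_form_sym (C := 1)) => //.
- by move=> z _; rewrite mul1r ger0_norm// n2_ge0.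
- by move=> z _; exact: n2_ge0.
Qed.

Lemma n2_cvg (u : nat -> H) x : u @ \oo --> x -> n2 (u n) @[n --> \oo] --> n2 x.
Proof.
move=> /cvg_n2 h; apply: (quad_cvg inner_form_sym inner_form_sym (C := 1)) => //.
- by move=> z _; rewrite mul1r ger0_norm// n2_ge0.
- by move=> z _; exact: n2_ge0.
Qed.

Lemma perp_cvg e N (u : nat -> H) x :
  u @ \oo --> x -> (forall n, perp e N (u n)) -> perp e N x.
Proof.
move=> ux h i iN; rewrite -(linear0l (@inner R H) (e i)); apply: inner_eq => c.
rewrite ip0l; apply: (cvg_unique _ (ip_cvg (y := c *: e i) ux)) => //.
rewrite (_ : (fun n => _) = cst 0); first exact: cvg_cst.
by apply/funext => n; rewrite /ip innerZr h// mulr0.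
Qed.

End Projection.

(** A Garding inequality from below and boundedness from above: after a shift the form norm of [q]
    is equivalent to that of [g], so closedness and compactness of [g] serve for [q] as well. *)
Definition admissible (R : realType) (H : hilbertType R) (g q : qform H) :=
  [/\ Defs.symmetric_form q, fdom q = fdom g &
    exists theta C K : R, [/\ 0 < theta, 0 <= C, 0 <= K &
      forall x, fdom g x -> theta * quad g x - C * n2 x <= quad q x <= K * quad g x]].

(** The eigenvalues are the numbers [quad q (e n)]. [eb_min] is the variational property of each
    vector; the ordering of the eigenvalues, the min-max comparisons and completeness rest on it and
    on [eb_unb]. *)
Record eigenbasis (R : realType) (H : hilbertType R) (q : qform H)
    (e : nat -> H) : Prop := EigenBasis {
  eb_dom : forall n, fdom q (e n);
  eb_orth : forall i j, '[e i, e j] = (i == j)%:R;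
  eb_eig : forall n u, fdom q u -> q (e n) u = (quad q (e n))%:C * '[e n, u];
  eb_min : forall N x, fdom q x -> perp e N x -> quad q (e N) * n2 x <= quad q x;
  eb_unb : forall C : R, exists N, C < quad q (e N) }.

Section Eigen.
Context {R : realType} {H : hilbertType R} {g : qform H}.
Hypothesis hg : Defs.symmetric_form g.
Hypothesis g_ge : forall x, fdom g x -> n2 x <= quad g x.
Hypothesis g_closed : closed_form g.
Hypothesis g_cpt : form_compact (g := g).
Hypothesis g_inf : forall (e : nat -> H) N, orthonormal_upto e N ->
  (forall i, (i < N)%N -> fdom g (e i)) ->
  exists w, [/\ fdom g w, w != 0 & perp e N w].

Lemma admissible_abs q : admissible g q ->
  exists2 K : R, 0 <= K & forall x, fdom g x -> `|quad q x| <= K * quad g x.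
Proof.
case=> _ _ [theta [C [K [th0 C0 K0 h]]]]; exists (C + K); first exact: addr_ge0.
move=> x hx; have /andP[h1 h2] := h x hx; have h3 := g_ge hx.
have h4 := n2_ge0 x.
have h5 : C * n2 x <= C * quad g x by rewrite ler_wpM2l.
have g0 := le_trans h4 h3.
have h6 : 0 <= theta * quad g x by apply: mulr_ge0 => //; exact: ltW.
have h7 : 0 <= K * quad g x by rewrite mulr_ge0.
have h8 : 0 <= C * quad g x by rewrite mulr_ge0.
rewrite ler_norml mulrDl; apply/andP; clear -h1 h2 h5 h6 h7 h8; split; lra.
Qed.

(** Compactness provides a minimiser of the Rayleigh quotient on the orthogonal complement of the
    earlier eigenvectors, and the minimiser is itself an eigenvector. The vector [w] ensures that
    this complement meets the form domain nontrivially. *)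
Lemma min_eigvec q (e : nat -> H) N (l : nat -> R) w : admissible g q ->
  (forall i, (i < N)%N -> fdom g (e i)) -> orthonormal_upto e N ->
  (forall i u, (i < N)%N -> fdom g u -> q (e i) u = (l i)%:C * '[e i, u]) ->
  fdom g w -> w != 0 -> perp e N w ->
  exists x, [/\ fdom g x, n2 x = 1, perp e N x,
    forall u, fdom g u -> q x u = (quad q x)%:C * '[x, u] &
    forall y, fdom g y -> perp e N y -> quad q x * n2 y <= quad q y].
Proof.
move=> adq eV eo el wV w0 wp.
have [K1 K10 hK1] := admissible_abs adq.
case: (adq) => hq qg [theta [C [K [th0 C0 K0 hth]]]].
have g0 := base_ge0 g_ge.
pose nrm (y : H) := ((Num.sqrt (n2 y))^-1)%:C *: y.
have nrm1 y : y != 0 -> n2 (nrm y) = 1.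
  by move=> /n2_gt0 y0; rewrite n2Zr exprVn sqr_sqrtr ?(ltW y0)// mulVf// gt_eqF.
pose E := [set quad q x | x in [set x | [/\ fdom g x, perp e N x & n2 x = 1]]].
have EI : has_inf E.
  split.
    exists (quad q (nrm w)), (nrm w) => //; split; last exact: nrm1.
      exact: fdomZ.
    exact: perpZ.
  exists (- C) => _ [x [xV xp x1] <-]; have /andP[h _] := hth x xV.
  by apply: le_trans h; rewrite x1 mulr1 lerDr; apply: mulr_ge0; [exact: ltW|exact: g0].
set m := inf E.
have Em x : fdom g x -> perp e N x -> m * n2 x <= quad q x.
  move=> xV xp; have [->|x0] := eqVneq x 0; first by rewrite n20 (quad0 hq) mulr0.
  have : m <= quad q (nrm x).
    apply: ge_inf; first exact: EI.2.
    exists (nrm x) => //; split; [exact: fdomZ|exact: perpZ|exact: nrm1].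
  rewrite (quadZr hq) ?qg// exprVn sqr_sqrtr ?n2_ge0// mulrC ler_pdivlMr//; exact: n2_gt0.
(* Nested sets of almost minimisers. Compactness supplies a norm limit [x0]; the parallelogram law
   below upgrades norm convergence to convergence in the form norm. *)
pose S (n : nat) := [set x | [/\ fdom g x, perp e N x, n2 x = 1 & quad q x <= m + n.+1%:R^-1]].
have [||| x0 hx0] := g_cpt (C := (m + 1 + C) / theta) (S := S).
- move=> n; have n0 : 0 < n.+1%:R^-1 :> R by rewrite invr_gt0 ltr0n.
  have [_ [x [xV xp x1] <-] hlt] := inf_adherent n0 EI.
  by exists x; split=> //; exact: ltW.
- move=> n x [xV xp x1 h]; split=> //; apply: (le_trans h).
  by rewrite lerD2l lef_pV2 ?posrE ?ltr0n// ler_nat.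
- move=> x [xV xp x1]; rewrite invr1 => h; split=> //.
  rewrite ler_pdivlMr// mulrC; have /andP[h1 _] := hth x xV.
  by move: h1; rewrite x1 mulr1 lerBlDr => /le_trans; apply; rewrite lerD2r.
have /choice[u hu] : forall n : nat, exists x, S n x /\ n2 (x - x0) < n.+1%:R^-1.
  move=> n; have n0 : 0 < n.+1%:R^-1 :> R by rewrite invr_gt0 ltr0n.
  by have [y Sy hy] := hx0 n _ n0; exists y.
have uV n : fdom g (u n) by have [[]] := hu n.
have up n : perp e N (u n) by have [[]] := hu n.
have u1 n : n2 (u n) = 1 by have [[]] := hu n.
have uq n : quad q (u n) <= m + n.+1%:R^-1 by have [[]] := hu n.
have ux n : n2 (u n - x0) < n.+1%:R^-1 by have [] := hu n.
pose K2 := (2 + 2 * (`|m| + C)) / theta.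
have [|x [xV xg xn]] := @base_complete _ _ _ hg g_ge g_closed K2 u uV.
  move=> n k; have dV : fdom g (u n - u k) by exact: fdomB.
  have /andP[h1 _] := hth _ dV.
  have h2 := Em _ (fdomD hg (uV n) (uV k)) (perpD (up n) (up k)).
  have h3 := parallelogram hq (x := u n) (y := u k).
  rewrite qg in h3; have {}h3 := h3 (uV n) (uV k).
  have h4 := parallelogram (@inner_form_sym R H) (x := u n) (y := u k) I I.
  rewrite -[quad _ (u n + u k)]/(n2 _) -[quad _ (u n - u k)]/(n2 _) in h4.
  rewrite -[quad _ (u n)]/(n2 _) -[quad _ (u k)]/(n2 _) !u1 in h4.
  have h5 := uq n; have h6 := uq k.
  have h7 : n2 (u n - u k) <= 2 * n.+1%:R^-1 + 2 * k.+1%:R^-1.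
    have -> : u n - u k = (u n - x0) + - (u k - x0) by rewrite opprB addrA subrK.
    apply: (le_trans (n2D_le _ _)); rewrite n2N.
    by apply: lerD; rewrite ler_pM2l ?ltr0n// ltW.
  have h8 : (m + C) * n2 (u n - u k) <= (`|m| + C) * n2 (u n - u k).
    by rewrite ler_wpM2r ?n2_ge0// lerD2r ler_norm.
  have h9 : (`|m| + C) * n2 (u n - u k) <= (`|m| + C) * (2 * n.+1%:R^-1 + 2 * k.+1%:R^-1).
    by rewrite ler_wpM2l ?addr_ge0.
  have -> : K2 / n.+1%:R + K2 / k.+1%:R =
      (2 * (n.+1%:R^-1 + k.+1%:R^-1) +
       (`|m| + C) * (2 * n.+1%:R^-1 + 2 * k.+1%:R^-1)) / theta by rewrite /K2; ring.
  rewrite ler_pdivlMr// mulrC.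
  have h10 : theta * quad g (u n - u k) <= quad q (u n - u k) + C * n2 (u n - u k) by rewrite -lerBlDr.
  apply: (le_trans h10).
  move: (n.+1%:R^-1) (k.+1%:R^-1) h5 h6 h7 h9 => p r h5 h6 h7 h9.
  have h11 : m * n2 (u n - u k) = 4 * m - m * n2 (u n + u k).
    by rewrite (_ : n2 (u n + u k) = 4 - n2 (u n - u k)); [ring|lra].
  rewrite mulrDl in h8.
  clear - h2 h3 h5 h6 h8 h9 h11; lra.
move/cvg_n2 in xn.
have xp : perp e N x by exact: perp_cvg xn up.
have x1 : n2 x = 1.
  apply: (cvg_unique _ (n2_cvg xn)) => //.
  rewrite (_ : (fun n => _) = cst 1); first exact: cvg_cst.
  by apply/funext => n; rewrite u1.
have xm : quad q x = m.
  apply/eqP; rewrite eq_le; apply/andP; split; last first.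
    by have := Em x xV xp; rewrite x1 mulr1.
  apply: (cvg_le_inv (K := 1) (quad_cvg hq hg qg K10 hK1 g0 uV xV xg)) => n.
  by rewrite div1r.
exists x; split=> //; last by rewrite xm.
have inn : fdom q `<=` fdom (inner_form H) by [].
(* On the complement q - m is nonnegative and vanishes at x, so by Cauchy-Schwarz it vanishes at all
   pairs (x, y): the Euler-Lagrange equation without differentiation. *)
pose W := QForm (fdom g `&` perp e N) (fadd q (- m) (inner_form H)).
have hf : Defs.symmetric_form (fadd q (- m) (inner_form H)).
  by apply: fadd_sym => //; exact: inner_form_sym.
have hW : Defs.symmetric_form W.
  case: hf => /= a1 a2 a3 a4; rewrite qg in a1 a2 a3 a4; split=> /=.
  - by split; [exact: a1|exact: perp0].
  - by move=> c y z [? ?] [? ?]; split; [exact: a2|exact: perpP].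
  - by move=> c y z t [? ?] [? ?] [? ?]; exact: a3.
  - by move=> y z [? ?] [? ?]; exact: a4.
have W0 y : fdom W y -> 0 <= quad W y.
  by move=> [yV yp]; rewrite [quad _ _]quad_fadd mulNr subr_ge0; exact: Em.
have var y : fdom g y -> perp e N y -> rq q x y = m * ip x y.
  move=> yV yp.
  have := form_cauchy_schwarz hW W0 (x := x) (y := y) (conj xV xp) (conj yV yp).
  rewrite [quad W x]quad_fadd [rq W _ _]rq_fadd xm -[quad _ _]/(n2 _) x1 mulr1 subrr mul0r.
  by rewrite mulNr -[rq (inner_form H) _ _]/(ip _ _) => h; apply/eqP; rewrite -subr_eq0 -sqrf_eq0 eq_le h sqr_ge0.
rewrite xm.
suff h : forall u, fdom q u -> q x u = '[m%:C *: x, u].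
  by move=> v vV; rewrite h ?qg// innerZl.
apply: form_eq_of_rq => //; rewrite ?qg// => v vV.
have pV : fdom g (proj e N v) by apply: fdom_sum => // i _; apply: fdomZ => //; exact: eV.
(* For arbitrary v the component along the earlier eigenvectors remains; both sides vanish there
   because x is orthogonal to them. *)
rewrite -[v](subrK (proj e N v)) (rqDr hq) ?qg//; last by exact: fdomB.
rewrite var; [|exact: fdomB|exact: perp_proj].
rewrite ipZl [in RHS]ipDr mulrDr; congr (_ + _).
rewrite ipC /ip proj_perp// mulr0 (rqC hq) ?qg// /rq /proj (form_suml hq) ?qg//; last first.
  by move=> i _; apply: fdomZ => //; exact: eV.
rewrite big1// => i _; rewrite (formZl hq) ?qg//; last exact: eV.
by rewrite el// (innerC (e i)) xp// rmorph0 !mulr0.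
Qed.

Lemma eigenbasis_exists q : admissible g q -> exists e, eigenbasis q e.
Proof.
move=> adq; case: (adq) => hq qg [theta [C [K [th0 C0 K0 hth]]]].
pose P (s : seq H) x := [/\ fdom g x, n2 x = 1, perp (nth 0 s) (size s) x,
    forall u, fdom g u -> q x u = (quad q x)%:C * '[x, u] &
    forall y, fdom g y -> perp (nth 0 s) (size s) y -> quad q x * n2 y <= quad q y].
(* The default 0 does not occur: [min_eigvec] provides a suitable vector at each stage, as the
   induction [hQ] shows. *)
pose next s := xget 0 [set x | P s x].
pose pre n := iter n (fun s => rcons s (next s)) [::].
pose e n := next (pre n).
have size_pre n : size (pre n) = n by elim: n => //= n ih; rewrite size_rcons ih.
have nth_pre N i : (i < N)%N -> nth 0 (pre N) i = e i.
  elim: N => // N ih; rewrite ltnS leq_eqVlt => /orP[/eqP ->|iN] /=.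
    by rewrite nth_rcons size_pre ltnn eqxx.
  by rewrite nth_rcons size_pre iN ih.
have perpE N x : perp (nth 0 (pre N)) (size (pre N)) x <-> perp e N x.
  by rewrite size_pre; split=> h i iN; have := h i iN; rewrite nth_pre.
pose Q N := [/\ fdom g (e N), n2 (e N) = 1, perp e N (e N),
    forall u, fdom g u -> q (e N) u = (quad q (e N))%:C * '[e N, u] &
    forall y, fdom g y -> perp e N y -> quad q (e N) * n2 y <= quad q y].
have orth N : (forall i, (i < N)%N -> Q i) -> orthonormal_upto e N.
  move=> hQ i j iN jN; have [ij|ji|->] := ltngtP i j.
  - have [_ _ h _ _] := hQ j jN; by rewrite innerC h// rmorph0.
  - have [_ _ h _ _] := hQ i iN; by rewrite h.
  - by have [_ h _ _ _] := hQ j jN; rewrite innerxx h.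
have hQ N : Q N.
  elim/ltn_ind: N => N ih; have eo := orth N ih.
  have eV i : (i < N)%N -> fdom g (e i) by move=> /ih[].
  have [w [wV w0 wp]] := g_inf eo eV.
  have [|x [xV x1 xp xe xm]] := min_eigvec (l := fun n => quad q (e n)) adq eV eo _ wV w0 wp.
    by move=> i u iN uV; have [_ _ _ h _] := ih i iN; exact: h.
  have : P (pre N) (e N).
    apply: (@xgetPex _ 0 [set x | P (pre N) x]); exists x; split=> //; first exact/perpE.
    by move=> y yV /perpE; exact: xm.
  case=> a1 a2 /perpE a3 a4 a5; split=> // y yV /perpE; exact: a5.
exists e; split.
- by move=> n; rewrite qg; have [] := hQ n.
- move=> i j; apply: (orth (maxn i j).+1) => [k _| |]; first exact: hQ.
    by rewrite ltnS leq_maxl.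
  by rewrite ltnS leq_maxr.
- by move=> n u; rewrite qg; have [_ _ _ h _] := hQ n; exact: h.
- by move=> n u; rewrite qg; have [_ _ _ _ h] := hQ n; exact: h.
(* Bounded eigenvalues would make the tails of [e] bounded in [g]; a norm cluster point would then
   bring two orthonormal vectors within squared distance 1, whereas that squared distance is 2. *)
move=> C1; apply: contrapT => /forallNP h.
have [||| x hx] := g_cpt (C := (C1 + C) / theta) (S := fun n => [set e k | k in [set k | (n <= k)%N]]).
- by move=> n; exists (e n), n => /=.
- by move=> n _ [k /= nk <-]; exists k => //=; exact: ltnW.
- move=> _ [k _ <-]; have [eV e1 _ _ _] := hQ k; split=> //.
  have /andP[h1 _] := hth _ eV; rewrite e1 mulr1 lerBlDr in h1.
  rewrite ler_pdivlMr// mulrC; apply: (le_trans h1).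
  by rewrite lerD2r leNgt; apply/negP; exact: h.
have p4 : 0 < 4^-1 :> R by rewrite invr_gt0 ltr0n.
have [_ [i _ <-] hi] := hx 0%N 4^-1 p4.
have [_ [j /= ij <-] hj] := hx i.+1 4^-1 p4.
have : n2 (e i - e j) < 1.
  have -> : e i - e j = (e i - x) + - (e j - x) by rewrite opprB addrA subrK.
  by apply: (le_lt_trans (n2D_le _ _)); rewrite n2N; lra.
have [_ ei1 _ _ _] := hQ i; have [_ ej1 ejp _ _] := hQ j.
rewrite n2B ei1 ej1 ipC /ip ejp//= mulr0 subr0; lra.
Qed.

End Eigen.

(** * Dimension counts, negative index and kernel of a form *)

Lemma nontrivial_kernel (K : fieldType) (k N : nat) (f : 'I_k -> 'I_N -> K) :
  (N < k)%N -> exists c : 'I_k -> K,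
    (exists i, c i != 0) /\ forall j, \sum_i c i * f i j = 0.
Proof.
move=> Nk; pose M := \matrix_(i < k, j < N) f i j.
have : kermx M != 0.
  rewrite -mxrank_eq0 mxrank_ker -lt0n subn_gt0.
  exact: leq_ltn_trans (rank_leq_col M) Nk.
move=> /rowV0Pn[v /sub_kermxP vM v0]; exists (fun i => v 0 i); split.
  apply: contrapT => /forallNP h; move/negP: v0; apply; apply/eqP/rowP => i.
  by rewrite mxE; apply/eqP/negPn/negP; exact: h.
move=> j; move/rowP/(_ j): vM; rewrite !mxE => h; rewrite -[RHS]h.
by apply: eq_bigr => i _; rewrite mxE.
Qed.

Lemma has_dim_unique (K : fieldType) (V : lmodType K) (W : set V) (k1 k2 : nat) :
  has_dim W k1 -> has_dim W k2 -> k1 = k2.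
Proof.
wlog : k1 k2 / (k1 <= k2)%N.
  by move=> h h1 h2; have [/h|/ltnW/h] := leqP k1 k2; [exact|move=> ->].
rewrite leq_eqVlt => /orP[/eqP //|k12] [e [We fe]] [f [Wf ff]]; exfalso.
have /choice[M hM] : forall i : 'I_k2, exists c : 'I_k1 -> K, f i = \sum_j c j *: e j.
  move=> i; have : W (f i).
    rewrite Wf; exists (fun j => (j == i)%:R).
    rewrite (bigD1 i)//= eqxx scale1r big1 ?addr0// => j ji.
    by rewrite (negbTE ji) scale0r.
  by rewrite We.
have [c [[i ci] hc]] := nontrivial_kernel M k12.
move/negP: ci; apply; apply/eqP; apply: ff.
under eq_bigr do rewrite hM scaler_sumr.
rewrite exchange_big big1// => j _ /=.
by under eq_bigr do rewrite scalerA; rewrite -scaler_suml hc scale0r.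
Qed.

(** The negative index is at least k. For a symmetric form the [v i] are automatically independent,
    since the form is 0 at 0, and the same vectors witness the statement for any smaller form. *)
Definition neg_dim (R : realType) (H : hilbertType R) (q : qform H) (k : nat) :=
  exists v : 'I_k -> H, (forall i, fdom q (v i)) /\
    forall c : 'I_k -> R[i], (exists i, c i != 0) ->
      quad q (\sum_i c i *: v i) < 0.

Lemma exists_perp_comb (R : realType) (H : hilbertType R) (e : nat -> H)
    (N k : nat) (v : 'I_k -> H) : (N < k)%N ->
  exists c : 'I_k -> R[i], (exists i, c i != 0) /\ perp e N (\sum_i c i *: v i).
Proof.
move=> Nk; have [c [c0 hc]] := nontrivial_kernel (fun i (j : 'I_N) => '[v i, e j]) Nk.
exists c; split=> // j jN; rewrite inner_suml -[RHS](hc (Ordinal jN)).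
by apply: eq_bigr => i _; rewrite linearZl_LR.
Qed.

Definition form_kernel (R : realType) (H : hilbertType R) (q : qform H) : set H :=
  [set x | fdom q x /\ forall u, fdom q u -> q x u = 0].

Section EigenBasis.
Context {R : realType} {H : hilbertType R} {q : qform H} {e : nat -> H}.
Hypothesis hq : Defs.symmetric_form q.
Hypothesis eb : eigenbasis q e.
Let l n := quad q (e n).

Lemma eb_upto N : orthonormal_upto e N.
Proof. by move=> i j _ _; exact: eb_orth eb i j. Qed.

Lemma eb_n2 n : n2 (e n) = 1.
Proof. by rewrite /n2 /ip (eb_orth eb) eqxx. Qed.

Lemma eb_nondecr i j : (i <= j)%N -> l i <= l j.
Proof.
move=> ij; rewrite /l -[X in X <= _]mulr1 -(eb_n2 j); apply: (eb_min eb (eb_dom eb j)).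
by move=> k ki; rewrite (eb_orth eb) gtn_eqF// (leq_trans ki).
Qed.

Lemma eb_eigr n u : fdom q u -> q u (e n) = (l n)%:C * '[u, e n].
Proof.
move=> hu; have hn := eb_dom eb n.
rewrite (formC hq)// (eb_eig eb)// rmorphM /= conj_real.
by rewrite -innerC.
Qed.

Lemma eb_comb_dom N (c : 'I_N -> R[i]) : fdom q (\sum_(i < N) c i *: e i).
Proof. by apply: (fdom_sum hq) => i _; apply: (fdomZ hq); exact: eb_dom. Qed.

Lemma eb_comb N (c : 'I_N -> R[i]) u : fdom q u ->
  q (\sum_(i < N) c i *: e i) u = \sum_(i < N) c i * ((l i)%:C * '[e i, u]).
Proof.
move=> hu; rewrite (form_suml hq)//; last by move=> i _; apply: (fdomZ hq); exact: eb_dom.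
by apply: eq_bigr => i _; rewrite (formZl hq) ?(eb_eig eb)//; exact: eb_dom.
Qed.

Lemma quad_comb N (c : 'I_N -> R[i]) :
  quad q (\sum_(i < N) c i *: e i) = \sum_(i < N) l i * abs2 (c i).
Proof.
rewrite /quad eb_comb ?Re_sum; last exact: eb_comb_dom.
apply: eq_bigr => i _; rewrite innerC (inner_comb c i (@eb_upto N)).
by rewrite mulrCA mulc_conj -rmorphM.
Qed.

Lemma quad_comb_le N (c : 'I_N -> R[i]) t : (forall i, (i < N)%N -> l i <= t) ->
  quad q (\sum_(i < N) c i *: e i) <= t * n2 (\sum_(i < N) c i *: e i).
Proof.
move=> h; rewrite quad_comb (n2_comb c (@eb_upto N)) mulr_sumr.
by apply: ler_sum => i _; rewrite ler_wpM2r ?abs2_ge0// h.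
Qed.

Lemma n2_comb_gt0 N (c : 'I_N -> R[i]) : (exists i, c i != 0) ->
  0 < n2 (\sum_(i < N) c i *: e i).
Proof.
move=> [i ci]; rewrite (n2_comb c (@eb_upto N)) (bigD1 i)//=.
rewrite ltr_wpDr ?abs2_gt0//; apply: sumr_ge0 => j _; exact: abs2_ge0.
Qed.

(** Min-max with eigenvalues numbered from 0, hence [k.+1] against [l k]. Some nonzero combination
    of k + 1 negative directions is orthogonal to the first k eigenvectors, where [q] is at least
    [l k]; conversely the first k + 1 eigenvectors serve. *)
Lemma neg_dimP k : neg_dim q k.+1 <-> l k < 0.
Proof.
split=> [[v [vV hv]]|lk].
  have [c [c0 hc]] := exists_perp_comb e v (ltnSn k).
  have xV : fdom q (\sum_i c i *: v i).
    by apply: (fdom_sum hq) => i _; apply: (fdomZ hq); exact: vV.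
  have h1 := hv c c0; have h2 := eb_min eb xV hc.
  rewrite ltNge; apply/negP => h3; have := lt_le_trans h1 (mulr_ge0 h3 (n2_ge0 _)).
  by move=> h4; have := le_lt_trans h2 (lt_le_trans h1 (lexx 0)); rewrite ltNge mulr_ge0// n2_ge0.
exists (fun i => e i); split=> [i|c c0]; first exact: eb_dom.
apply: (@le_lt_trans _ _ (l k * n2 (\sum_i c i *: e i))).
  by apply: quad_comb_le => i; rewrite ltnS => /eb_nondecr.
by rewrite nmulr_rlt0//; exact: n2_comb_gt0.
Qed.

Lemma neg_dim_le j k : (j <= k)%N -> neg_dim q k -> neg_dim q j.
Proof.
case: j => [_ _|j]; first by exists (fun=> 0); split=> [[]//|c [[]]].
case: k => // k jk /neg_dimP lk; apply/neg_dimP; apply: le_lt_trans lk.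
exact: eb_nondecr.
Qed.

(** By [eb_min] the Rayleigh quotient of a nonzero such x would bound every eigenvalue, against
    [eb_unb]. *)
Lemma eb_complete x : fdom q x -> (forall n, '[x, e n] = 0) -> x = 0.
Proof.
move=> xV h; apply: n2_eq0; apply/eqP/negPn/negP => x0.
have x0' : 0 < n2 x by rewrite lt_def x0 n2_ge0.
have [N hN] := eb_unb eb (quad q x / n2 x).
have := eb_min eb xV (N := N) (fun i _ => h i).
by rewrite leNgt -ltr_pdivrMr// hN.
Qed.

Lemma eb_first_pos (t : R) : exists m, t < l m /\ forall j, (j < m)%N -> l j <= t.
Proof.
have ex : exists n, t < l n := eb_unb eb t.
exists (ex_minn ex); case: ex_minnP => m lm hm; split=> // j jm.
by rewrite leNgt; apply/negP => /hm; rewrite leqNgt jm.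
Qed.

Lemma eb_first_nonneg (t : R) : exists m, t <= l m /\ forall j, (j < m)%N -> l j < t.
Proof.
have ex : exists n, t <= l n by have [n h] := eb_unb eb t; exists n; exact: ltW.
exists (ex_minn ex); case: ex_minnP => m lm hm; split=> // j jm.
by rewrite ltNge; apply/negP => /hm; rewrite leqNgt jm.
Qed.

(** As [l] is nondecreasing, its zeros form one block m <= j < m', and the corresponding
    eigenvectors span the kernel. *)
Lemma form_kernel_dim : exists2 k, has_dim (form_kernel q) k &
  ([set j | l j = 0] #= `I_k)%card.
Proof.
have [m [lm hm]] := eb_first_nonneg 0; have [m' [lm' hm']] := eb_first_pos 0.
have mm : (m <= m')%N.
  rewrite leqNgt; apply/negP => /hm h; by have := lt_trans lm' h; rewrite ltxx.
have lE j : (l j = 0) <-> (m <= j)%N /\ (j < m')%N.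
  split=> [lj|[mj jm]].
    split; rewrite leqNgt; apply/negP; first by move=> /hm; rewrite lj ltxx.
    rewrite ltnS => /eb_nondecr; rewrite lj => h.
    by have := lt_le_trans lm' h; rewrite ltxx.
  by apply/eqP; rewrite eq_le hm'//= (le_trans lm)// eb_nondecr.
exists (m' - m)%N; last first.
  have -> : [set j | l j = 0] = `I_m' `\` `I_m.
    apply/seteqP; split=> j /=; rewrite lE.
      by move=> [mj jm]; split=> //=; apply/negP; rewrite -leqNgt.
    by move=> [jm /negP]; rewrite -leqNgt.
  exact: card_IID.
pose f i := e (m + i)%N.
have fV i : fdom q (f i) by exact: (eb_dom eb).
have l0 (i : 'I_(m' - m)) : l (m + i)%N = 0.
  by apply/lE; rewrite leq_addr -ltn_subRL.
have fo : orthonormal_upto f (m' - m)%N.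
  by move=> i j _ _; rewrite (eb_orth eb) eqn_add2l.
exists (fun i => f i); split; last first.
  by move=> c hc i; rewrite -(inner_comb c i fo) hc linear0l.
apply/seteqP; split=> [x [xV hx]|_ [c ->]] /=.
  have hj j : l j != 0 -> '[x, e j] = 0.
    move=> lj; have := hx (e j) (eb_dom eb j); rewrite eb_eigr// => /eqP.
    by rewrite mulf_eq0 => /orP[/eqP[] /eqP|/eqP //]; rewrite (negbTE lj).
  (* Removing the components along the block leaves a kernel vector orthogonal to the first m'
     eigenvectors. There the form is at least [l m'] > 0 times the squared norm, so nothing is
     left. *)
  exists (fun i => '[x, f i]); apply/subr0_eq.
  set s := \sum_i _; have sV : fdom q s.
    by apply: (fdom_sum hq) => i _; apply: (fdomZ hq); exact: fV.
  have dV : fdom q (x - s) by exact: fdomB.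
  have sk u : fdom q u -> q s u = 0.
    move=> uV; rewrite (form_suml hq)//; last first.
      by move=> i _; apply: (fdomZ hq); exact: fV.
    rewrite big1// => i _; rewrite (formZl hq) ?(eb_eig eb)//; try exact: fV.
    by rewrite -/(l _) l0 mul0r mulr0.
  apply: n2_eq0; apply/eqP; rewrite eq_le n2_ge0 andbT.
  rewrite -(pmulr_rle0 _ lm'); apply: (le_trans (eb_min eb dV _)).
    move=> j jm; have [jlt|mj] := ltnP j m.
      rewrite linearBl /= (hj j) ?(lt_eqF (hm j jlt))// sub0r.
      rewrite inner_suml big1 ?oppr0// => i _; rewrite linearZl_LR /= (eb_orth eb).
      by rewrite gtn_eqF ?mulr0// ltn_addr.
    have jk : (j - m < m' - m)%N by rewrite ltn_sub2r// (leq_ltn_trans mj).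
    rewrite linearBl /= -{2}(subnKC mj) -/(f _).
    rewrite (inner_comb (fun i => '[x, f i]) (Ordinal jk) fo) /= /f subnKC//.
    by rewrite subrr.
  suff h u : fdom q u -> q (x - s) u = 0 by rewrite /quad h.
  by move=> uV; rewrite addrC -scaleN1r (formPl hq)// sk// hx// mulr0 addr0.
have sV : fdom q (\sum_(i < m' - m) c i *: f i).
  by apply: (fdom_sum hq) => i _; apply: (fdomZ hq); exact: fV.
split=> // u uV; rewrite (form_suml hq)//; last first.
  by move=> i _; apply: (fdomZ hq); exact: fV.
rewrite big1// => i _; rewrite (formZl hq) ?(eb_eig eb)//; try exact: fV.
by rewrite -/(l _) l0 mul0r mulr0.
Qed.

Lemma quad_proj_perp m x : fdom q x ->
  quad q x = \sum_(i < m) l i * abs2 '[x, e i] + quad q (x - proj e m x).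
Proof.
move=> xV; rewrite -(quad_comb (fun i => '[x, e i])) -/(proj e m x).
have pV : fdom q (proj e m x) by exact: eb_comb_dom.
have dV : fdom q (x - proj e m x) by exact: fdomB.
have := quadD hq pV dV; rewrite addrC subrK => ->.
rewrite /rq eb_comb// big1 ?mulr0 ?addr0// => i _.
by rewrite (innerC (e i)) (perp_proj _ (@eb_upto m))// rmorph0 !mulr0.
Qed.

End EigenBasis.

(** * Weak solvability for a form without zero eigenvalue *)

Section Solve.
Context {R : realType} {H : hilbertType R} {g : qform H}.
Hypothesis hg : Defs.symmetric_form g.
Hypothesis g_ge : forall x, fdom g x -> n2 x <= quad g x.
Hypothesis g_closed : closed_form g.

(* Flipping the sign of the finitely many negative eigenvalues turns the form
   into a coercive one. *)
Lemma form_solve q e : admissible g q -> eigenbasis q e ->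
  (forall n, quad q (e n) != 0) ->
  exists2 C0 : R, 0 <= C0 & forall (F : H -> R) (K : R), 0 <= K ->
    (forall x y, fdom g x -> fdom g y -> F (x + y) = F x + F y) ->
    (forall (t : R) x, fdom g x -> F (t%:C *: x) = t * F x) ->
    (forall x, fdom g x -> F x ^+ 2 <= K * quad g x) ->
    exists x, [/\ fdom g x, forall u, fdom g u -> rq q x u = F u &
                  quad g x <= C0 * K].
Proof.
move=> adq eb l0; case: (adq) => hq qg [theta [C [K1 [th0 C0 K10 hth]]]].
have g0 := base_ge0 g_ge.
pose l n := quad q (e n).
have eo m : orthonormal_upto e m by exact: (eb_upto eb).
have [m [lm hm]] := eb_first_pos eb 0.
(* A spectral gap around 0. If m = 0 there are no negative eigenvalues and [l 0] itself serves. *)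
have [d [d0 dm hd]] : exists d : R, [/\ 0 < d, d <= l m & forall j, (j < m)%N -> l j <= - d].
  case: m lm hm => [lm _|m lm hm]; first by exists (l 0%N); split.
  have lm0 : l m < 0 by rewrite lt_neqAle l0 hm.
  exists (Num.min (l m.+1) (- l m)); split.
  - by rewrite lt_min lm oppr_gt0 lm0.
  - by rewrite ge_min lexx.
  - move=> j jm; apply: (le_trans (eb_nondecr eb (jm : (j <= m)%N))).
    by rewrite lerNr ge_min lexx orbT.
pose p := QForm [set: H] (fun x y => \sum_(i < m) (l i)%:C * ('[x, e i] * '[e i, y])).
have hp : Defs.symmetric_form p.
  split=> //= [c x y z _ _ _|x y _ _].
    rewrite mulr_sumr -big_split; apply: eq_bigr => i _ /=.
    by rewrite linearDl linearZl_LR /=; ring.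
  rewrite rmorph_sum; apply: eq_bigr => i _ /=.
  by rewrite !rmorphM /= conj_real -!innerC (mulrC '[x, _]).
have quadp x : quad p x = \sum_(i < m) l i * abs2 '[x, e i].
  rewrite /quad Re_sum; apply: eq_bigr => i _.
  by rewrite (innerC (e i)) mulc_conj -rmorphM.
have ab0 (x : H) (i : nat) : 0 <= abs2 '[x, e i] by exact: abs2_ge0.
have p_le x : quad p x <= - (d * \sum_(i < m) abs2 '[x, e i]).
  rewrite quadp mulr_sumr -sumrN; apply: ler_sum => i _.
  by rewrite -mulNr ler_wpM2r// hd.
have p_le0 x : quad p x <= 0.
  by apply: (le_trans (p_le x)); rewrite oppr_le0 mulr_ge0 ?(ltW d0)// sumr_ge0.
have p_ge x : - (`|l 0%N| * n2 x) <= quad p x.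
  apply: (@le_trans _ _ (- (`|l 0%N| * \sum_(i < m) abs2 '[x, e i]))).
    by rewrite lerN2 ler_wpM2l// bessel.
  rewrite quadp mulr_sumr -sumrN; apply: ler_sum => i _.
  rewrite -mulNr ler_wpM2r//; apply: (@le_trans _ _ (l 0%N)).
    by rewrite lerNl -normrN ler_norm.
  exact: (eb_nondecr eb).
pose q' := fadd q (-2) p.
have hq' : Defs.symmetric_form q' by exact: fadd_sym.
have quadq' x : quad q' x = quad q x - 2 * quad p x by rewrite quad_fadd mulNr.
have q'q x : quad q x <= quad q' x.
  by rewrite quadq' lerDl oppr_ge0 pmulr_rle0.
have q'n2 x : fdom g x -> d * n2 x <= quad q' x.
  move=> xV; rewrite quadq' (quad_proj_perp hq eb m) ?qg// -quadp.
  have pV : fdom q (proj e m x) by exact: (eb_comb_dom hq eb).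
  have dV : fdom q (x - proj e m x) by apply: (fdomB hq) => //; rewrite qg.
  have h1 := eb_min eb dV (perp_proj x (eo m)).
  have h2 : d * n2 (x - proj e m x) <= quad q (e m) * n2 (x - proj e m x).
    by rewrite ler_wpM2r ?n2_ge0.
  have h3 : n2 x = \sum_(i < m) abs2 '[x, e i] + n2 (x - proj e m x).
    have := n2D (proj e m x) (x - proj e m x); rewrite addrC subrK => ->.
    rewrite /ip proj_perp ?mulr0 ?addr0//; last exact: perp_proj.
    by rewrite (n2_comb (fun i => '[x, e (nat_of_ord i)]) (eo m)).
  have h4 := p_le x; rewrite h3 mulrDr.
  move: h1 h2 h4; clear; lra.
pose th' := theta / (1 + C / d).
have Cd : 0 < 1 + C / d by rewrite ltr_wpDr// divr_ge0// ltW.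
have th'0 : 0 < th' by rewrite divr_gt0.
have q'g x : fdom g x -> th' * quad g x <= quad q' x.
  move=> xV; rewrite /th' mulrAC ler_pdivrMr// mulrDr mulr1.
  have /andP[h1 _] := hth x xV; have h2 := q'q x; have h3 := q'n2 x xV.
  have h4 : C * n2 x <= quad q' x * (C / d).
    by rewrite mulrCA ler_wpM2l// ler_pdivlMr// mulrC.
  move: h1 h2 h4; clear; lra.
have q'K x : fdom g x -> quad q' x <= (K1 + 2 * `|l 0%N|) * quad g x.
  move=> xV; rewrite quadq' mulrDl; have /andP[_ h1] := hth x xV.
  have h2 := p_ge x; have h3 : `|l 0%N| * n2 x <= `|l 0%N| * quad g x.
    by rewrite ler_wpM2l// g_ge.
  move: h1 h2 h3; clear; lra.
(* [J] is a reflection, J^2 = 1, with q(x, J u) = q'(x, u). Hence the weak solution for [q'] with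
   the functional F o J solves the problem for [q] with F. *)
pose J x := x - 2%:C *: proj e m x.
have pV x : fdom g (proj e m x) by rewrite -qg; exact: (eb_comb_dom hq eb).
have JV x : fdom g x -> fdom g (J x).
  by move=> xV; apply: fdomB => //; apply: fdomZ.
have projD x y : proj e m (x + y) = proj e m x + proj e m y.
  by rewrite /proj -big_split; apply: eq_bigr => i _; rewrite linearDl scalerDl.
have projZ c x : proj e m (c *: x) = c *: proj e m x.
  by rewrite /proj scaler_sumr; apply: eq_bigr => i _; rewrite linearZl_LR /= scalerA.
have projK x : proj e m (proj e m x) = proj e m x.
  by apply: eq_bigr => i _; rewrite proj_inner.
have JK x : J (J x) = x.
  have pJ : proj e m (J x) = - proj e m x.
    rewrite {1}/J projD -scaleN1r scalerA projZ projK mulN1r scaleNr.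
    by rewrite rmorphD /= rmorph1 scalerDl scale1r opprD addrA subrr sub0r.
  by rewrite {1}/J pJ scalerN opprK /J subrK.
pose CJ := 2 + 8 * (C / theta).
have CJ0 : 0 <= CJ by rewrite addr_ge0// mulr_ge0// divr_ge0// ltW.
have gJ x : fdom g x -> quad g (J x) <= CJ * quad g x.
  move=> xV; have pxV := pV x.
  have h1 : quad g (J x) <= 2 * quad g x + 8 * quad g (proj e m x).
    have := quadD_le hg g0 xV (fdomN hg (fdomZ hg (2%:C) pxV)).
    rewrite (quadN hg) ?(quadZr hg)//; last exact: fdomZ.
    move=> h; apply: (le_trans h); rewrite le_eqVlt; apply/orP; left; apply/eqP; ring.
  have /andP[h2 _] := hth _ pxV.
  have h3 : quad q (proj e m x) <= 0.
    rewrite (quad_comb hq eb (fun i : 'I_m => '[x, e i])) -quadp; exact: p_le0.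
  have h4 : quad g (proj e m x) <= C / theta * n2 (proj e m x).
    rewrite mulrAC ler_pdivlMr// mulrC; move: h2 h3; clear; lra.
  have h5 : n2 (proj e m x) <= quad g x.
    apply: le_trans (g_ge xV).
    by rewrite (n2_comb (fun i => '[x, e (nat_of_ord i)]) (eo m)) bessel.
  have h6 : C / theta * n2 (proj e m x) <= C / theta * quad g x.
    by apply: ler_wpM2l h5; rewrite divr_ge0// ltW.
  rewrite /CJ mulrDl; move: h1 h4 h6; clear; lra.
have rqJ x u : fdom g x -> fdom g u -> rq q x (J u) = rq q' x u.
  move=> xV uV; have puV := pV u.
  rewrite rq_fadd mulNr (rqBr hq) ?qg//; last exact: fdomZ.
  rewrite (rqZr hq) ?qg//; congr (_ - 2 * _).
  rewrite (rqC hq) ?qg// /rq /proj (eb_comb hq eb) ?qg//.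
  rewrite -[LHS]Re_conj rmorph_sum; congr (complex.Re _); apply: eq_bigr => i _ /=.
  by rewrite !rmorphM /= conj_real -!innerC; ring.
exists (CJ / th' ^+ 2); first by rewrite divr_ge0 ?sqr_ge0.
move=> F K K0 FD FZ FK.
have FJ x : fdom g x -> F (J x) ^+ 2 <= K * CJ * quad g x.
  move=> xV; apply: (le_trans (FK _ (JV _ xV))).
  by rewrite -mulrA ler_wpM2l// gJ.
have JD x y : J (x + y) = J x + J y.
  by rewrite /J projD scalerDr opprD addrACA.
have JZ c x : J (c *: x) = c *: J x.
  by rewrite /J projZ scalerBr !scalerA mulrC.
have [|||x xV hx] := @riesz _ _ _ hg g_ge g_closed q' th' (K1 + 2 * `|l 0%N|)
    (K * CJ) (fun x => F (J x)) hq' qg th'0 (mulr_ge0 K0 CJ0) _ _ _ FJ.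
- by move=> x xV; rewrite q'g// q'K.
- by move=> x y xV yV; rewrite JD FD//; exact: JV.
- by move=> t x xV; rewrite JZ FZ//; exact: JV.
exists x; split=> //.
  move=> u uV; rewrite -{1}[u]JK rqJ//; last exact: JV.
  by rewrite hx ?JK//; exact: JV.
have h1 := q'g x xV; have h2 := FJ x xV; have h3 := hx x xV.
rewrite -[rq _ _ _]/(quad q' x) in h3; rewrite -h3 in h2.
have gx := g0 x xV.
have h4 : (th' * quad g x) ^+ 2 <= quad q' x ^+ 2.
  have tg : 0 <= th' * quad g x by apply: mulr_ge0 => //; exact: ltW.
  by rewrite ler_sqr ?nnegrE// (le_trans tg).
have [gx0|gx0] := lerP (quad g x) 0.
  by apply: (le_trans gx0); rewrite mulr_ge0// divr_ge0// sqr_ge0.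
have := le_trans h4 h2; rewrite exprMn (expr2 (quad g x)) mulrA ler_pM2r// => h5.
by rewrite mulrAC ler_pdivlMr ?exprn_gt0// mulrC (mulrC CJ).
Qed.

End Solve.

(** At a first disagreement n with l1 n < l2 n, all occurrences of the value l1 n in l2 lie before
    n, where the lists agree, while l1 has one more at n itself; yet both counts equal the same
    multiplicity. *)
Lemma eigenvalue_sequence_unique (R : realType) (E : normedModType R[i])
    (T : set (E * E)) (J : set R) (lam lam' : R^nat) :
  eigenvalue_sequence T J lam -> eigenvalue_sequence T J lam' -> lam = lam'.
Proof.
have aux (l1 l2 : R^nat) n : eigenvalue_sequence T J l1 -> eigenvalue_sequence T J l2 ->
    (forall m, (m < n)%N -> l1 m = l2 m) -> l2 n <= l1 n.
  move=> [nd1 J1 h1] [nd2 J2 h2] eqn; rewrite leNgt; apply/negP => lt12.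
  have [k1 d1 c1] := h1 _ (J1 n); have [k2 d2 c2] := h2 _ (J1 n).
  have kk := has_dim_unique d1 d2; rewrite -kk in c2.
  have sub : [set j | l2 j = l1 n] `<=` [set j | l1 j = l1 n] `\ n.
    move=> j /= hj; have [jn|nj] := ltnP j n.
      by split; [rewrite eqn|move=> jn'; rewrite jn' ltnn in jn].
    by have := nd2 _ _ nj; rewrite hj leNgt lt12.
  have fin1 : finite_set [set j | l1 j = l1 n] by apply/finite_setP; exists k1.
  have fin2 : finite_set [set j | l2 j = l1 n] by apply/finite_setP; exists k1.
  have nin : n \in fset_set [set j | l1 j = l1 n] by rewrite in_fset_set//; apply/mem_set.
  have := cardfsD1 n (fset_set [set j | l1 j = l1 n]).
  rewrite nin (card_fset_set c1) -(card_fset_set c2) add1n => /eqP.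
  rewrite eqn_leq => /andP[_]; apply/negP; rewrite -ltnNge ltnS.
  apply: fsubset_leq_card; apply/fsubsetP => j.
  rewrite in_fset_set// => /set_mem /sub [hj jn].
  by rewrite in_fsetD1 in_fset_set// mem_set// andbT; apply/eqP.
move=> s1 s2; apply/funext; elim/ltn_ind => n ih.
apply/eqP; rewrite eq_le (aux _ _ _ s1 s2 ih) andbT.
by apply: aux s2 s1 _ => m /ih.
Qed.

(** * Monotone families of forms *)

Section Family.
Context {R : realType} {H : hilbertType R} {g : qform H}.
Hypothesis hg : Defs.symmetric_form g.
Hypothesis g_ge : forall x, fdom g x -> n2 x <= quad g x.
Hypothesis g_eb : forall q, admissible g q -> exists e, eigenbasis q e.
Variables (q : R -> qform H) (mu : R).
Hypothesis q_adm : forall t, mu < t -> admissible g (q t).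
Hypothesis q_mono : forall t t' x, mu < t -> t < t' -> fdom g x -> x != 0 ->
  quad (q t) x <= 0 -> quad (q t') x < 0.
Hypothesis q_cont : forall t, mu < t -> exists C d : R, [/\ 0 <= C, 0 < d &
  forall t', mu < t' -> `|t' - t| < d -> forall x, fdom g x ->
    `|quad (q t') x - quad (q t) x| <= C * `|t' - t| * quad g x].
Hypothesis q_unb : forall k t0, exists2 t, t0 < t & neg_dim (q t) k.

Lemma fam_sym t : mu < t -> Defs.symmetric_form (q t).
Proof. by move=> /q_adm[]. Qed.

Lemma fam_dom t : mu < t -> fdom (q t) = fdom g.
Proof. by move=> /q_adm[]. Qed.

(** Decrease is assumed once the form is nonpositive; that suffices, because the index sees negative
    directions alone. *)
Lemma fam_mono t t' k : mu < t -> t <= t' -> neg_dim (q t) k -> neg_dim (q t') k.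
Proof.
move=> mt; rewrite le_eqVlt => /orP[/eqP <-//|tt'] [v [vV hv]].
have mt' := lt_trans mt tt'.
exists v; split=> [i|c c0]; first by rewrite fam_dom// -(fam_dom mt).
have xV : fdom (q t) (\sum_i c i *: v i).
  by apply: (fdom_sum (fam_sym mt)) => i _; apply: (fdomZ (fam_sym mt)); exact: vV.
apply: (q_mono mt) => //; first by rewrite -(fam_dom mt).
  apply/eqP => x0; have := hv c c0; rewrite x0 (quad0 (fam_sym mt)) ltxx//.
exact: ltW (hv c c0).
Qed.

(** The largest of the k negative eigenvalues leaves room for a small step backwards. This makes the
    set of parameters with index at least k open to the left. *)
Lemma fam_left t k : mu < t -> neg_dim (q t) k ->
  exists t', [/\ mu < t', t' < t & neg_dim (q t') k].
Proof.
move=> mt; case: k => [_|k].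
  exists ((mu + t) / 2); rewrite midf_lt// ; split=> //; first by rewrite midf_lt.
  by exists (fun=> 0); split=> [[]//|c [[]]].
have hq := fam_sym mt; have [e eb] := g_eb (q_adm mt); case: (q_adm mt) => _ qg.
move=> [theta [C [K [th0 C0 K0 hth]]]] /(neg_dimP hq eb) lk.
have [C1 [d [C10 d0 hd]]] := q_cont mt.
set l := quad (q t) (e k) in lk.
(* On the span of the first k + 1 eigenvectors q(t) <= 0, so g <= (C / theta) n2 there and a step s
   changes the form by at most s A n2. *)
set A := C1 * (C / theta) + 1.
have A0 : 0 < A by rewrite ltr_wpDl// mulr_ge0// divr_ge0// ltW.
have [s [s0 sd sm sl]] : exists s : R, [/\ 0 < s, s < d, s < t - mu & s * A < - l].
  have a0 : 0 < - l / A by rewrite divr_gt0// oppr_gt0.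
  have b0 : 0 < t - mu by rewrite subr_gt0.
  exists (Num.min d (Num.min (t - mu) (- l / A)) / 2).
  have m0 : 0 < Num.min d (Num.min (t - mu) (- l / A)) by rewrite !lt_min d0 b0 a0.
  have m1 : Num.min d (Num.min (t - mu) (- l / A)) / 2 < Num.min d (Num.min (t - mu) (- l / A)).
    by rewrite ltr_pdivrMr// ltr_pMr// ltr1n.
  move: m0 m1; set m := Num.min _ _ => m0 m1; split.
  - by rewrite divr_gt0.
  - by apply: (lt_le_trans m1); rewrite ge_min lexx.
  - by apply: (lt_le_trans m1); rewrite ge_min ge_min lexx orbT.
  - by rewrite -ltr_pdivlMr//; apply: (lt_le_trans m1); rewrite !ge_min lexx !orbT.
have mt' : mu < t - s by rewrite ltrBrDr addrC -ltrBrDr.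
exists (t - s); split=> //; first by rewrite ltrBlDr ltrDl.
exists (fun i => e i); split=> [i|c c0].
  by rewrite fam_dom// -qg; exact: (eb_dom eb).
set x := \sum_i _.
have xV : fdom g x by rewrite -qg; exact: (eb_comb_dom hq eb).
have x0 : 0 < n2 x by exact: (n2_comb_gt0 eb).
have h1 : quad (q t) x <= l * n2 x.
  by apply: (quad_comb_le hq eb) => i; rewrite ltnS => /(eb_nondecr eb).
have /andP[h2 _] := hth x xV.
have h3 : quad g x <= C / theta * n2 x.
  rewrite mulrAC ler_pdivlMr// mulrC.
  have : l * n2 x <= 0 by rewrite pmulr_lle0// ltW.
  move: h1 h2; clear; lra.
have h4 := hd _ mt' _ x xV; rewrite addrAC subrr sub0r normrN gtr0_norm// in h4.
have {}h4 := h4 sd.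
have h5 : C1 * s * quad g x <= C1 * s * (C / theta * n2 x).
  by rewrite ler_wpM2l// mulr_ge0// ltW.
have h6 : C1 * s * (C / theta * n2 x) <= s * A * n2 x.
  rewrite (_ : C1 * s * _ = s * (C1 * (C / theta)) * n2 x); last by ring.
  by apply: ler_wpM2r; [exact: n2_ge0|rewrite ler_wpM2l ?(ltW s0)// lerDl].
have h7 : s * A * n2 x < - l * n2 x by rewrite ltr_pM2r.
have h8 := ler_norm (quad (q (t - s)) x - quad (q t) x).
move: h1 h4 h5 h6 h7 h8; clear; lra.
Qed.

(** Kernel directions count too: what is nonpositive at t is negative at any later parameter, so the
    index jumps by the full dimension of the kernel. *)
Lemma fam_jump t t' e k : mu < t -> t < t' -> eigenbasis (q t) e ->
  quad (q t) (e k) <= 0 -> neg_dim (q t') k.+1.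
Proof.
move=> mt tt' eb lk; have hq := fam_sym mt; have mt' := lt_trans mt tt'.
exists (fun i => e i); split=> [i|c c0].
  by rewrite fam_dom// -(fam_dom mt); exact: (eb_dom eb).
set x := \sum_i _.
have x0 : 0 < n2 x by exact: (n2_comb_gt0 eb).
apply: (q_mono mt) => //.
- by rewrite -(fam_dom mt); exact: (eb_comb_dom hq eb).
- by apply/eqP => x00; rewrite x00 n20 ltxx in x0.
apply: (@le_trans _ _ (0 * n2 x)); last by rewrite mul0r.
apply: (quad_comb_le hq eb) => i; rewrite ltnS => /(eb_nondecr eb) h.
exact: le_trans h lk.
Qed.

(** Orthogonally to the first k eigenvectors q(t) is positive and controls [g], so a small step
    forwards is absorbed and creates no new negative direction. *)
Lemma fam_right t e k : mu < t -> eigenbasis (q t) e ->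
  0 < quad (q t) (e k) -> exists t', t < t' /\ ~ neg_dim (q t') k.+1.
Proof.
move=> mt eb lk; case: (q_adm mt) => hq qg [theta [C [K [th0 C0 K0 hth]]]].
have [C1 [d [C10 d0 hd]]] := q_cont mt.
set l := quad (q t) (e k) in lk.
(* On that complement n2 <= q(t) / l, hence theta g <= q(t) + C n2 <= (1 + C / l) q(t). *)
set A := C1 * ((1 + C / l) / theta) + 1.
have A0 : 0 < A.
  by rewrite ltr_wpDl// mulr_ge0// divr_ge0 ?(ltW th0)// addr_ge0// divr_ge0// ltW.
have [s [s0 sd sA]] : exists s : R, [/\ 0 < s, s < d & s * A <= 1].
  have a0 : 0 < A^-1 by rewrite invr_gt0.
  exists (Num.min d A^-1 / 2).
  have m0 : 0 < Num.min d A^-1 by rewrite !lt_min d0 a0.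
  have m1 : Num.min d A^-1 / 2 < Num.min d A^-1.
    by rewrite ltr_pdivrMr// ltr_pMr// ltr1n.
  move: m0 m1; set m := Num.min _ _ => m0 m1; split.
  - by rewrite divr_gt0.
  - by apply: (lt_le_trans m1); rewrite ge_min lexx.
  - rewrite -ler_pdivlMr// div1r; apply: (le_trans (ltW m1)); rewrite !ge_min lexx !orbT//.
have mt' : mu < t + s by rewrite (lt_trans mt)// ltrDl.
exists (t + s); split; first by rewrite ltrDl.
move=> [v [vV hv]].
have [c [c0 hc]] := exists_perp_comb e v (ltnSn k).
have := hv c c0; set x := \sum_i _ in hc *.
have xV : fdom g x.
  rewrite -(fam_dom mt'); apply: (fdom_sum (fam_sym mt')) => i _.
  by apply: (fdomZ (fam_sym mt')); exact: vV.
have xV' : fdom (q t) x by rewrite qg.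
have h1 := eb_min eb xV' hc; rewrite -/l in h1.
have /andP[h2 _] := hth x xV.
have h0 : 0 <= quad (q t) x by apply: le_trans h1; rewrite mulr_ge0 ?n2_ge0// ltW.
have h3 : quad g x <= (1 + C / l) / theta * quad (q t) x.
  rewrite mulrAC ler_pdivlMr// mulrC mulrDl mul1r.
  have : C * n2 x <= C / l * quad (q t) x.
    by rewrite mulrAC -mulrA ler_wpM2l// ler_pdivlMr// mulrC.
  move: h2; clear; lra.
have h4 := hd _ mt' _ x xV; rewrite addrAC subrr add0r gtr0_norm// in h4.
have {}h4 := h4 sd.
have h5 : C1 * s * quad g x <= C1 * s * ((1 + C / l) / theta * quad (q t) x).
  by rewrite ler_wpM2l// mulr_ge0// ltW.
have h6 : C1 * s * ((1 + C / l) / theta * quad (q t) x) <= s * A * quad (q t) x.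
  rewrite (_ : C1 * s * _ = s * (C1 * ((1 + C / l) / theta)) * quad (q t) x); last by ring.
  by apply: ler_wpM2r => //; rewrite ler_wpM2l ?(ltW s0)// lerDl.
have h7 : s * A * quad (q t) x <= 1 * quad (q t) x by rewrite ler_wpM2r.
rewrite mul1r in h7.
have h8 := ler_norm (- (quad (q (t + s)) x - quad (q t) x)); rewrite normrN in h8.
move: h4 h5 h6 h7 h8; clear; lra.
Qed.

Lemma fam_index t : mu < t -> exists k, neg_dim (q t) k /\ ~ neg_dim (q t) k.+1.
Proof.
move=> mt; have hq := fam_sym mt; have [e eb] := g_eb (q_adm mt).
have [m [lm hm]] := eb_first_nonneg eb 0; exists m; split; last first.
  by move/(neg_dimP hq eb); rewrite ltNge lm.
case: m hm {lm} => [_|m hm]; first by exists (fun=> 0); split=> [[]//|c [[]]].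
by apply/(neg_dimP hq eb); exact: hm.
Qed.

(** Excludes accumulation at mu. Take [t0] where the index attains its least value k over (mu, oo).
    A zero eigenvalue number j at an earlier t forces j < k through the jump at [t0], while the
    index at t, being at least k, makes that eigenvalue negative. *)
Lemma fam_bottom : exists2 t0, mu < t0 &
  forall t x, mu < t -> t < t0 -> form_kernel (q t) x -> x = 0.
Proof.
pose P (k : nat) := `[< exists2 t, mu < t & neg_dim (q t) k /\ ~ neg_dim (q t) k.+1 >].
have exP : exists k, P k.
  have mt : mu < mu + 1 by rewrite ltrDl.
  by have [k hk] := fam_index mt; exists k; apply/asboolP; exists (mu + 1).
case: (ex_minnP exP) => k /asboolP[t0 mt0 [k1 k2]] kmin; exists t0 => // t x mt tt0 [xV hx].
have hq := fam_sym mt; have [e eb] := g_eb (q_adm mt).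
apply: (eb_complete eb xV) => j.
have [lj|lj] := eqVneq (quad (q t) (e j)) 0; last first.
  have := hx (e j) (eb_dom eb j); rewrite (eb_eigr hq eb)// => /eqP.
  by rewrite mulf_eq0 => /orP[/eqP[] /eqP|/eqP //]; rewrite (negbTE lj).
have nd : neg_dim (q t0) j.+1 by apply: (fam_jump mt tt0 eb); rewrite lj.
have [e0 eb0] := g_eb (q_adm mt0).
have jk : (j < k)%N.
  by rewrite ltnNge; apply/negP => kj; apply: k2; apply: (neg_dim_le (fam_sym mt0) eb0 _ nd).
have [k' hk'] := fam_index mt.
have kk' : (k <= k')%N by apply: kmin; apply/asboolP; exists t.
have : neg_dim (q t) j.+1.
  by apply: (neg_dim_le hq eb _ hk'.1); exact: leq_trans kk'.
by move/(neg_dimP hq eb); rewrite lj ltxx.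
Qed.

(** [lam n] is the infimum of the parameters at which the index reaches kap + n + 1. Semicontinuity
    from both sides shows that lam n = t exactly when eigenvalue number kap + n of q(t) vanishes. *)
Lemma fam_sequence gam kap : mu < gam ->
  neg_dim (q gam) kap -> ~ neg_dim (q gam) kap.+1 ->
  exists lam : nat -> R, [/\ forall n m, (n <= m)%N -> lam n <= lam m,
    forall n, gam <= lam n,
    forall n t, gam <= t -> lam n < t <-> neg_dim (q t) (kap + n).+1,
    forall t, gam <= t -> exists2 k, has_dim (form_kernel (q t)) k &
      ([set n | lam n = t] #= `I_k)%card &
    forall T : R, exists N, forall n, (N <= n)%N -> T <= lam n].
Proof.
move=> mg kg1 kg2; have [eg ebg] := g_eb (q_adm mg).
have mt t : gam <= t -> mu < t by exact: lt_le_trans.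
pose U n := [set t | gam <= t /\ neg_dim (q t) (kap + n).+1].
have U0 n : U n !=set0.
  have [t tg h] := q_unb (kap + n).+1 gam; exists t; split=> //; exact: ltW.
have Ulb n : lbound (U n) gam by move=> t [].
have UI n : has_inf (U n) by split=> //; exists gam.
pose lam n := inf (U n).
have lamg n : gam <= lam n by apply: lb_le_inf => //; exact: Ulb.
have lamP n t : gam <= t -> lam n < t <-> neg_dim (q t) (kap + n).+1.
  move=> gt; split=> [lt|nd].
    have d0 : 0 < t - lam n by rewrite subr_gt0.
    have [t' [gt' nd]] := inf_adherent d0 (UI n).
    by rewrite subrKC => /ltW t't; apply: (fam_mono (mt _ gt') t't nd).
  (* The index at gam is exactly kap, so t lies strictly above gam and there is room for
     [fam_left]. *)
  have tg : t != gam.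
    apply/eqP => tg; apply: kg2; rewrite -tg in ebg *.
    by apply: (neg_dim_le (fam_sym (mt _ gt)) ebg _ nd); rewrite ltnS leq_addr.
  have {tg}gt1 : gam < t by rewrite lt_neqAle eq_sym tg.
  have [t' [mt' t't nd']] := fam_left (mt _ gt) nd.
  apply: (@le_lt_trans _ _ (Num.max t' gam)); last by rewrite gt_max t't gt1.
  apply: ge_inf; first by exists gam.
  split; first by rewrite le_max lexx orbT.
  by apply: (fam_mono mt' _ nd'); rewrite le_max lexx.
have lamE n t e : gam <= t -> eigenbasis (q t) e ->
    lam n = t <-> quad (q t) (e (kap + n)%N) = 0.
  move=> gt eb; have mtt := mt _ gt; have hq := fam_sym mtt; split=> [lt|l0].
    have : ~ neg_dim (q t) (kap + n).+1 by rewrite -lamP// lt ltxx.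
    move/(neg_dimP hq eb)/negP; rewrite -leNgt le_eqVlt => /orP[/eqP <-//|lpos].
    have [t' [tt' h]] := fam_right mtt eb lpos.
    exfalso; apply: h; apply/lamP; last by rewrite lt.
    exact: le_trans gt (ltW tt').
  apply/eqP; rewrite eq_le; apply/andP; split; rewrite leNgt; apply/negP => h; last first.
    have := (lamP n t gt).1 h; move/(neg_dimP hq eb); rewrite l0 ltxx//.
  have [h1 h2] := (midf_lt h).
  have gm : gam <= (t + lam n) / 2 by apply: (le_trans gt); exact: ltW.
  have := (lamP n _ gm).2 (fam_jump mtt h1 eb _); rewrite l0 lexx => /(_ isT).
  by rewrite ltNge (ltW h2).
exists lam; split=> //.
- move=> n m nm; rewrite leNgt; apply/negP => h.
  have := (lamP m _ (lamg n)).1 h; have [e eb] := g_eb (q_adm (mt _ (lamg n))).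
  move=> nd; have : neg_dim (q (lam n)) (kap + n).+1.
    by apply: (neg_dim_le (fam_sym (mt _ (lamg n))) eb _ nd); rewrite ltnS leq_add2l.
  by move/(lamP n _ (lamg n)).2; rewrite ltxx.
- move=> t gt; have mtt := mt _ gt; have hq := fam_sym mtt; have [e eb] := g_eb (q_adm mtt).
  have [k d c] := form_kernel_dim hq eb; exists k => //.
  apply: card_eq_trans c.
  (* The first kap eigenvalues are negative from gam onwards, so the vanishing ones carry numbers of
     the form kap + n. *)
  have -> : [set j | quad (q t) (e j) = 0] = (addn kap) @` [set n | lam n = t].
    apply/seteqP; split=> j /=; last by move=> [n /(lamE n t e gt eb) h <-].
    move=> lj; have kj : (kap <= j)%N.
      rewrite leqNgt; apply/negP => jk.
      have := fam_mono mg gt kg1 => nd.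
      have : neg_dim (q t) j.+1 by exact: (neg_dim_le hq eb jk nd).
      by move/(neg_dimP hq eb); rewrite lj ltxx.
    by exists (j - kap)%N; rewrite ?subnKC//; apply/(lamE _ _ _ gt eb); rewrite subnKC.
  rewrite card_eq_sym; apply: inj_card_eq => n m _ _; exact: addnI.
move=> T; set t := Num.max T gam.
have gt : gam <= t by rewrite le_max lexx orbT.
have mtt := mt _ gt; have hq := fam_sym mtt; have [e eb] := g_eb (q_adm mtt).
have [N [lN _]] := eb_first_nonneg eb 0; exists N => n Nn.
apply: (@le_trans _ _ t); first by rewrite le_max lexx.
rewrite leNgt; apply/negP => /(lamP n t gt) /(neg_dimP hq eb).
rewrite ltNge (le_trans lN)//; apply: (eb_nondecr eb).
by rewrite (leq_trans Nn)// leq_addl.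
Qed.

End Family.

(** * Compact resolvent *)

Section Balls.
Context {R : realType} {H : hilbertType R}.
Implicit Types x y : H.

Lemma rnorm_lt_sqr x (e : R) : 0 < e -> (rnorm x < e) = (n2 x < e ^+ 2).
Proof. by move=> e0; rewrite -rnorm2 ltr_sqr ?nnegrE ?rnorm_ge0 ?(ltW e0). Qed.

Lemma rnorm_le_sqr x (e : R) : 0 <= e -> (rnorm x <= e) = (n2 x <= e ^+ 2).
Proof. by move=> e0; rewrite -rnorm2 ler_sqr ?nnegrE ?rnorm_ge0. Qed.

Lemma ball_n2 x y (e : R[i]) : 0 < e ->
  ball x e y <-> n2 (y - x) < complex.Re e ^+ 2.
Proof.
move=> e0; have /andP[ei er] : (0 == complex.Im e :> R) && (0 < complex.Re e).
  by move: e0; rewrite ltcE eq_sym.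
by rewrite -ball_normE /ball_ /= distrC normE ltcE /= (eq_sym _ 0) ei /= rnorm_lt_sqr.
Qed.

Lemma nbhs_n2 x (e : R) : 0 < e -> nbhs x [set y | n2 (y - x) < e].
Proof.
move=> e0; apply/nbhs_ballP; exists (Num.sqrt e)%:C => /=.
  by rewrite ltcR sqrtr_gt0.
by move=> y /ball_n2; rewrite ltcR sqrtr_gt0 /= sqr_sqrtr ?(ltW e0)//; exact.
Qed.

Lemma dense_n2 (S : set H) x (e : R) : dense S -> 0 < e ->
  exists2 y, S y & n2 (y - x) < e.
Proof.
move=> dS e0; pose O := interior [set y | n2 (y - x) < e].
have [|y [yO Sy]] := dS O _ (@open_interior _ _); first by exists x; exact: nbhs_n2.
by exists y => //; exact: (@interior_subset _ _ _ yO).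
Qed.

Lemma dense_seq (S : set H) x : dense S ->
  exists2 u : nat -> H, (forall n, S (u n)) & u @ \oo --> x.
Proof.
move=> dS; have /choice[u hu] : forall n : nat, exists y, S y /\ n2 (y - x) < n.+1%:R^-1.
  move=> n; have n0 : 0 < n.+1%:R^-1 :> R by rewrite invr_gt0 ltr0n.
  by have [y Sy hy] := dense_n2 x dS n0; exists y.
exists u => [n|]; first by case: (hu n).
apply/cvg_n2 => e e0; have [N hN] := ex_inv_lt 1 e0; exists N => n Nn.
by apply: lt_trans (hN n Nn); rewrite div1r; case: (hu n).
Qed.

End Balls.

Lemma linear_operatorP (R : realType) (E F : normedModType R[i]) (T : set (E * F))
    c x x' y y' : linear_operator T -> T (x, y) -> T (x', y') ->
  T (c *: x + x', c *: y + y').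
Proof. by case=> _ h _ h1 h2; exact: (h c (x, y) (x', y')). Qed.

(** * Semiboundedness and the base form of [A] *)

Section BaseForm.
Context {R : realType} {H : hilbertType R} {A : set (H * H)} {fa : qform H}.
Hypothesis saA : selfadjoint A.
Hypothesis belowA : bounded_from_below A.
Hypothesis formA : closed_form_of A fa.

Lemma fa_sym : Defs.symmetric_form fa. Proof. by case: formA. Qed.

Lemma dom_A_fa x y : A (x, y) -> fdom fa x /\ forall u, fdom fa u -> fa x u = '[y, u].
Proof. by case: formA => _ _ _ _ <-. Qed.

Lemma A_intro x y : fdom fa x -> (forall u, fdom fa u -> fa x u = '[y, u]) -> A (x, y).
Proof. by case: formA => _ _ _ _ <-. Qed.

Lemma dense_A : dense (op_dom A). Proof. by case: saA. Qed.

(** A closed semibounded form may a priori be bounded from above. In that case the lower bound of A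
    makes [fa] bounded on dom A, and closedness carries the bound from this dense set to the whole
    domain. *)
Lemma fa_below : exists c : R, forall x, fdom fa x -> c * n2 x <= quad fa x.
Proof.
case: (formA) => hfa [C [hC|hC]] hcl _ _.
  by exists C => x xV; rewrite -rnorm2 hC.
have [c hc] := belowA.
have hA x y : A (x, y) -> c * n2 x <= quad fa x.
  by move=> Axy; rewrite -rnorm2 /quad; have [xV ->//] := dom_A_fa Axy; exact: (hc _ Axy).
(* From fa[x] = 2 fa[u] + 2 fa[u - x] - fa[2 u - x] with u in dom A tending to x: the first term is
   at least 2 c n2 u, and the last form value is at most C times a squared norm. *)
exists (2 * c - C) => x xV.
have [u uA ux] := dense_seq x dense_A.
have uV n : fdom fa (u n) by have [y /dom_A_fa[]] := uA n.
have lA : linear_operator A by case: saA.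
have quadle n k : `|quad fa (u n - u k)| <= (`|c| + `|C|) * n2 (u n - u k).
  have [y1 h1] := uA n; have [y2 h2] := uA k.
  have hd : A (u n - u k, y1 - y2).
    by rewrite addrC -scaleN1r (addrC y1) -(scaleN1r y2); exact: linear_operatorP.
  have dV : fdom fa (u n - u k) by exact: (fdomB hfa).
  have := hA _ _ hd; have := hC _ dV; rewrite rnorm2 => h3 h4.
  have n0 := n2_ge0 (u n - u k).
  have h5 : - `|c| * n2 (u n - u k) <= c * n2 (u n - u k).
    by rewrite ler_wpM2r// lerNl -normrN ler_norm.
  have h6 : C * n2 (u n - u k) <= `|C| * n2 (u n - u k) by rewrite ler_wpM2r// ler_norm.
  have h7 : 0 <= `|c| * n2 (u n - u k) by rewrite mulr_ge0.
  have h8 : 0 <= `|C| * n2 (u n - u k) by rewrite mulr_ge0.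
  rewrite ler_norml mulrDl; apply/andP; move: h3 h4 h5 h6 h7 h8; clear; split; lra.
have [|_ ql] := hcl u x uV ux.
  move=> e e0; have K0 : 0 < `|c| + `|C| + 1 by rewrite ltr_wpDl// addr_ge0.
  have e4 : 0 < e / (`|c| + `|C| + 1) / 4 by rewrite !divr_gt0.
  have [N hN] := (cvg_n2 u x).2 ux _ e4; exists N => n k Nn Nk.
  apply: (le_lt_trans (quadle n k)).
  have h1 : n2 (u n - u k) < e / (`|c| + `|C| + 1).
    have -> : u n - u k = (u n - x) + - (u k - x) by rewrite opprB addrA subrK.
    apply: (le_lt_trans (n2D_le _ _)); rewrite n2N.
    have := hN n Nn; have := hN k Nk; clear; lra.
  apply: (@le_lt_trans _ _ ((`|c| + `|C| + 1) * n2 (u n - u k))).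
    by rewrite ler_wpM2r ?n2_ge0// lerDl.
  by rewrite mulrC -ltr_pdivlMr.
have ql' : 2 * c * n2 (u n) + 2 * quad fa (u n - x) - C * n2 (u n + (u n - x))
    @[n --> \oo] --> 2 * c * n2 x + 2 * 0 - C * n2 (x + 0).
  apply: cvgB; [apply: cvgD|]; apply: cvgM; (try exact: cvg_cst) => //.
    exact: n2_cvg.
  apply: n2_cvg; apply: cvgD => //; rewrite -(subrr x); apply: cvgB => //; exact: cvg_cst.
rewrite (_ : (2 * c - C) * n2 x = 2 * c * n2 x + 2 * 0 - C * n2 (x + 0)); last first.
  by rewrite addr0; ring.
rewrite -(cvg_lim _ ql')//; apply: limr_le; first by apply/cvg_ex; eexists; exact: ql'.
apply: nearW => n.
have [y Auy] := uA n; have h1 := hA _ _ Auy.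
have dV : fdom fa (u n - x) by exact: (fdomB hfa).
have h2 := hC _ (fdomD hfa (uV n) dV); rewrite rnorm2 in h2.
have h3 := parallelogram hfa (uV n) dV; rewrite subKr in h3.
move: h1 h2 h3; clear; lra.
Qed.

(** The shift 1 - c lifts the lower bound of [fa] to 1; the added term is continuous in norm, so
    closedness is preserved. *)
Lemma base_form_exists : exists c : R, let g := fadd fa c (inner_form H) in
  [/\ Defs.symmetric_form g, forall x, fdom g x -> n2 x <= quad g x & closed_form g].
Proof.
have [c hc] := fa_below; exists (1 - c).
have hfa := fa_sym.
have qg (x : H) : quad (fadd fa (1 - c) (inner_form H)) x = quad fa x + (1 - c) * n2 x.
  by rewrite quad_fadd.
split.
- by apply: fadd_sym => //; exact: inner_form_sym.
- move=> x /= xV; rewrite qg; have := hc x xV; lra.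
move=> u x uV ux hu.
have [xV hx] : fdom fa x /\ quad fa (u n - x) @[n --> \oo] --> (0 : R).
  case: (formA) => _ _ hcl _ _; apply: hcl => // e e0.
  have [N1 hN1] := hu (e / 2) ltac:(lra).
  have K0 : 0 < 8 * (`|1 - c| + 1) by rewrite mulr_gt0// ltr_wpDl.
  have e4 : 0 < e / (8 * (`|1 - c| + 1)) by rewrite divr_gt0.
  have [N2 hN2] := (cvg_n2 u x).2 ux _ e4.
  exists (maxn N1 N2) => n k; rewrite !geq_max => /andP[n1 n2'] /andP[k1 k2].
  have := hN1 n k n1 k1; rewrite qg => h1.
  have h2 : n2 (u n - u k) < 4 * (e / (8 * (`|1 - c| + 1))).
    have -> : u n - u k = (u n - x) + - (u k - x) by rewrite opprB addrA subrK.
    apply: (le_lt_trans (n2D_le _ _)); rewrite n2N.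
    have := hN2 n n2'; have := hN2 k k2; move: (e / _) => d; clear; lra.
  have h3 : `|(1 - c) * n2 (u n - u k)| <= e / 2.
    rewrite normrM (ger0_norm (n2_ge0 _)).
    apply: (@le_trans _ _ ((`|1 - c| + 1) * (4 * (e / (8 * (`|1 - c| + 1)))))).
      by apply: ler_pM; rewrite ?n2_ge0// ?lerDl// ltW.
    rewrite le_eqVlt; apply/orP; left; apply/eqP; field.
    by rewrite gt_eqF// ltr_wpDl.
  have -> : quad fa (u n - u k) = (quad fa (u n - u k) + (1 - c) * n2 (u n - u k)) - (1 - c) * n2 (u n - u k) by rewrite addrK.
  by apply: (le_lt_trans (ler_normB _ _)); rewrite [e]splitr ltr_leD.
split=> //.
rewrite (_ : (fun n => _) = (fun n => quad fa (u n - x) + (1 - c) * n2 (u n - x))); last first.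
  by apply/funext => n; rewrite qg.
rewrite (_ : (0 : R) = 0 + (1 - c) * n2 (0 : H)); last by rewrite n20 mulr0 addr0.
apply: cvgD => //; apply: cvgM; first exact: cvg_cst.
apply: n2_cvg; rewrite -(subrr x); apply: cvgB => //; exact: cvg_cst.
Qed.

End BaseForm.

Section Compactness.
Context {R : realType} {H : hilbertType R} {A : set (H * H)} {fa : qform H} {c : R}.
Hypothesis saA : selfadjoint A.
Hypothesis formA : closed_form_of A fa.
Let g := fadd fa c (inner_form H).
Hypothesis hg : Defs.symmetric_form g.
Hypothesis g_ge : forall x, fdom g x -> n2 x <= quad g x.
Hypothesis g_closed : closed_form g.

(** Here y = (1 + d (A + c))^{-1} x, a resolvent regularisation: it lies in dom A with A y expressed
    through x and y, and it is close to x uniformly on g-bounded sets. *)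
Lemma smoothing (d : R) x : 0 < d -> fdom g x -> exists y,
  [/\ A (y, d^-1%:C *: (x - y) - c%:C *: y), n2 y <= n2 x &
      n2 (x - y) <= d * quad g x].
Proof.
move=> d0 xV.
have hq : Defs.symmetric_form (fadd g d^-1 (inner_form H)).
  by apply: fadd_sym => //; exact: inner_form_sym.
have di : 0 < d^-1 by rewrite invr_gt0.
have [||||y yV hy] := @riesz _ _ _ hg g_ge g_closed (fadd g d^-1 (inner_form H)) 1 (1 + d^-1)
    (d^-1 ^+ 2 * n2 x) (fun u => d^-1 * ip x u) hq erefl ltr01 (mulr_ge0 (sqr_ge0 _) (n2_ge0 x)).
- move=> u uV; rewrite quad_fadd -[quad (inner_form H) u]/(n2 u).
  have := g_ge uV; have := n2_ge0 u => h1 h2.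
  rewrite mul1r mulrDl mul1r lerDl lerD2l ler_wpM2l ?(ltW di)// andbT.
  by rewrite mulr_ge0// ltW.
- by move=> u v _ _; rewrite ipDr mulrDr.
- by move=> t u _; rewrite ipZr mulrCA.
- move=> u uV; rewrite exprMn -[leRHS]mulrA ler_wpM2l ?sqr_ge0//.
  by apply: (le_trans (ip_CS x u)); rewrite ler_wpM2l ?n2_ge0 ?g_ge.
have rqg u : fdom g u -> rq g y u = d^-1 * ip (x - y) u.
  move=> uV; have := hy u uV; rewrite rq_fadd -[rq (inner_form H) y u]/(ip y u) ipBl => h.
  by rewrite mulrBr -h addrK.
exists y; split.
- apply: (A_intro formA) => // u uV; apply: (form_eq_of_rq (fa_sym formA)) => // v vV.
  have := rqg v vV; rewrite rq_fadd -[rq (inner_form H) y v]/(ip y v) => h.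
  by rewrite ipBl !ipZl -h addrK.
- have := rqg y yV; rewrite -[rq g y y]/(quad g y) ipBl -/(n2 y) => h.
  have h1 := g_ge yV; have h2 := n2_ge0 y.
  have h3 : 0 <= ip x y - n2 y by rewrite -(pmulr_rge0 _ di) -h (le_trans h2).
  have [y0|y0] := lerP (n2 y) 0; first by apply: (le_trans y0); exact: n2_ge0.
  have h4 : n2 y ^+ 2 <= n2 x * n2 y.
    apply: le_trans (ip_CS x y); rewrite ler_sqr ?nnegrE ?n2_ge0//; first by rewrite -subr_ge0.
    by apply: (le_trans h2); rewrite -subr_ge0.
  by rewrite -(ler_pM2r y0) -expr2.
have dV : fdom g (x - y) by exact: (fdomB hg).
have := rqg _ dV; rewrite -[ip _ _]/(n2 (x - y)) => h.
have h1 : rq g y (x - y) = rq g x (x - y) - quad g (x - y).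
  by rewrite -[quad _ _]/(rq g (x - y) (x - y)) (rqBl hg xV yV dV) opprB [RHS]addrC subrK.
have h2 := quadB hg xV dV; rewrite subKr in h2.
have h3 := g_ge yV; have h4 := n2_ge0 y; have h5 := base_ge0 g_ge dV.
rewrite -(ler_pM2l di) mulrA mulVf ?gt_eqF// mul1r -h h1.
have h6 := base_ge0 g_ge xV.
lra.
Qed.

(** The hypothesis concerns the image of the unit ball under one resolvent, the conclusion g-bounded
    sets; [smoothing] approximates the latter by multiples of the former. An ultrafilter containing
    all [S n] is therefore Cauchy, and its limit is the cluster point. *)
Lemma compact_resolvent_form : compact_resolvent A -> form_compact (g := g).
Proof.
move=> [z _ cpt] C S S0 Sdec Sbnd.
pose K := closure [set x | exists2 y, op_shift A z (x, y) & rnorm y <= 1].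
have subS n m : (n <= m)%N -> S m `<=` S n.
  elim: m => [|m ih]; first by rewrite leqn0 => /eqP ->.
  by rewrite leq_eqVlt => /orP[/eqP -> //|]; rewrite ltnS => /ih h x /Sdec /h.
pose F := filter_from [set: nat] S.
have FF : ProperFilter F.
  apply: filter_from_proper => [|n _]; last exact: S0.
  apply: filter_from_filter; first by exists 0%N.
  move=> n m _ _; exists (maxn n m) => // x Sx.
  by split; [apply: (subS _ _ _ x Sx); rewrite leq_maxl|apply: (subS _ _ _ x Sx); rewrite leq_maxr].
have [U [UU FU]] := ultraFilterLemma FF.
have US n : U (S n) by apply: FU; exists n.
have Sin n x : S n x -> fdom g x /\ quad g x <= C.
  by move=> /(subS 0%N n (leq0n n)) /Sbnd.
have C0 : 0 <= C.
  by have [x /Sin[xV h]] := S0 0%N; apply: le_trans h; exact: (base_ge0 g_ge).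
have cau (r : R) : 0 < r -> exists k, U [set x | n2 (x - k) < r].
  (* Makes the smoothing error at most r / 4 in squared norm; the smoothed points come within r / 4
     of a fixed point, and [n2D_le] doubles both. *)
  move=> r0; pose d := r / (4 * (C + 1)).
  have C1 : 0 < C + 1 by rewrite ltr_wpDl.
  have d0 : 0 < d by rewrite divr_gt0// mulr_gt0.
  have /choice[sm hsm] : forall x, exists y, fdom g x ->
      [/\ A (y, d^-1%:C *: (x - y) - c%:C *: y), n2 y <= n2 x & n2 (x - y) <= d * quad g x].
    move=> x; have [xV|nxV] := pselect (fdom g x); last by exists 0.
    by have [y hy] := smoothing d0 xV; exists y.
  (* [M] bounds (A - z) on the smoothed vectors, so dividing by [M] lands in the image of the unit
     ball. It has the form 1 + B with B a bound for the squared norm, since B <= (1 + B)^2. *)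
  have [M M1 hM] : exists2 M : R, 1 <= M & forall x, S 0%N x ->
      exists2 y, op_shift A z (sm x, y) & n2 y <= M ^+ 2.
    pose a2 := abs2 (- (c%:C + z)).
    exists (1 + (2 * (d^-1 ^+ 2 * (4 * C)) + 2 * (a2 * C))).
      rewrite lerDl; apply: addr_ge0; apply: mulr_ge0 => //; apply: mulr_ge0 => //.
      - exact: sqr_ge0.
      - exact: mulr_ge0.
      - exact: abs2_ge0.
    set B := 2 * _ + _.
    move=> x Sx; have [xV hx] := Sin 0%N x Sx; have [h1 h2 h3] := hsm x xV.
    exists (d^-1%:C *: (x - sm x) + (- (c%:C + z)) *: sm x).
      rewrite /op_shift /= scaleNr scalerDl opprD addrA subrK//.
    have hxC : n2 x <= C by apply: (le_trans (g_ge xV)).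
    have hsC : n2 (sm x) <= C by exact: le_trans h2 hxC.
    have h4 : n2 (x - sm x) <= 4 * C.
      apply: (le_trans (n2D_le _ _)); rewrite n2N; lra.
    have h5 : n2 (d^-1%:C *: (x - sm x) + (- (c%:C + z)) *: sm x) <= B.
      apply: (le_trans (n2D_le _ _)); rewrite n2Zr n2Z.
      by apply: lerD; apply: ler_wpM2l => //; apply: ler_wpM2l => //; rewrite ?sqr_ge0 ?abs2_ge0.
    have B0 : 0 <= B by apply: le_trans h5; exact: n2_ge0.
    apply: (le_trans h5); have := sqr_ge0 B.
    have -> : (1 + B) ^+ 2 = 1 + 2 * B + B ^+ 2 by ring.
    move: B B0 {h5} => B B0; lra.
  have M0 : 0 < M by exact: lt_le_trans M1.
  have Mi : 0 < M^-1 by rewrite invr_gt0.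
  pose f x := M^-1%:C *: sm x.
  have lA : linear_operator A by case: saA.
  have fK x : S 0%N x -> K (f x).
    move=> Sx; have [y hy hM2] := hM x Sx.
    apply: subset_closure; exists (M^-1%:C *: y).
      have := linear_operatorP M^-1%:C lA hy (x' := 0) (y' := 0).
      rewrite /op_shift /= !addr0 scalerDr !scalerA (mulrC _ z) => h; apply: h.
      by case: lA.
    rewrite rnorm_le_sqr// n2Zr expr1n exprVn mulrC ler_pdivrMr ?exprn_gt0//.
    by rewrite mul1r.
  have [k [Kk ck]] := cpt (f @ U) _ (filterS fK (US 0%N)).
  exists (M%:C *: k).
  pose e := r / (4 * M ^+ 2).
  have e0 : 0 < e by rewrite divr_gt0// mulr_gt0// exprn_gt0.
  have h1 : U (f @^-1` [set y | n2 (y - k) < e]).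
    have [//|h] := in_ultra_setVsetC (f @^-1` [set y | n2 (y - k) < e]) UU.
    have [y [/= h2 h3]] := ck (~` [set y | n2 (y - k) < e]) _ h (nbhs_n2 k e0).
    by [].
  apply: filterS (filterI h1 (US 0%N)) => x [/= h2 Sx].
  have [xV hx] := Sin 0%N x Sx; have [_ _ h3] := hsm x xV.
  have h4 : n2 (sm x - M%:C *: k) < r / 4.
    have -> : sm x - M%:C *: k = M%:C *: (f x - k).
      by rewrite scalerBr /f scalerA -rmorphM /= mulfV ?scale1r// gt_eqF.
    rewrite n2Zr mulrC -ltr_pdivlMr ?exprn_gt0//; apply: (lt_le_trans h2).
    by rewrite /e invfM mulrA.
  have h5 : n2 (x - sm x) <= r / 4.
    apply: (le_trans h3); apply: (@le_trans _ _ (d * (C + 1))).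
      by rewrite ler_wpM2l ?(ltW d0)// (le_trans hx)// lerDl.
    by rewrite /d invfM mulrA mulfVK// gt_eqF.
  have -> : x - M%:C *: k = (x - sm x) + (sm x - M%:C *: k) by rewrite addrA subrK.
  apply: (le_lt_trans (n2D_le _ _)); lra.
have [|x Ux] := (@cvg_ex _ U).1.
  apply: cauchy_cvg; apply: cauchy_exP => e e0.
  have er : 0 < complex.Re e by move: e0; rewrite ltcE => /andP[].
  have [k hk] := cau _ (exprn_gt0 2 er); exists k; apply: filterS hk => y /= hy.
  by apply/ball_n2.
exists x => n e e0.
have [y [/= h1 h2]] := filter_ex (filterI (US n) (Ux _ (nbhs_n2 x e0))).
by exists y.
Qed.

(** Otherwise every vector of the form domain would equal its projection onto the span of the [e i];
    by density of dom A so would every vector of [H]. *)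
Lemma base_infinite : infinite_dimensional H -> forall (e : nat -> H) N,
  orthonormal_upto e N -> (forall i, (i < N)%N -> fdom g (e i)) ->
  exists w, [/\ fdom g w, w != 0 & perp e N w].
Proof.
move=> infH e N eo eV; apply: contrapT => h; apply: infH; exists N, (fun i => e i).
have projB x y : proj e N (x - y) = proj e N x - proj e N y.
  rewrite /proj -sumrB; apply: eq_bigr => i _; rewrite linearBl scalerBl//.
split; last by move=> c0 h0 i; rewrite -(inner_comb c0 i eo) h0 linear0l.
apply/seteqP; split=> x _ //.
exists (fun i => '[x, e i]); apply/subr0_eq; rewrite -/(proj e N x).
apply: n2_eq0; apply/eqP; rewrite eq_le n2_ge0 andbT; apply/ler_addgt0Pr => d d0.
have [y [y' Ay] hy] := dense_n2 x (dense_A saA) d0.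
have [yV _] := dom_A_fa formA Ay.
have yp : y - proj e N y = 0.
  apply/eqP/negPn/negP => y0; apply: h; exists (y - proj e N y); split=> //.
    apply: (fdomB hg) => //; apply: (fdom_sum hg) => i _; apply: (fdomZ hg); exact: eV.
  exact: perp_proj.
have -> : x - proj e N x = (x - y) - proj e N (x - y).
  by rewrite projB -[proj e N y in RHS](subr0_eq yp) opprB addrA subrK.
rewrite add0r; apply: ltW; apply: le_lt_trans hy.
rewrite -(n2N (y - x)) opprB.
set t := x - y; have := n2D (proj e N t) (t - proj e N t); rewrite addrC subrK => ->.
rewrite /ip proj_perp ?mulr0 ?addr0; last exact: perp_proj.
by rewrite lerDr n2_ge0.
Qed.

End Compactness.

(** * The resolvent of D *)

Lemma op_appP (R : realType) (E F : normedModType R[i]) (T : set (E * F)) x y :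
  linear_operator T -> T (x, y) -> op_app T x = y.
Proof.
move=> lT Txy; have h : T (x, op_app T x) by apply: (@xgetPex _ 0 [set y | T (x, y)]); exists y.
have := linear_operatorP (-1) lT h Txy.
rewrite !scaleN1r addNr addrC; case: lT => _ _ h0 /h0 /subr0_eq //.
Qed.

(** In graph terms (T - z) y = w reads [T (y, w + z *: y)], the shape used for resolvents from here
    on. *)
Lemma resolvent_facts (R : realType) (H : hilbertType R) (T : set (H * H)) (z : R[i]) :
  resolvent_set T z -> [/\ forall w, exists y, T (y, w + z *: y),
    forall w y y', T (y, w + z *: y) -> T (y', w + z *: y') -> y = y' &
    exists2 C : R, 0 <= C & forall w y, T (y, w + z *: y) -> n2 y <= C * n2 w].
Proof.
move=> [hex [C hC]]; split.
- by move=> w; have [y [hy _]] := hex w; exists y.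
- by move=> w y y' hy hy'; have [v [_ hv]] := hex w; rewrite -(hv y hy) (hv y').
exists (C ^+ 2); first exact: sqr_ge0.
move=> w y hy; have := hC (w, y) hy; rewrite /= => h.
rewrite -!rnorm2 -exprMn ler_sqr ?nnegrE ?rnorm_ge0//.
exact: le_trans (rnorm_ge0 y) h.
Qed.

Definition op_symmetric (R : realType) (H : hilbertType R) (T : set (H * H)) :=
  forall x y x' y', T (x, y) -> T (x', y') -> '[y, x'] = '[x, y'].

(* If the supremum c of the numerical range exceeded delta, it would lie in the
   resolvent set, and Cauchy-Schwarz for the form of c - T would bound
   <(c - T) x, x> away from 0 on the unit sphere. *)
Lemma num_range_bound (R : realType) (H : hilbertType R) (T : set (H * H)) (delta : R) :
  linear_operator T -> op_symmetric T ->
  (exists C : R, forall x y, T (x, y) -> ip y x <= C * n2 x) ->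
  (forall t : R, delta < t -> resolvent_set T t%:C) ->
  forall x y, T (x, y) -> ip y x <= delta * n2 x.
Proof.
move=> lT sT [C hC] hres.
pose E := [set r : R | exists x y, [/\ T (x, y), n2 x = 1 & r = ip y x]].
have T0 : T (0, 0) by case: lT.
have norml x y : T (x, y) -> x != 0 ->
    T ((Num.sqrt (n2 x))^-1%:C *: x, (Num.sqrt (n2 x))^-1%:C *: y).
  move=> Txy _; have := linear_operatorP (Num.sqrt (n2 x))^-1%:C lT Txy T0.
  by rewrite !addr0.
have inE0 x y : T (x, y) -> x != 0 -> E (ip y x / n2 x).
  move=> Txy x0; have n0 := n2_gt0 x0; do 2!eexists; split; first exact: norml Txy x0.
    by rewrite n2Zr exprVn sqr_sqrtr ?(ltW n0)// mulVf// gt_eqF.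
  rewrite ipZl ipZr mulrA -invfM -expr2 sqr_sqrtr ?(ltW n0)// mulrC//.
move=> x y Txy; have [->|x0] := eqVneq x 0; first by rewrite ip0r n20 mulr0.
have EI : has_sup E.
  split; first by exists (ip y x / n2 x); exact: inE0.
  by exists C => _ [u [v [Tuv u1 ->]]]; have := hC _ _ Tuv; rewrite u1 mulr1.
set c := sup E.
have hc u v : T (u, v) -> ip v u <= c * n2 u.
  move=> Tuv; have [->|u0] := eqVneq u 0; first by rewrite ip0r n20 mulr0.
  by rewrite -ler_pdivrMr ?n2_gt0//; apply: sup_upper_bound => //; exact: inE0.
have [cd|dc] := lerP c delta.
  by apply: (le_trans (hc _ _ Txy)); rewrite ler_wpM2r ?n2_ge0.
have [hex _ [K K0 hK]] := resolvent_facts (hres c dc).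
pose q := QForm (op_dom T) (fun x u => c%:C * '[x, u] - '[op_app T x, u]).
have qE u v z : T (u, v) -> q u z = c%:C * '[u, z] - '[v, z].
  by move=> Tuv; rewrite /= (op_appP lT Tuv).
have rE u v z : T (u, v) -> rq q u z = c * ip u z - ip v z.
  by move=> Tuv; rewrite /rq (qE _ _ z Tuv) ReD ReN ReM /= mul0r subr0.
have hq : Defs.symmetric_form q.
  split; first by exists 0.
  - by move=> s u v [u' hu] [v' hv]; exists (s *: u' + v'); exact: linear_operatorP.
  - move=> s u v z [u' hu] [v' hv] _; rewrite (qE _ _ z hu) (qE _ _ z hv).
    rewrite (qE _ _ z (linear_operatorP s lT hu hv)) !linearDl !linearZl_LR /=; ring.
  - move=> u v [u' hu] [v' hv]; rewrite (qE _ _ v hu) (qE _ _ u hv).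
    rewrite rmorphB rmorphM /= conj_real -!innerC.
    by rewrite (sT _ _ _ _ hu hv).
have q0 u : fdom q u -> 0 <= quad q u.
  move=> [v hu]; rewrite -[quad q u]/(rq q u u) (rE _ _ u hu) subr_ge0; exact: hc.
exfalso.
have e0 : 0 < 1 / (1 + K) by rewrite divr_gt0// ltr_wpDr.
have [_ [u [v [Tuv u1 ->]]] huv] := sup_adherent e0 EI.
(* So (c - T) z = u for a unit vector u nearly attaining the supremum. Then q(z, u) = 1, while q[z]
   <= (1 + K) / 2 and q[u] < 1 / (1 + K), against Cauchy-Schwarz. *)
have [z hz] := hex (- u).
have h := form_cauchy_schwarz hq q0 (x := z) (y := u) ltac:(by eexists; exact: hz) ltac:(by exists v).
have hzu t : ip (- u + c%:C *: z) t = - ip u t + c * ip z t by rewrite ipDl ipNl ipZl.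
have E1 : rq q z u = 1 by rewrite (rE _ _ u hz) hzu -/(n2 u) u1; ring.
have E2 : quad q z = ip u z by rewrite -[quad q z]/(rq q z z) (rE _ _ z hz) hzu; ring.
have E3 : quad q u = c - ip v u by rewrite -[quad q u]/(rq q u u) (rE _ _ u Tuv) -/(n2 u) u1 mulr1.
have h1 : n2 z <= K by have := hK _ _ hz; rewrite n2N u1 mulr1.
have h2 : 2 * ip u z <= 1 + K.
  have := n2_ge0 (u - z); rewrite n2B u1; move: h1; clear; lra.
have h3 : quad q u < 1 / (1 + K) by rewrite E3; move: huv; rewrite -/c; clear; lra.
have h4 : quad q z * quad q u <= (1 + K) / 2 * (1 / (1 + K)).
  have := q0 z ltac:(by eexists; exact: hz); have := q0 u ltac:(by exists v) => a1 a2.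
  by apply: ler_pM => //; [rewrite E2 ler_pdivlMr// mulrC|exact: ltW].
move: h; rewrite E1 expr1n; apply/negP; rewrite -ltNge; apply: (le_lt_trans h4).
have -> : (1 + K) / 2 * (1 / (1 + K)) = 2^-1 :> R.
  by field; rewrite gt_eqF// ltr_wpDr.
by rewrite invf_lt1// ltr1n.
Qed.

Section OperatorD.
Context {R : realType} {H : hilbertType R} {D : set (H * H)} {dp : R}.
Hypothesis saD : selfadjoint D.
Hypothesis aboveD : bounded_from_above D.
Hypothesis dpP : is_max (real_spectrum D) dp.

Lemma D_lin : linear_operator D. Proof. by case: saD. Qed.

Lemma D_sym : op_symmetric D.
Proof. by case: saD => _ _ aD x y x' y' h; rewrite -{1}aD => h'; exact: (h' (x, y)). Qed.

Lemma D_resolvent t : dp < t -> resolvent_set D t%:C.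
Proof.
move=> dt; apply: contrapT => h; case: dpP => _ /(_ t h).
by rewrite leNgt dt.
Qed.

Lemma D_upper x y : D (x, y) -> ip y x <= dp * n2 x.
Proof.
apply: num_range_bound; [exact: D_lin|exact: D_sym| |exact: D_resolvent].
by have [C hC] := aboveD; exists C => u v /hC /=; rewrite rnorm2.
Qed.

(** The upper bound applied to -D; boundedness of [D] supplies the a priori bound on its numerical
    range. *)
Lemma D_lower dm x y : bounded_operator D -> is_min (real_spectrum D) dm ->
  D (x, y) -> dm * n2 x <= ip y x.
Proof.
move=> [C hC] [_ dmP] Dxy.
pose T := [set p : H * H | D (p.1, - p.2)].
have lD := D_lin.
suff : ip (- y) x <= - dm * n2 x by rewrite ipNl mulNr lerN2.
apply: (@num_range_bound _ _ T); last by rewrite /T /= opprK.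
- split; rewrite /T /=; first by rewrite oppr0; case: lD.
    move=> c p q hp hq; rewrite opprD -scalerN; exact: linear_operatorP.
  by move=> v hv; case: lD => _ _ h; rewrite -(opprK v) (h _ hv) oppr0.
- move=> u v u' v' hu hv; have := D_sym hu hv; rewrite linearNl linearNr.
  exact: oppr_inj.
- exists (`|C| + 1) => u v /hC /= h; have [->|u0] := eqVneq u 0; first by rewrite ip0r n20 mulr0.
  have h1 : n2 v <= C ^+ 2 * n2 u.
    rewrite -(n2N v) -!rnorm2 -exprMn ler_sqr ?nnegrE ?rnorm_ge0//.
    exact: le_trans (rnorm_ge0 _) h.
  have h2 := ip_CS v u.
  have h3 : ip v u ^+ 2 <= (`|C| * n2 u) ^+ 2.
    apply: (le_trans h2); rewrite exprMn real_normK ?num_real// (expr2 (n2 u)) mulrA.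
    by rewrite ler_wpM2r ?n2_ge0.
  have h4 : `|ip v u| <= `|C| * n2 u.
    by rewrite -ler_sqr ?nnegrE ?mulr_ge0 ?n2_ge0// real_normK ?num_real.
  apply: (le_trans (ler_norm _)); apply: (le_trans h4).
  by rewrite ler_wpM2r ?n2_ge0// lerDl.
move=> t dt; have : resolvent_set D (- t)%:C.
  by apply: contrapT => /dmP; rewrite leNgt ltrNl dt.
move=> [h1 [K hK]]; split.
  move=> w; have [v [hv hu]] := h1 (- w); exists v; split.
    by move: hv; rewrite /op_shift /T /= opprD rmorphN scaleNr.
  move=> v' hv'; apply: hu; move: hv'.
  by rewrite /op_shift /T /= opprD rmorphN scaleNr.
exists K => -[w v] hw; have := hK (- w, v).
have rN : rnorm (- w) = rnorm w by rewrite /rnorm normrN.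
rewrite /= rN => h; apply: h; move: hw.
by rewrite /op_inverse /op_shift /T /= opprD rmorphN scaleNr.
Qed.

Definition Dres (t : R) (w : H) : H := op_app (op_inverse (op_shift D t%:C)) w.

Lemma DresP t w : dp < t -> D (Dres t w, w + t%:C *: Dres t w).
Proof.
move=> /D_resolvent/resolvent_facts[hex _ _]; have [y hy] := hex w.
by apply: (@xgetPex _ 0 [set y | op_inverse (op_shift D t%:C) (w, y)]); exists y.
Qed.

Lemma Dres_unique t w y : dp < t -> D (y, w + t%:C *: y) -> y = Dres t w.
Proof.
by move=> dt hy; have /resolvent_facts[_ h _] := D_resolvent dt; apply: (h w) => //; exact: DresP.
Qed.

Lemma DresPl t c w w' : dp < t -> Dres t (c *: w + w') = c *: Dres t w + Dres t w'.
Proof.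
move=> dt; apply/esym/Dres_unique => //.
have := linear_operatorP c D_lin (DresP w dt) (DresP w' dt).
by rewrite !scalerDr !scalerA (mulrC c) addrACA.
Qed.

Lemma Dres_sym t w w' : dp < t -> '[Dres t w, w'] = '[w, Dres t w'].
Proof.
move=> dt; have := D_sym (DresP w dt) (DresP w' dt).
rewrite linearDl linearDr linearZl_LR linearZr_LR /= conj_real => /addIr //.
Qed.

(** For t above the spectrum (D - t)^{-1} is negative, hence the sign; the bound is [D_upper] tested
    at (D - t)^{-1} w. *)
Lemma Dres_ge t w : dp < t -> (t - dp) * n2 (Dres t w) <= - ip (Dres t w) w.
Proof.
move=> dt; have := D_upper (DresP w dt); rewrite ipDl ipZl -/(n2 _) ipC; lra.
Qed.

(** Cauchy-Schwarz bounds r^2 by the squared norms of (D - t)^{-1} w and w; [Dres_ge] bounds the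
    former by r itself, and one factor r cancels. *)
Lemma Dres_le t w : dp < t -> (t - dp) * - ip (Dres t w) w <= n2 w.
Proof.
move=> dt; have h := Dres_ge w dt; have d0 : 0 < t - dp by rewrite subr_gt0.
set y := Dres t w in h *; set r := - ip y w in h *.
have r0 : 0 <= r by apply: le_trans h; rewrite mulr_ge0 ?n2_ge0// ltW.
have h1 : r ^+ 2 <= n2 y * n2 w by rewrite sqrrN ip_CS.
have h2 : (t - dp) * r ^+ 2 <= r * n2 w.
  apply: (@le_trans _ _ ((t - dp) * (n2 y * n2 w))); first by rewrite ler_wpM2l// ltW.
  by rewrite mulrA ler_wpM2r ?n2_ge0.
have [rr|rr] := lerP r 0.
  have -> : r = 0 by apply/eqP; rewrite eq_le rr.
  by rewrite mulr0 n2_ge0.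
by rewrite -(ler_pM2l rr) mulrCA -expr2.
Qed.

Lemma Dres_le0 t w : dp < t -> ip (Dres t w) w <= 0.
Proof.
move=> dt; rewrite -oppr_ge0; apply: le_trans (Dres_ge w dt).
by rewrite mulr_ge0 ?n2_ge0// subr_ge0 ltW.
Qed.

Lemma Dres_n2 t w : dp < t -> (t - dp) ^+ 2 * n2 (Dres t w) <= n2 w.
Proof.
move=> dt; apply: le_trans (Dres_le w dt); rewrite expr2 -mulrA ler_wpM2l//.
  by rewrite subr_ge0 ltW.
exact: Dres_ge.
Qed.

Lemma Dres_diff t t' w : dp < t -> dp < t' ->
  Dres t w - Dres t' w = Dres t' ((t - t')%:C *: Dres t w).
Proof.
move=> dt dt'; apply: Dres_unique => //.
have := linear_operatorP (-1) D_lin (DresP w dt') (DresP w dt).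
rewrite !scaleN1r [- _ + Dres t w]addrC [- _ + (w + _)]addrC opprD addrACA subrr add0r.
congr (D (_, _)); rewrite rmorphB scalerBl scalerBr addrA.
by rewrite subrK.
Qed.

Lemma Dres_ip_diff t t' w : dp < t -> dp < t' ->
  ip (Dres t' w) w - ip (Dres t w) w = (t' - t) * ip (Dres t w) (Dres t' w).
Proof.
move=> dt dt'; rewrite -opprB -ipBl Dres_diff//.
rewrite -{1}[t - t']opprB /ip Dres_sym// -/(ip _ _) ipZl; ring.
Qed.

(** By the resolvent identity the right side exceeds the left by (t - t') <(D - t')^{-1} y, y> with
    y = (D - t)^{-1} w, a product of two nonpositive factors. *)
Lemma Dres_ip_le t t' w : dp < t -> t < t' ->
  ip (Dres t w) (Dres t' w) <= n2 (Dres t w).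
Proof.
move=> dt tt'; have dt' := lt_trans dt tt'.
have -> : Dres t' w = Dres t w - Dres t' ((t - t')%:C *: Dres t w).
  by rewrite -Dres_diff// subKr.
rewrite ipBr -/(n2 _) lerBlDr lerDl ipC.
set y := Dres t w; have -> : (t - t')%:C *: y = (t - t')%:C *: y + 0 by rewrite addr0.
rewrite DresPl//; have -> : Dres t' 0 = 0.
  by apply/esym/Dres_unique => //; rewrite scaler0 addr0; case: D_lin.
by rewrite addr0 ipZl mulr_le0// ?Dres_le0// subr_le0 ltW.
Qed.

(* Here T = t - D satisfies 0 <= T <= t - dm, so |T y|^2 <= (t - dm) <T y, y>. *)
Lemma Dres_lower t dm w : dp < t -> bounded_operator D ->
  is_min (real_spectrum D) dm -> n2 w <= (t - dm) * - ip (Dres t w) w.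
Proof.
move=> dt bD dmP.
have low u v : D (u, v) -> dm * n2 u <= ip v u by exact: D_lower.
have lD := D_lin.
pose q := QForm (op_dom D) (fun x u => t%:C * '[x, u] - '[op_app D x, u]).
have qE u v z : D (u, v) -> q u z = t%:C * '[u, z] - '[v, z].
  by move=> Duv; rewrite /= (op_appP lD Duv).
have rE u v z : D (u, v) -> rq q u z = t * ip u z - ip v z.
  by move=> Duv; rewrite /rq (qE _ _ z Duv) ReD ReN ReM /= mul0r subr0.
have hq : Defs.symmetric_form q.
  split; first by exists 0; case: lD.
  - by move=> s u v [u' hu] [v' hv]; exists (s *: u' + v'); exact: linear_operatorP.
  - move=> s u v z [u' hu] [v' hv] _; rewrite (qE _ _ z hu) (qE _ _ z hv).
    rewrite (qE _ _ z (linear_operatorP s lD hu hv)) !linearDl !linearZl_LR /=; ring.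
  - move=> u v [u' hu] [v' hv]; rewrite (qE _ _ v hu) (qE _ _ u hv).
    rewrite rmorphB rmorphM /= conj_real -!innerC.
    by rewrite (D_sym hu hv).
have quadE u v : D (u, v) -> quad q u = t * n2 u - ip v u.
  by move=> Duv; rewrite -[quad q u]/(rq q u u) (rE _ _ u Duv).
have q0 u : fdom q u -> 0 <= quad q u.
  move=> [v hu]; rewrite (quadE _ _ hu) subr_ge0; apply: (le_trans (D_upper hu)).
  by rewrite ler_wpM2r ?n2_ge0// ltW.
set y := Dres t w; have hy : D (y, w + t%:C *: y) by exact: DresP.
have yq : quad q y = - ip y w.
  by rewrite (quadE _ _ hy) ipDl ipZl -/(n2 y) (ipC w); ring.
set r := - ip y w in yq *.
have tm : 0 <= (t - dm) * r.
  rewrite mulr_ge0//; last by rewrite -yq; apply: q0; exists (w + t%:C *: y).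
  rewrite subr_ge0; case: dmP => dm1 _; case: dpP => _ /(_ _ dm1) h.
  exact: le_trans h (ltW dt).
(* Cauchy-Schwarz for the form of t - D at (y, v), where (t - D) y = -w. The bound is wanted at v =
   w, which is reached from dom D by density. *)
have key v : op_dom D v -> ip w v ^+ 2 <= (t - dm) * r * n2 v.
  move=> [v' hv]; have yV : fdom q y by exists (w + t%:C *: y).
  have h := form_cauchy_schwarz hq q0 yV (ex_intro _ v' hv : fdom q v).
  have e1 : rq q y v = - ip w v.
    by rewrite (rE _ _ v hy) ipDl ipZl; ring.
  rewrite e1 sqrrN yq in h; apply: (le_trans h).
  rewrite (mulrC (t - dm)) -mulrA ler_wpM2l//; first by rewrite -yq; exact: q0.
  rewrite (quadE _ _ hv) mulrBl lerD2l lerN2; exact: low.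
have [u uD uw] := dense_seq w (let: And3 _ d _ := saD in d).
have c1 : ip (u n) w ^+ 2 @[n --> \oo] --> ip w w ^+ 2 by apply: cvgM; exact: ip_cvg.
have c2 : (t - dm) * r * n2 (u n) @[n --> \oo] --> (t - dm) * r * n2 w.
  by apply: cvgM; [exact: cvg_cst|exact: n2_cvg].
have : n2 w ^+ 2 <= (t - dm) * r * n2 w.
  rewrite -(cvg_lim _ c1)// -(cvg_lim _ c2)//; apply: ler_lim.
  - by apply/cvg_ex; eexists; exact: c1.
  - by apply/cvg_ex; eexists; exact: c2.
  - by apply: nearW => n; rewrite ipC; apply: key; exact: uD.
have [w0|w0] := lerP (n2 w) 0; first by move=> _; apply: (le_trans w0).
by rewrite expr2 ler_pM2r.
Qed.

End OperatorD.

(** * The Schur complement *)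

Lemma adjoint_linear (R : realType) (H K : hilbertType R) (T : set (H * K)) :
  dense (op_dom T) -> linear_operator (adjoint T).
Proof.
move=> dT; split.
- by move=> p _ /=; rewrite !linear0r.
- by move=> s p q hp hq r Tr /=; rewrite !linearDr !linearZr_LR /= hp// hq.
move=> y hy; have [u uT uy] := dense_seq y dT; apply: n2_eq0.
apply: (cvg_unique _ (ip_cvg (y := y) uy)) => //.
rewrite (_ : (fun n => _) = cst 0); first exact: cvg_cst.
apply/funext => n; have [z hz] := uT n.
by have := hy _ hz; rewrite /= linear0r /ip => <-.
Qed.

Section Schur.
Context {R : realType} {H1 H2 : hilbertType R}.
Context {B : set (H2 * H1)} {D : set (H2 * H2)} {fa : qform H1} {c : R}.
Let g := fadd fa c (inner_form H1).
Hypothesis hfa : Defs.symmetric_form fa.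
Hypothesis hg : Defs.symmetric_form g.
Hypothesis g_ge : forall x, fdom g x -> n2 x <= quad g x.
Hypothesis dense_B : dense (op_dom B).
Hypothesis dom_fa : fdom fa `<=` op_dom (adjoint B).
Hypothesis saD : selfadjoint D.
Hypothesis aboveD : bounded_from_above D.
Variables a b dp : R.
Hypothesis b_ge0 : 0 <= b.
Hypothesis ab : forall x, fdom fa x ->
  rnorm (op_app (adjoint B) x) ^+ 2 <= a * rnorm x ^+ 2 + b * quad fa x.
Hypothesis dpP : is_max (real_spectrum D) dp.
Let mu := dp + b + Num.sqrt (Num.max (b * dp + b ^+ 2 + a) 0).
Notation Bs := (op_app (adjoint B)).
Notation G := (@Dres R H2 D).
Notation s := (schur_form fa B D).

Lemma mu_dp t : mu < t -> dp + b < t.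
Proof. by apply: le_lt_trans; rewrite lerDl sqrtr_ge0. Qed.

Lemma mu_dp' t : mu < t -> dp < t.
Proof. by move/mu_dp; apply: le_lt_trans; rewrite lerDl. Qed.

(** Origin of mu: (t - dp)(t - dp - b) - (a + b t) = (t - dp - b)^2 - (b^2 + b dp + a). If this has
    real roots, mu is the larger one; otherwise mu is the vertex dp + b. *)
Lemma mu_sqr t : mu < t -> a + b * t < (t - dp) * (t - dp - b).
Proof.
move=> mt; have h0 := mu_dp mt; set m := Num.max (b * dp + b ^+ 2 + a) 0.
have m0 : 0 <= m by rewrite le_max lexx orbT.
have h1 : Num.sqrt m < t - dp - b by move: mt; rewrite /mu -/m; lra.
have h2 : m < (t - dp - b) ^+ 2.
  by rewrite -(sqr_sqrtr m0) ltr_sqr ?nnegrE ?sqrtr_ge0// ltW// (le_lt_trans (sqrtr_ge0 m)).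
have h3 : b * dp + b ^+ 2 + a <= m by rewrite le_max lexx.
have := le_lt_trans h3 h2.
have -> : (t - dp - b) ^+ 2 = (t - dp) * (t - dp - b) - b * (t - dp) + b ^+ 2 by ring.
rewrite mulrBr; lra.
Qed.

Lemma BsP x : fdom fa x -> adjoint B (x, Bs x).
Proof.
by move=> /dom_fa [w hw]; apply: (@xgetPex _ 0 [set y | adjoint B (x, y)]); exists w.
Qed.

Lemma BsPl r x y : fdom fa x -> fdom fa y -> Bs (r *: x + y) = r *: Bs x + Bs y.
Proof.
move=> xV yV; have lB := adjoint_linear dense_B.
exact: (op_appP lB (linear_operatorP r lB (BsP xV) (BsP yV))).
Qed.

Lemma Bs_le x : fdom fa x -> n2 (Bs x) <= a * n2 x + b * quad fa x.
Proof. by move=> xV; rewrite -!rnorm2 ab. Qed.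

Lemma quad_base x : quad g x = quad fa x + c * n2 x.
Proof. exact: quad_fadd. Qed.

Lemma Bs_bound : exists2 K : R, 0 <= K & forall x, fdom fa x -> n2 (Bs x) <= K * quad g x.
Proof.
exists (`|a - b * c| + b); first by rewrite addr_ge0.
move=> x xV; apply: (le_trans (Bs_le xV)).
have -> : quad fa x = quad g x - c * n2 x by rewrite quad_base addrK.
have h1 : (a - b * c) * n2 x <= `|a - b * c| * n2 x by rewrite ler_wpM2r ?n2_ge0// ler_norm.
have h2 : `|a - b * c| * n2 x <= `|a - b * c| * quad g x by rewrite ler_wpM2l// g_ge.
rewrite mulrDl mulrBr mulrA; move: h1 h2; rewrite mulrBl; lra.
Qed.

Lemma schurE t x y : s t x y = fa x y - t%:C * '[x, y] + '[G t (Bs x), Bs y].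
Proof. by []. Qed.

Lemma schur_sym t : mu < t -> Defs.symmetric_form (s t).
Proof.
move=> mt; have dt := mu_dp' mt; split; first exact: fdom0 hfa.
- by move=> r x y; exact: (fdomP hfa).
- move=> r x y z xV yV zV; rewrite !schurE (formPl hfa)// BsPl// (DresPl saD dpP)//.
  rewrite !linearDl !linearZl_LR /=; ring.
- move=> x y xV yV; rewrite !schurE (formC hfa)// (innerC x) rmorphD rmorphB rmorphM /=.
  by rewrite conj_real (Dres_sym saD dpP)// -(innerC (Bs x)).
Qed.

Lemma quad_schur t x : quad (s t) x = quad fa x - t * n2 x + ip (G t (Bs x)) (Bs x).
Proof. by rewrite /quad schurE !ReD ReN ReM /= mul0r subr0. Qed.

Lemma schur_le t x : mu < t -> quad (s t) x <= quad fa x - t * n2 x.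
Proof.
by move=> /mu_dp' dt; rewrite quad_schur gerDl; exact: (Dres_le0 saD aboveD dpP).
Qed.

Lemma schur_adm t : mu < t -> admissible g (s t).
Proof.
move=> mt; split=> //; first exact: schur_sym.
have dt := mu_dp' mt; have dbt := mu_dp mt; have d0 : 0 < t - dp by rewrite subr_gt0.
(* Relative bound of the D-term with respect to [fa]; it is below 1 because t > dp + b. *)
pose be := b / (t - dp).
have be1 : be < 1 by rewrite ltr_pdivrMr// mul1r; lra.
have be0 : 0 <= be by rewrite divr_ge0// ltW.
exists (1 - be), (`|c * (1 - be) + t + a / (t - dp)|), (1 + `|c + t|); split => //; first by rewrite subr_gt0.
move=> x xV; apply/andP; split; last first.
  apply: (le_trans (schur_le x mt)).
  have -> : quad fa x - t * n2 x = quad g x - (c + t) * n2 x by rewrite quad_base; ring.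
  have h1 : - (c + t) * n2 x <= `|c + t| * n2 x.
    by rewrite ler_wpM2r ?n2_ge0// -normrN ler_norm.
  have h2 : `|c + t| * n2 x <= `|c + t| * quad g x by rewrite ler_wpM2l// g_ge.
  rewrite [leRHS]mulrDl mul1r; move: h1 h2; rewrite mulNr; lra.
have h1 := Bs_le xV; have h2 := Dres_le saD aboveD dpP (Bs x) dt.
have h3 : - ip (G t (Bs x)) (Bs x) <= be * quad fa x + a / (t - dp) * n2 x.
  rewrite -(ler_pM2l d0); apply: (le_trans h2); apply: (le_trans h1).
  by rewrite le_eqVlt; apply/orP; left; apply/eqP; rewrite /be; field; rewrite gt_eqF.
rewrite quad_schur.
have h4 : (c * (1 - be) + t + a / (t - dp)) * n2 x <=
    `|c * (1 - be) + t + a / (t - dp)| * n2 x by rewrite ler_wpM2r ?n2_ge0// ler_norm.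
have -> : (1 - be) * quad g x = (1 - be) * quad fa x + c * (1 - be) * n2 x.
  by rewrite quad_base; ring.
move: h3 h4; rewrite !mulrDl; lra.
Qed.

Lemma schur_diff t t' x : mu < t -> mu < t' ->
  quad (s t') x - quad (s t) x =
  (t' - t) * (ip (G t (Bs x)) (G t' (Bs x)) - n2 x).
Proof.
move=> mt mt'; rewrite !quad_schur mulrBr -(Dres_ip_diff saD dpP); try exact: mu_dp'.
ring.
Qed.

(* s(t)[x] <= 0 turns the relative bound on B^* into ||(D-t)^-1 B^* x|| < ||x||;
   this is where t > mu is needed. *)
Lemma schur_nonpos_bound t x : mu < t -> fdom fa x -> quad (s t) x <= 0 ->
  (t - dp - b) * - ip (G t (Bs x)) (Bs x) <= (a + b * t) * n2 x.
Proof.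
move=> mt xV; rewrite quad_schur => h.
have dt := mu_dp' mt.
have h1 := Bs_le xV; have h2 := Dres_le saD aboveD dpP (Bs x) dt.
set r := ip _ _ in h h2 *.
have h3 : b * (quad fa x - t * n2 x + r) <= 0 by rewrite mulr_ge0_le0.
move: h1 h2 h3; lra.
Qed.

Lemma schur_mono t t' x : mu < t -> t < t' -> fdom g x -> x != 0 ->
  quad (s t) x <= 0 -> quad (s t') x < 0.
Proof.
move=> mt tt' xV x0 h; have mt' := lt_trans mt tt'.
have dt := mu_dp' mt; have dbt := mu_dp mt.
have d0 : 0 < t - dp by rewrite subr_gt0.
have db0 : 0 < t - dp - b by lra.
have h1 := schur_nonpos_bound mt xV h.
have h2 := Dres_ge saD aboveD dpP (Bs x) dt.
set y := G t (Bs x) in h1 h2.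
(* With y = (D - t)^{-1} B^* x the chain is (t - dp - b)(t - dp) |y|^2 <= (a + b t) |x|^2 < (t -
   dp)(t - dp - b) |x|^2, the last step being [mu_sqr]. *)
have h3 : n2 y < n2 x.
  have h4 : (t - dp - b) * ((t - dp) * n2 y) <= (t - dp - b) * - ip y (Bs x).
    by rewrite ler_wpM2l// ltW.
  have h5 : (a + b * t) * n2 x < (t - dp) * (t - dp - b) * n2 x.
    by rewrite ltr_pM2r ?n2_gt0// mu_sqr.
  have h6 := le_lt_trans (le_trans h4 h1) h5.
  rewrite mulrCA mulrA in h6.
  by rewrite ltr_pM2l// mulr_gt0 in h6.
have h4 := schur_diff x mt mt'.
have h5 := Dres_ip_le saD aboveD dpP (Bs x) dt tt'; rewrite -/y in h5 h4.
have h6 : (t' - t) * (ip y (G t' (Bs x)) - n2 x) < 0.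
  by rewrite pmulr_rlt0 ?subr_gt0//; move: h3 h5; lra.
lra.
Qed.

Lemma schur_cont t : mu < t -> exists C d : R, [/\ 0 <= C, 0 < d &
  forall t', mu < t' -> `|t' - t| < d -> forall x, fdom g x ->
    `|quad (s t') x - quad (s t) x| <= C * `|t' - t| * quad g x].
Proof.
move=> mt; have dt := mu_dp' mt; have [K K0 hK] := Bs_bound.
(* Within half the distance to [dp] all resolvents involved are bounded by 1 / d. *)
pose d := (t - dp) / 2; have d0 : 0 < d by rewrite divr_gt0// subr_gt0.
exists (K / d ^+ 2 + 1), d; split=> //.
  by rewrite addr_ge0// divr_ge0// sqr_ge0.
move=> t' mt' htt x xV; have dt' := mu_dp' mt'.
have bnd r : dp < r -> d <= r - dp -> n2 (G r (Bs x)) <= K / d ^+ 2 * quad g x.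
  move=> dr hr; rewrite mulrAC ler_pdivlMr ?exprn_gt0//.
  apply: le_trans (hK x xV); apply: le_trans (Dres_n2 saD aboveD dpP (Bs x) dr).
  by rewrite mulrC ler_wpM2r ?n2_ge0// ler_sqr ?nnegrE ?(ltW d0)// subr_ge0 ltW.
have b1 : n2 (G t (Bs x)) <= K / d ^+ 2 * quad g x.
  by apply: bnd => //; rewrite /d; lra.
have b2 : n2 (G t' (Bs x)) <= K / d ^+ 2 * quad g x.
  by apply: bnd => //; move: htt; rewrite ltr_norml /d => /andP[]; lra.
rewrite schur_diff// normrM.
have -> : (K / d ^+ 2 + 1) * `|t' - t| * quad g x = `|t' - t| * ((K / d ^+ 2 + 1) * quad g x).
  by ring.
rewrite ler_wpM2l//.
have c1 := n2_ge0 (G t (Bs x) - G t' (Bs x)); have c2 := n2_ge0 (G t (Bs x) + G t' (Bs x)).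
rewrite n2B in c1; rewrite n2D in c2.
have c3 := g_ge xV; have c4 := n2_ge0 x.
rewrite ler_norml mulrDl mul1r; apply/andP; split; lra.
Qed.

(** The D-term is nonpositive, so s(t) lies below fa - t; eigenvectors of [fa] become negative
    directions once t exceeds their eigenvalues. *)
Lemma schur_unb (e : nat -> H1) k t0 : eigenbasis fa e ->
  exists2 t, t0 < t & neg_dim (s t) k.
Proof.
move=> eb; pose t := Num.max t0 (Num.max mu (quad fa (e k))) + 1.
have t1 : t0 < t by rewrite /t ltr_pwDr// le_max lexx.
have t2 : mu < t by rewrite /t ltr_pwDr// !le_max lexx orbT.
have t3 : quad fa (e k) < t by rewrite /t ltr_pwDr// !le_max lexx !orbT.
exists t => //; exists (fun i => e i); split=> [i|f f0]; first exact: (eb_dom eb).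
apply: (le_lt_trans (schur_le _ t2)); set x := \sum_i _.
have x0 : 0 < n2 x by exact: (n2_comb_gt0 eb).
have h : quad fa x <= quad fa (e k) * n2 x.
  by apply: (quad_comb_le hfa eb) => i ik; apply: (eb_nondecr eb); exact: ltnW.
by rewrite subr_lt0; apply: (le_lt_trans h); rewrite ltr_pM2r.
Qed.

End Schur.

(** * The forms of [A - t] *)

Section Translates.
Context {R : realType} {H : hilbertType R} {fa : qform H} {c : R}.
Let g := fadd fa c (inner_form H).
Hypothesis hfa : Defs.symmetric_form fa.
Hypothesis g_ge : forall x, fdom g x -> n2 x <= quad g x.
Notation q t := (fadd fa (- t) (inner_form H)).

(** This and the next lemmas check for the forms of A - t what was checked for the Schur forms, so
    that the same family argument counts the eigenvalues of A. *)
Lemma translate_adm t : admissible g (q t).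
Proof.
split=> //; first by apply: fadd_sym => //; exact: inner_form_sym.
exists 1, (`|c + t|), (1 + `|c + t|); split => //.
move=> x xV.
have qx : quad (q t) x = quad g x - (c + t) * n2 x.
  rewrite !quad_fadd -[quad (inner_form H) x]/(n2 x); ring.
have h1 : - (c + t) * n2 x <= `|c + t| * n2 x.
  by rewrite ler_wpM2r ?n2_ge0// -normrN ler_norm.
have h3 : (c + t) * n2 x <= `|c + t| * n2 x by rewrite ler_wpM2r ?n2_ge0// ler_norm.
have h2 : `|c + t| * n2 x <= `|c + t| * quad g x by rewrite ler_wpM2l// g_ge.
rewrite qx; apply/andP; move: h1 h2 h3; split; lra.
Qed.

Lemma quad_translate t x : quad (q t) x = quad fa x - t * n2 x.
Proof. by rewrite quad_fadd mulNr. Qed.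

Lemma translate_mono t t' x : t < t' -> x != 0 ->
  quad (q t) x <= 0 -> quad (q t') x < 0.
Proof.
move=> tt' x0; rewrite !quad_translate => h.
have : t * n2 x < t' * n2 x by rewrite ltr_pM2r// n2_gt0.
move: h; lra.
Qed.

Lemma translate_cont t t' x : fdom g x ->
  `|quad (q t') x - quad (q t) x| <= 1 * `|t' - t| * quad g x.
Proof.
move=> xV; rewrite !quad_translate.
have -> : quad fa x - t' * n2 x - (quad fa x - t * n2 x) = - ((t' - t) * n2 x) by ring.
by rewrite normrN normrM mul1r (ger0_norm (n2_ge0 x)) ler_wpM2l// g_ge.
Qed.

Lemma translate_unb (e : nat -> H) k t0 : eigenbasis fa e ->
  exists2 t, t0 < t & neg_dim (q t) k.
Proof.
move=> eb; pose t := Num.max t0 (quad fa (e k)) + 1.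
have t1 : t0 < t by rewrite /t ltr_pwDr// le_max lexx.
have t3 : quad fa (e k) < t by rewrite /t ltr_pwDr// !le_max lexx !orbT.
exists t => //; exists (fun i => e i); split=> [i|f f0]; first exact: (eb_dom eb).
rewrite quad_translate; set x := \sum_i _.
have x0 : 0 < n2 x by exact: (n2_comb_gt0 eb).
have h : quad fa x <= quad fa (e k) * n2 x.
  by apply: (quad_comb_le hfa eb) => i ik; apply: (eb_nondecr eb); exact: ltnW.
by rewrite subr_lt0; apply: (le_lt_trans h); rewrite ltr_pM2r.
Qed.

End Translates.

(** * The block operator matrix *)

Lemma rnorm_pair (R : realType) (E F : normedModType R[i]) (x : E) (y : F) (C : R) :
  (rnorm ((x, y) : E * F) <= C) = (rnorm x <= C) && (rnorm y <= C).
Proof.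
have h (K : normedModType R[i]) (z : K) : `|z| = (rnorm z)%:C.
  by rewrite [LHS]complexE (ger0_Im (normr_ge0 z)) mulr0 addr0.
rewrite -!lecR -!h prod_normE /= comparable_ge_max//; apply: real_comparable; exact: normr_real.
Qed.

Lemma nbhs_block (R : realType) (H K : hilbertType R) (p : (H * K) * (H * K)) (e : R) :
  0 < e -> nbhs p [set q : (H * K) * (H * K) |
    [/\ n2 (q.1.1 - p.1.1) < e, n2 (q.1.2 - p.1.2) < e,
        n2 (q.2.1 - p.2.1) < e & n2 (q.2.2 - p.2.2) < e]].
Proof.
case: p => [[x y] [f h]] e0 /=.
exists ([set r : H * K | n2 (r.1 - x) < e /\ n2 (r.2 - y) < e],
        [set r : H * K | n2 (r.1 - f) < e /\ n2 (r.2 - h) < e]) => /=.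
  split.
    exists ([set r | n2 (r - x) < e], [set r | n2 (r - y) < e]) => /=.
      by split; exact: nbhs_n2.
    by move=> [r r'] [].
  exists ([set r | n2 (r - f) < e], [set r | n2 (r - h) < e]) => /=.
    by split; exact: nbhs_n2.
  by move=> [r r'] [].
by move=> [[r1 r2] [r3 r4]] /= [[] ? ? [? ?]].
Qed.

Lemma nbhs_pair2 (R : realType) (H K : hilbertType R) (p : H * K) (e : R) :
  0 < e -> nbhs p [set q : H * K | n2 (q.1 - p.1) < e /\ n2 (q.2 - p.2) < e].
Proof.
case: p => [x y] e0 /=.
exists ([set r | n2 (r - x) < e], [set r | n2 (r - y) < e]) => /=.
  by split; exact: nbhs_n2.
by move=> [r r'] [].
Qed.

Lemma cvg_inv (R : realType) (H : hilbertType R) (u : nat -> H) x (K : R) :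
  (forall n, n2 (u n - x) <= K / n.+1%:R) -> u @ \oo --> x.
Proof.
move=> h; apply/cvg_n2 => e e0; have [N hN] := ex_inv_lt K e0; exists N => n Nn.
exact: le_lt_trans (h n) (hN n Nn).
Qed.

Lemma closure_seq (R : realType) (T : topologicalType) (S : set T) (u : nat -> T) p :
  (forall n, S (u n)) -> u @ \oo --> p -> closure S p.
Proof.
move=> uS up O Op; have [N _ hN] := up _ Op; exists (u N); split=> //.
exact: hN N (leqnn N).
Qed.

Lemma ip_young (R : realType) (H : hilbertType R) (x y : H) (K : R) : 0 < K ->
  2 * `|ip x y| <= K * n2 x + n2 y / K.
Proof.
move=> K0; have h0 := n2_ge0 (K%:C *: x + y); have h1 := n2_ge0 (K%:C *: x - y).
have Ki : 0 < K^-1 by rewrite invr_gt0.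
rewrite n2D n2Zr ipZl in h0; rewrite n2B n2Zr ipZl in h1.
have e1 : K^-1 * (K ^+ 2 * n2 x + n2 y + 2 * (K * ip x y)) = K * n2 x + n2 y / K + 2 * ip x y.
  by field; rewrite gt_eqF.
have e2 : K^-1 * (K ^+ 2 * n2 x + n2 y - 2 * (K * ip x y)) = K * n2 x + n2 y / K - 2 * ip x y.
  by field; rewrite gt_eqF.
have := mulr_ge0 (ltW Ki) h0; have := mulr_ge0 (ltW Ki) h1; rewrite e1 e2.
by case: (ger0P (ip x y)); lra.
Qed.

Section Block.
Context {R : realType} {H1 H2 : hilbertType R}.
Context {A : set (H1 * H1)} {B : set (H2 * H1)} {D : set (H2 * H2)}.
Context {fa : qform H1} {fd : qform H2} {c : R}.
Let g := fadd fa c (inner_form H1).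
Hypothesis formA : closed_form_of A fa.
Hypothesis formD : closed_form_of D fd.
Hypothesis hg : Defs.symmetric_form g.
Hypothesis g_ge : forall x, fdom g x -> n2 x <= quad g x.
Hypothesis g_closed : closed_form g.
Hypothesis linear_B : linear_operator B.
Hypothesis dense_B : dense (op_dom B).
Hypothesis dom_fa : fdom fa `<=` op_dom (adjoint B).
Hypothesis saD : selfadjoint D.
Hypothesis dom_B : (op_dom B `<=` op_dom D /\ op_core D (op_dom B)) \/ fdom fd `<=` op_dom B.
Hypothesis aboveD : bounded_from_above D.
Variables a b dp : R.
Hypothesis b_ge0 : 0 <= b.
Hypothesis ab : forall x, fdom fa x ->
  rnorm (op_app (adjoint B) x) ^+ 2 <= a * rnorm x ^+ 2 + b * quad fa x.
Hypothesis dpP : is_max (real_spectrum D) dp.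
Let mu := dp + b + Num.sqrt (Num.max (b * dp + b ^+ 2 + a) 0).
Notation Bs := (op_app (adjoint B)).
Notation G := (@Dres R H2 D).
Notation s := (schur_form fa B D).

(** Candidate for the closure: the second row reads D y = h + B^* x, and the first is imposed
    weakly, with <B y, u> replaced by <y, B^* u>. Thus x ranges over the form domain and y over dom
    D. *)
Definition weak_block : set ((H1 * H2) * (H1 * H2)) :=
  [set p | [/\ fdom fa p.1.1, D (p.1.2, p.2.2 + Bs p.1.1) &
    forall u, fdom fa u -> fa p.1.1 u + '[p.1.2, Bs u] = '[p.2.1, u]]].

Let hfa : Defs.symmetric_form fa := fa_sym formA.
Let BsPl' := BsPl dense_B dom_fa.

Lemma BsB x y : fdom fa x -> fdom fa y -> Bs (x - y) = Bs x - Bs y.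
Proof.
move=> xV yV; have := BsPl' (-1) yV xV.
by rewrite !scaleN1r addrC (addrC (- Bs y)).
Qed.

Lemma BsD x y : fdom fa x -> fdom fa y -> Bs (x + y) = Bs x + Bs y.
Proof. by move=> xV yV; have := BsPl' 1 xV yV; rewrite !scale1r. Qed.

Lemma BsZ r x : fdom fa x -> Bs (r *: x) = r *: Bs x.
Proof.
move=> xV; have V0 := fdom0 hfa.
have := BsPl' 0 V0 V0; rewrite scaler0 addr0 scale0r add0r => B0.
have := BsPl' r xV V0; rewrite addr0 => ->; suff -> : Bs 0 = 0 by rewrite addr0.
by have := BsPl' 1 V0 V0; rewrite scale1r addr0 scale1r => /eqP; rewrite -subr_eq0 opprD addNKr oppr_eq0 => /eqP.
Qed.

(* The weak identities are tested on all u, so real parts suffice. *)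
Lemma weak_of_real x y f : fdom fa x ->
  (forall u, fdom fa u -> rq fa x u + ip y (Bs u) = ip f u) ->
  forall u, fdom fa u -> fa x u + '[y, Bs u] = '[f, u].
Proof.
move=> xV h u uV; apply/eqP; rewrite eq_complex; apply/andP; split; apply/eqP.
  by rewrite ReD; exact: h.
rewrite ImD -(rqi hfa)// -[in RHS]ipi -h ?BsZ ?ipi//; exact: (fdomZ hfa).
Qed.

Lemma block_sub_weak : block_operator A B (adjoint B) D `<=` weak_block.
Proof.
move=> [[x y] [f h]] [u0 [v [w [z [/= Axu Byv Bxw Dyz [-> ->]]]]]].
have [xV hx] := dom_A_fa formA Axu.
have wE : Bs x = w by apply: (op_appP (adjoint_linear dense_B)).
split=> //=; first by rewrite wE addrAC addNr add0r.
move=> u uV; rewrite hx// linearDl; congr (_ + _).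
by have := BsP dom_fa uV Byv.
Qed.

(** Subtracting two approximate equations and testing with the difference of the x-components makes
    these Cauchy in [g]; B^* is bounded with respect to [g], so both rows pass to the limit. *)
Lemma weak_block_closed : closure weak_block `<=` weak_block.
Proof.
move=> [[x y] [f h]] cl.
have /choice[p hp] : forall n : nat, exists q : (H1 * H2) * (H1 * H2), weak_block q /\
    [/\ n2 (q.1.1 - x) < n.+1%:R^-1, n2 (q.1.2 - y) < n.+1%:R^-1,
        n2 (q.2.1 - f) < n.+1%:R^-1 & n2 (q.2.2 - h) < n.+1%:R^-1].
  move=> n; have n0 : 0 < n.+1%:R^-1 :> R by rewrite invr_gt0 ltr0n.
  by have [q [wq hq]] := cl _ (nbhs_block ((x, y), (f, h)) n0); exists q.
pose xn n := (p n).1.1; pose yn n := (p n).1.2; pose fn n := (p n).2.1; pose hn n := (p n).2.2.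
have xnV n : fdom g (xn n) by have [[]] := hp n.
have xnx : xn @ \oo --> x.
  by apply: (cvg_inv (K := 1)) => n; rewrite div1r ltW//; have [_ []] := hp n.
have yny : yn @ \oo --> y.
  by apply: (cvg_inv (K := 1)) => n; rewrite div1r ltW//; have [_ []] := hp n.
have fnf : fn @ \oo --> f.
  by apply: (cvg_inv (K := 1)) => n; rewrite div1r ltW//; have [_ []] := hp n.
have hnh : hn @ \oo --> h.
  by apply: (cvg_inv (K := 1)) => n; rewrite div1r ltW//; have [_ []] := hp n.
have dif (H : hilbertType R) (un : nat -> H) v n k : n2 (un n - v) < n.+1%:R^-1 ->
    n2 (un k - v) < k.+1%:R^-1 -> n2 (un n - un k) <= 2 * (n.+1%:R^-1 + k.+1%:R^-1).
  move=> h1 h2; have -> : un n - un k = (un n - v) + - (un k - v) by rewrite opprB addrA subrK.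
  apply: (le_trans (n2D_le _ _)); rewrite n2N mulrDr; apply: lerD; rewrite ler_pM2l//; exact: ltW.
have [K K0 hK] := Bs_bound g_ge b_ge0 ab.
(* Chosen so that Young's inequality bounds the B^* term by a multiple of the y-difference plus one
   half of [g], which is absorbed on the left. *)
pose K1 := K + 1; have K10 : 0 < K1 by rewrite ltr_wpDl.
have youngB u v : fdom fa v -> 2 * `|ip u (Bs v)| <= K1 * n2 u + quad g v.
  move=> vV; apply: (le_trans (ip_young u (Bs v) K10)); rewrite lerD2l ler_pdivrMr//.
  apply: (le_trans (hK v vV)); rewrite mulrDr mulr1 mulrC lerDl.
  exact: (base_ge0 g_ge).
have real n u : fdom fa u -> rq fa (xn n) u + ip (yn n) (Bs u) = ip (fn n) u.
  by have [[_ _ hw] _] := hp n; move=> /hw /(congr1 (@complex.Re R)); rewrite ReD.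
have [|x' [x'V xg xx']] := base_complete hg g_ge g_closed (K := 2 * (2 * `|c| + 1 + 1 + K1)) xnV.
  move=> n k; set d := xn n - xn k.
  have dV : fdom fa d by exact: (fdomB hg).
  have e1 : quad fa d + ip (yn n - yn k) (Bs d) = ip (fn n - fn k) d.
    have -> : quad fa d = rq fa (xn n) d - rq fa (xn k) d.
      exact: (rqBl hfa (xnV n) (xnV k) dV).
    by have := real n d dV; have := real k d dV; rewrite !ipBl => h1 h2; rewrite -h1 -h2; ring.
  have h1 : n2 d <= 2 * (n.+1%:R^-1 + k.+1%:R^-1).
    by apply: (dif _ xn x); [have [_ []] := hp n|have [_ []] := hp k].
  have h2 : n2 (yn n - yn k) <= 2 * (n.+1%:R^-1 + k.+1%:R^-1).
    by apply: (dif _ yn y); [have [_ []] := hp n|have [_ []] := hp k].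
  have h3 : n2 (fn n - fn k) <= 2 * (n.+1%:R^-1 + k.+1%:R^-1).
    by apply: (dif _ fn f); [have [_ []] := hp n|have [_ []] := hp k].
  have h4 := youngB (yn n - yn k) d dV.
  have h5 := ip_young (fn n - fn k) d (ltr01 : (0 : R) < 1).
  rewrite -mulrDr; move: (n.+1%:R^-1 + k.+1%:R^-1) h1 h2 h3 => r h1 h2 h3.
  have h6 : c * n2 d <= `|c| * (2 * r).
    apply: (@le_trans _ _ (`|c| * n2 d)); first by rewrite ler_wpM2r ?n2_ge0// ler_norm.
    by rewrite ler_wpM2l.
  have h7 : K1 * n2 (yn n - yn k) <= K1 * (2 * r) by rewrite ler_wpM2l// ltW.
  have h8 := ler_norm (ip (fn n - fn k) d).
  have h9 := ler_norm (- ip (yn n - yn k) (Bs d)); rewrite normrN in h9.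
  have e2 : quad g d = quad fa d + c * n2 d by exact: quad_fadd.
  rewrite mul1r divr1 in h5.
  move: e1 e2 h1 h3 h4 h5 h6 h7 h8 h9; lra.
have xE : x' = x by apply: (cvg_unique (@norm_hausdorff _ _) ((cvg_n2 xn x').1 xx') xnx).
rewrite {}xE in x'V xg xx'.
have [Kf Kf0 hKf] : exists2 Kf : R, 0 <= Kf & forall x, fdom g x -> `|quad fa x| <= Kf * quad g x.
  exists (1 + `|c|); first by rewrite addr_ge0.
  move=> u uV; have -> : quad fa u = quad g u - c * n2 u by rewrite [quad g u]quad_fadd addrK.
  apply: (le_trans (ler_normB _ _)); rewrite ger0_norm; last exact: (base_ge0 g_ge).
  by rewrite mulrDl mul1r lerD2l normrM (ger0_norm (n2_ge0 u)) ler_wpM2l// g_ge.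
have Bsx : (fun n => Bs (xn n)) @ \oo --> Bs x.
  apply/cvg_n2 => e e0; have eK : 0 < e / K1 by rewrite divr_gt0.
  have [N hN] := xg _ eK; exists N => n Nn; rewrite -BsB//; last exact: xnV.
  have dV : fdom g (xn n - x) by exact: (fdomB hg).
  apply: (le_lt_trans (hK _ dV)); apply: (@le_lt_trans _ _ (K1 * quad g (xn n - x))).
    by rewrite ler_wpM2r ?(base_ge0 g_ge)// lerDl.
  by rewrite mulrC -ltr_pdivlMr// hN.
split=> //=.
  have aD : adjoint D = D by case: saD.
  rewrite -aD => -[u v] Duv /=; rewrite -[v in LHS]scale1r -[u in RHS]scale1r.
  rewrite innerC [RHS]innerC; congr (Num.conj _).
  apply: inner_eq => r.
  have c1 := ip_cvg (y := r *: (1 *: v)) yny.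
  have c2 : ip (hn n + Bs (xn n)) (r *: (1 *: u)) @[n --> \oo] --> ip (h + Bs x) (r *: (1 *: u)).
    apply: (ip_cvg (u := fun n => hn n + Bs (xn n))); exact: cvgD.
  apply: (cvg_unique _ c1) => //.
  rewrite (_ : (fun n => _) = (fun n => ip (hn n + Bs (xn n)) (r *: (1 *: u)))) //.
  apply/funext => n; have [[_ hD _] _] := hp n.
  rewrite /ip !innerZr; congr (complex.Re (_ * (_ * _))).
  by rewrite -(D_sym saD hD Duv).
apply: weak_of_real => // u uV.
have c1 := rq_cvg hfa hg erefl Kf0 hKf (base_ge0 g_ge) xnV x'V uV xg.
have c2 : rq fa (xn n) u + ip (yn n) (Bs u) @[n --> \oo] --> rq fa x u + ip y (Bs u).
  by apply: cvgD => //; exact: ip_cvg.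
apply: (cvg_unique _ c2) => //.
rewrite (_ : (fun n => _) = (fun n => ip (fn n) u)); first exact: ip_cvg.
by apply/funext => n; exact: real.
Qed.

(** The functional on the right of the reduced equation for x; the bound makes [riesz] and
    [form_solve] applicable. *)
Lemma block_form_functional (K : R) (f : H1) (y : H2) :
  0 <= K -> (forall x, fdom fa x -> n2 (Bs x) <= K * quad g x) ->
  forall u, fdom g u -> (ip f u - ip y (Bs u)) ^+ 2 <= (2 * n2 f + 2 * K * n2 y) * quad g u.
Proof.
move=> K0 hK u uV; have h1 := ip_CS f u; have h2 := ip_CS y (Bs u).
have h3 : n2 f * n2 u <= n2 f * quad g u by rewrite ler_wpM2l ?n2_ge0// g_ge.
have h4 : n2 y * n2 (Bs u) <= n2 y * (K * quad g u) by rewrite ler_wpM2l ?n2_ge0// hK.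
have h5 := sqr_ge0 (ip f u + ip y (Bs u)).
have -> : (ip f u - ip y (Bs u)) ^+ 2 =
  2 * ip f u ^+ 2 + 2 * ip y (Bs u) ^+ 2 - (ip f u + ip y (Bs u)) ^+ 2 by ring.
move: h1 h2 h3 h4 h5; lra.
Qed.

(** Under (II) y already lies in dom B, so the pair belongs to the block operator itself. Under (I)
    y is approximated from the core in the graph of D, and each approximation is completed by an
    x-component in dom A. *)
Lemma weak_sub_block : weak_block `<=` closure (block_operator A B (adjoint B) D).
Proof.
move=> [[x y] [f h]] [/= xV Dyz hw].
have [|domfd] := dom_B; last first.
  have [v Byv] : op_dom B y.
    by apply: domfd; case: formD => _ _ _ _ fdE; move: Dyz; rewrite -fdE => -[].
  apply: subset_closure; exists (f - v), v, (Bs x), (h + Bs x); split => //=.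
  - apply: (A_intro formA) => // u uV; rewrite linearBl /= -hw//.
    by have := BsP dom_fa uV Byv; rewrite /= => ->; rewrite addrK.
  - exact: (BsP dom_fa).
  - by rewrite subrK addrCA addNr addr0.
move=> [_ [_ coreD]].
set z := h + Bs x in Dyz.
have /choice[q hq] : forall n : nat, exists q : H2 * H2, (D q /\ op_dom B q.1) /\
    n2 (q.1 - y) <= 1 / n.+1%:R /\ n2 (q.2 - z) <= 1 / n.+1%:R.
  move=> n; have n0 : 0 < n.+1%:R^-1 :> R by rewrite invr_gt0 ltr0n.
  rewrite -coreD in Dyz; have [q [Sq [q1 q2]]] := Dyz _ (nbhs_pair2 (y, z) n0).
  by exists q; split=> //; rewrite div1r; split; exact: ltW.
have /choice[v hv] : forall n, exists v, B ((q n).1, v) by move=> n; have [[_ h0] _] := hq n.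
have [K K0 hK] := Bs_bound g_ge b_ge0 ab.
have quadg u : quad g u = quad fa u + c * n2 u by exact: quad_fadd.
have rqg u w : rq g u w = rq fa u w + c * ip u w by exact: rq_fadd.
have wr u : fdom fa u -> rq fa x u = ip f u - ip y (Bs u).
  by move=> /hw /(congr1 (@complex.Re R)); rewrite ReD => h0; rewrite /rq /ip -h0 addrK.
(* [xn] solves (A + c) xn = f + c x - B y_n with y_n the first entry of [q n]. The given x satisfies
   the same weak equation with y in place of y_n, so y_n - y controls xn - x. *)
have /choice[xn hxn] : forall n, exists xn, fdom g xn /\ forall u, fdom g u ->
    rq g xn u = ip (f + c%:C *: x) u - ip (q n).1 (Bs u).
  move=> n; pose y0 := (q n).1; pose f0 := f + c%:C *: x.
  have K20 : 0 <= 2 * n2 f0 + 2 * K * n2 y0 by rewrite addr_ge0// mulr_ge0 ?n2_ge0// mulr_ge0.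
  have [||||xn xnV hxn] := @riesz _ _ _ hg g_ge g_closed g 1 1 (2 * n2 f0 + 2 * K * n2 y0)
     (fun u => ip f0 u - ip y0 (Bs u)) hg erefl ltr01 K20; last by exists xn.
  - by move=> u _; rewrite mul1r lexx.
  - by move=> u w uV wV; rewrite BsD// !ipDr opprD addrACA.
  - by move=> t u uV; rewrite BsZ// !ipZr mulrBr.
  - exact: block_form_functional.
have xnV n : fdom g (xn n) by case: (hxn n).
have Axn n : A (xn n, f + c%:C *: (x - xn n) - v n).
  apply: (A_intro formA (xnV n)) => u0 u0V; apply: (form_eq_of_rq hfa (xnV n) _ u0V) => u uV.
  have [_ /(_ u uV)] := hxn n; rewrite rqg => h1.
  have h2 : ip (v n) u = ip (q n).1 (Bs u).
    by have := BsP dom_fa uV (hv n); rewrite /ip /= => ->.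
  have -> : rq fa (xn n) u = ip (f + c%:C *: x) u - ip (q n).1 (Bs u) - c * ip (xn n) u.
    by rewrite -h1 addrK.
  by rewrite ipBl !ipDl !ipZl ipBl h2; ring.
have xng n : quad g (xn n - x) <= (K + 1) / n.+1%:R.
  set d := xn n - x; have dV : fdom g d by exact: (fdomB hg).
  have h1 : quad g d = - ip ((q n).1 - y) (Bs d).
    have -> : quad g d = rq g (xn n) d - rq g x d by exact: (rqBl hg (xnV n) xV dV).
    have [_ ->//] := hxn n; rewrite rqg wr// ipDl ipZl ipBl; ring.
  have K10 : 0 < K + 1 by rewrite ltr_wpDl.
  have h2 := ip_young ((q n).1 - y) (Bs d) K10.
  have h3 : n2 (Bs d) / (K + 1) <= quad g d.
    rewrite ler_pdivrMr// mulrC; apply: (le_trans (hK d dV)).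
    by rewrite ler_wpM2r ?(base_ge0 g_ge)// lerDl.
  have h4 := ler_norm (- ip ((q n).1 - y) (Bs d)); rewrite normrN -h1 in h4.
  have [_ [h5 _]] := hq n.
  have h6 : (K + 1) * n2 ((q n).1 - y) <= (K + 1) / n.+1%:R.
    by rewrite ler_wpM2l ?(ltW K10)//; apply: (le_trans h5); rewrite div1r.
  move: h2 h3 h4 h6; move: (n2 (Bs d) / (K + 1)) ((K + 1) * n2 ((q n).1 - y)) => p1 p2.
  move: ((K + 1) / n.+1%:R) => p3; lra.
have dV n : fdom g (xn n - x) by exact: (fdomB hg).
have xnx n : n2 (xn n - x) <= (K + 1) / n.+1%:R by apply: le_trans (xng n); exact: g_ge.
have cx : xn @ \oo --> x by exact: cvg_inv xnx.
have cy : (fun n => (q n).1) @ \oo --> y.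
  by apply: (cvg_inv (K := 1)) => n; have [_ []] := hq n.
have cz : (fun n => (q n).2) @ \oo --> z.
  by apply: (cvg_inv (K := 1)) => n; have [_ []] := hq n.
have cB : (fun n => Bs (xn n)) @ \oo --> Bs x.
  apply: (cvg_inv (K := K * (K + 1))) => n; rewrite -BsB//; last exact: xnV.
  by apply: (le_trans (hK _ (dV n))); rewrite -mulrA ler_wpM2l.
have cf : (fun n => f + c%:C *: (x - xn n)) @ \oo --> f.
  apply: (cvg_inv (K := c ^+ 2 * (K + 1))) => n; rewrite addrAC subrr add0r n2Zr.
  by rewrite -n2N opprB -mulrA ler_wpM2l ?sqr_ge0.
have ch : (fun n => - Bs (xn n) + (q n).2) @ \oo --> h.
  rewrite (_ : h = - Bs x + z); last by rewrite /z addrCA addNr addr0.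
  by apply: cvgD => //; exact: cvgN.
apply: (@closure_seq R _ _ (fun n => ((xn n, (q n).1),
   (f + c%:C *: (x - xn n), - Bs (xn n) + (q n).2)))).
  move=> n; exists (f + c%:C *: (x - xn n) - v n), (v n), (Bs (xn n)), (q n).2; split=> //=.
  - exact: (BsP dom_fa (xnV n)).
  - by have [[]] := hq n; case: (q n).
  - by rewrite subrK.
exact: (cvg_pair (cvg_pair cx cy) (cvg_pair cf ch)).
Qed.

Lemma closure_block : closure (block_operator A B (adjoint B) D) = weak_block.
Proof.
apply/seteqP; split; last exact: weak_sub_block.
by move=> p hp; apply: weak_block_closed; apply: closure_subset hp; exact: block_sub_weak.
Qed.

(** The second row gives y = (D - t)^{-1} (h + B^* x); substituted into the first row, this leaves
    an equation for x in the Schur form. *)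
Lemma weak_block_shift t x y f h : mu < t ->
  op_shift weak_block t%:C ((x, y), (f, h)) <->
  [/\ fdom fa x, y = G t (h + Bs x) &
      forall u, fdom fa u -> s t x u = '[f, u] - '[G t h, Bs u]].
Proof.
move=> mt; have dt := mu_dp' b_ge0 mt.
have GD w w' : G t (w + w') = G t w + G t w'.
  by have := DresPl saD dpP 1 w w' dt; rewrite !scale1r.
have eqs u : fdom fa u -> y = G t (h + Bs x) ->
    (fa x u + '[y, Bs u] = '[f + t%:C *: x, u] <-> s t x u = '[f, u] - '[G t h, Bs u]).
  move=> uV ->; rewrite schurE GD !linearDl linearZl_LR /=; split=> [e|e].
    apply: (addIr ('[G t h, Bs u] + t%:C * '[x, u])); rewrite subrKA -e; ring.
  apply: (addIr (- '[G t h, Bs u] - t%:C * '[x, u])); rewrite addrA -[RHS]addrA.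
  rewrite (_ : '[f, u] + (t%:C * '[x, u] + (- '[G t h, Bs u] - t%:C * '[x, u])) =
    '[f, u] - '[G t h, Bs u]); last by ring.
  rewrite -e; ring.
split=> [[/= xV Dy hw]|[xV yE hs]].
  have yE : y = G t (h + Bs x) by apply: (Dres_unique dpP dt); rewrite addrAC.
  by split=> // u uV; apply/eqs => //; exact: hw.
split=> //=; first by rewrite addrAC yE; exact: (DresP dpP).
by move=> u uV; apply/eqs => //; exact: hs.
Qed.

Let Phi t x : H1 * H2 := (x, G t (Bs x)).

(** [Phi t] carries a basis of the kernel to one of the eigenspace, the first coordinate being its
    inverse. Its linearity is available on the form domain, so sums are kept there. *)
Lemma eigenspace_dim t k : mu < t -> has_dim (form_kernel (s t)) k ->
  has_dim (op_eigenspace weak_block t%:C) k.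
Proof.
move=> mt [e [We fe]]; have dt := mu_dp' b_ge0 mt.
have eK i : form_kernel (s t) (e i).
  rewrite We; exists (fun j => (j == i)%:R).
  rewrite (bigD1 i)//= eqxx scale1r big1 ?addr0// => j ji.
  by rewrite (negbTE ji) scale0r.
have eV i : fdom fa (e i) by case: (eK i).
have PhiP r x y : fdom fa x -> fdom fa y -> Phi t (r *: x + y) = r *: Phi t x + Phi t y.
  by move=> xV yV; rewrite /Phi BsPl' // (DresPl saD dpP).
have V0 := fdom0 hfa.
have Phi0 : Phi t 0 = 0.
  by have := PhiP (-1) 0 0 V0 V0; rewrite scaler0 addr0 scaleN1r addNr.
have sumV (c0 : 'I_k -> R[i]) (r : seq 'I_k) : fdom fa (\sum_(i <- r) c0 i *: e i).
  by apply: (fdom_sum hfa) => i _; exact: (fdomZ hfa).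
have Phisum (c0 : 'I_k -> R[i]) : Phi t (\sum_i c0 i *: e i) = \sum_i c0 i *: Phi t (e i).
  elim: (index_enum 'I_k) => [|i r ih]; first by rewrite !big_nil Phi0.
  by rewrite !big_cons PhiP// ih.
have eigP x y : op_eigenspace weak_block t%:C (x, y) <-> form_kernel (s t) x /\ y = G t (Bs x).
  have := @weak_block_shift t x y 0 0 mt; rewrite /op_shift /= !add0r => h.
  have e0 : t%:C *: (x, y) = (t%:C *: x, t%:C *: y) by [].
  have G0 : G t 0 = 0 by have := congr1 snd Phi0; rewrite /Phi /=;
    have := DresPl saD dpP (-1) 0 0 dt; rewrite scaler0 addr0 scaleN1r addNr.
  split=> [hM|[[xV hx] yE]].
    have [xV yE hs] := h.1 hM; split=> //; split=> // u uV.
    by have := hs u uV; rewrite G0 !linear0l subrr; exact.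
  by apply/h; split=> // u uV; rewrite G0 !linear0l subrr; exact: hx.
exists (fun i => Phi t (e i)); split; last first.
  move=> c0 hc; apply: fe; have : Phi t (\sum_i c0 i *: e i) = 0 by rewrite Phisum.
  by move/(congr1 fst).
apply/seteqP; split=> [[x y] /eigP[xK ->]|_ [c0 ->]] /=.
  move: xK; rewrite We => -[c0 ->]; exists c0; exact: Phisum.
rewrite -Phisum; apply/eigP; split=> //; rewrite We; by exists c0.
Qed.

(** With trivial kernel no eigenvalue of s(t) is zero, so [form_solve] gives x with a bound on g[x],
    and y follows from the resolvent of D. Conversely a kernel vector violates uniqueness for the
    zero right-hand side. *)
Lemma spectrum_kernel t : mu < t -> (exists e, eigenbasis (s t) e) ->
  real_spectrum weak_block t <-> exists2 x, x != 0 & form_kernel (s t) x.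
Proof.
move=> mt [e eb]; have dt := mu_dp' b_ge0 mt.
have hs := schur_sym hfa dense_B dom_fa saD b_ge0 dpP mt.
have adm := schur_adm hfa g_ge dense_B dom_fa saD aboveD b_ge0 ab dpP mt.
have G0 : G t 0 = 0.
  by have := DresPl saD dpP (-1) 0 0 dt; rewrite scaler0 addr0 scaleN1r addNr.
have V0 := fdom0 hfa.
have B0 : Bs 0 = 0 by have := BsPl' (-1) V0 V0; rewrite scaler0 addr0 scaleN1r addNr.
split; last first.
  move=> [x x0 [xV hx]] [hex _]; have [p [_ hp]] := hex 0.
  have e1 : op_shift weak_block t%:C ((x, G t (Bs x)), (0, 0)).
    apply/(weak_block_shift _ _ _ _ mt); split=> //; first by rewrite add0r.
    by move=> u uV; rewrite hx// G0 !linear0l subrr.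
  have e2 : op_shift weak_block t%:C ((0, 0), (0, 0)).
    apply/(weak_block_shift _ _ _ _ mt); split=> //; first by rewrite add0r B0 G0.
    by move=> u uV; rewrite (form0l hs)// G0 !linear0l subrr.
  have := hp _ e1; rewrite (hp _ e2) => -[x00 _].
  by rewrite -x00 eqxx in x0.
move=> hspec; apply: contrapT => hker; apply: hspec.
have l0 n : quad (s t) (e n) != 0.
  apply/eqP => ln; apply: hker; exists (e n).
    by apply/eqP => en; have := eb_n2 eb n; rewrite en n20 => /eqP; rewrite eq_sym oner_eq0.
  split; first exact: (eb_dom eb).
  by move=> u uV; rewrite (eb_eig eb)// ln mul0r.
have [C0 C00 hsolve] := form_solve hg g_ge g_closed adm eb l0.
have [K K0 hK] := Bs_bound g_ge b_ge0 ab.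
have uniq x : fdom fa x -> (forall u, fdom fa u -> s t x u = 0) -> x = 0.
  move=> xV hx; apply/eqP/negPn/negP => x0; apply: hker; exists x => //.
have sol f h : exists x y, op_shift weak_block t%:C ((x, y), (f, h)) /\
    quad g x <= C0 * (2 * n2 f + 2 * K * n2 (G t h)).
  pose M := 2 * n2 f + 2 * K * n2 (G t h).
  have M0 : 0 <= M by rewrite addr_ge0// mulr_ge0 ?n2_ge0// mulr_ge0.
  have [|||x [xV hx gx]] := hsolve (fun u => ip f u - ip (G t h) (Bs u)) M M0.
  - by move=> u w uV wV; rewrite BsD// !ipDr opprD addrACA.
  - by move=> r u uV; rewrite BsZ// !ipZr mulrBr.
  - exact: block_form_functional.
  exists x, (G t (h + Bs x)); split=> //; apply/(weak_block_shift _ _ _ _ mt); split=> //.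
  move=> u uV; apply/eqP; rewrite eq_complex; apply/andP; split; apply/eqP.
    by rewrite [RHS]ReD ReN -[LHS]/(rq (s t) x u) hx.
  rewrite -(rqi hs)// [RHS]ImD ImN hx; last exact: (fdomZ hfa).
  by rewrite BsZ// !ipi.
split.
  move=> [f h]; have [x [y [hxy _]]] := sol f h; exists (x, y); split=> //.
  move=> [x' y'] hxy'.
  have [xV yE hx] := (weak_block_shift _ _ _ _ mt).1 hxy.
  have [xV' yE' hx'] := (weak_block_shift _ _ _ _ mt).1 hxy'.
  suff xx : x = x' by rewrite yE yE' xx.
  apply/subr0_eq/uniq; first exact: (fdomB hfa).
  move=> u uV; rewrite addrC -scaleN1r (formPl hs)// hx// hx'//.
  by rewrite mulN1r addNr.
pose Kd := ((t - dp) ^+ 2)^-1.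
have Kd0 : 0 <= Kd by rewrite invr_ge0 sqr_ge0.
have td0 : 0 < (t - dp) ^+ 2 by rewrite exprn_gt0// subr_gt0.
have Gle w : n2 (G t w) <= Kd * n2 w.
  by rewrite mulrC ler_pdivlMr// mulrC; exact: (Dres_n2 saD aboveD dpP).
pose C1 := C0 * (2 + 2 * K * Kd).
have C10 : 0 <= C1 by rewrite mulr_ge0// addr_ge0// mulr_ge0// mulr_ge0.
pose C2 := Kd * (2 + 2 * (K * C1)).
have C20 : 0 <= C2 by rewrite mulr_ge0// addr_ge0// mulr_ge0// mulr_ge0.
(* [C1] and [C2] bound the squared norms of x and y; the added 1 turns this into a bound on norms
   without square roots, as X <= (1 + X)^2. *)
exists (1 + (C1 + C2)) => -[[f h] [x y]] /= hxy.
set N := rnorm (f, h).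
have := lexx N; rewrite {1}/N rnorm_pair => /andP[fN hN].
have N0 : 0 <= N by apply: le_trans fN; exact: rnorm_ge0.
rewrite !rnorm_le_sqr// in fN hN.
have hxy0 := hxy; have [x' [y' [hxy' gx]]] := sol f h.
have [xV yE hx] := (weak_block_shift _ _ _ _ mt).1 hxy.
have [xV' yE' hx'] := (weak_block_shift _ _ _ _ mt).1 hxy'.
have xx : x = x'.
  apply/subr0_eq/uniq; first exact: (fdomB hfa).
  move=> u uV; rewrite addrC -scaleN1r (formPl hs)// hx// hx'//.
  by rewrite mulN1r addNr.
rewrite -xx in gx.
have gx1 : quad g x <= C1 * N ^+ 2.
  apply: (le_trans gx); rewrite /C1 -[leRHS]mulrA ler_wpM2l// [leRHS]mulrDl.
  apply: lerD; first by rewrite ler_wpM2l.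
  rewrite -!mulrA ler_wpM2l// ler_wpM2l//; apply: (le_trans (Gle h)).
  by rewrite ler_wpM2l.
have y1 : n2 y <= C2 * N ^+ 2.
  rewrite yE; apply: (le_trans (Gle _)); rewrite /C2 -[leRHS]mulrA ler_wpM2l//.
  apply: (le_trans (n2D_le _ _)); rewrite [leRHS]mulrDl; apply: lerD; first by rewrite ler_wpM2l.
  rewrite -[leRHS]mulrA ler_wpM2l// -[leRHS]mulrA; apply: (le_trans (hK x xV)).
  by rewrite ler_wpM2l.
have bb (X : R) : 0 <= X -> X <= C1 + C2 -> X * N ^+ 2 <= ((1 + (C1 + C2)) * N) ^+ 2.
  move=> X0 hX; rewrite exprMn ler_wpM2r ?sqr_ge0//; apply: (le_trans hX).
  have CC : 0 <= C1 + C2 by exact: addr_ge0.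
  have -> : (1 + (C1 + C2)) ^+ 2 = 1 + 2 * (C1 + C2) + (C1 + C2) ^+ 2 by ring.
  by have := sqr_ge0 (C1 + C2); move: CC; lra.
have CN : 0 <= (1 + (C1 + C2)) * N by rewrite mulr_ge0// addr_ge0// addr_ge0.
rewrite rnorm_pair !rnorm_le_sqr//; apply/andP; split.
  apply: (le_trans (g_ge xV)); apply: (le_trans gx1); apply: bb => //.
  by rewrite lerDl.
by apply: (le_trans y1); apply: bb => //; rewrite lerDr.
Qed.

End Block.

(** * Spectral measures and kappa *)

Lemma eseries_EFin (R : realType) (u : nat -> R) (L : R) :
  (\sum_(i < n) u i) @[n --> \oo] --> L -> (\sum_(n <oo) (u n)%:E = L%:E)%E.
Proof.
move=> uL; apply: cvg_lim => //.
rewrite (_ : (fun n => _) = (fun n => (\sum_(i < n) u i)%:E)); first by apply: cvg_EFin => //; exact: nearW.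
by apply/funext => n; rewrite sumEFin big_mkord.
Qed.

Lemma nneg_sum_cvg (R : realType) (u : nat -> R) (M : R) : (forall n, 0 <= u n) ->
  (forall n, \sum_(i < n) u i <= M) ->
  cvg ((\sum_(i < n) u i) @[n --> \oo]).
Proof.
move=> u0 uM; apply: nondecreasing_is_cvgn.
  apply/nondecreasing_seqP => n; rewrite big_ord_recr /= lerDl//.
by exists M => _ [n _ <-].
Qed.

Section Completeness.
Context {R : realType} {H : hilbertType R} {g q : qform H} {e : nat -> H}.
Hypothesis hg : Defs.symmetric_form g.
Hypothesis g_ge : forall x, fdom g x -> n2 x <= quad g x.
Hypothesis g_closed : closed_form g.
Hypothesis g_dense : dense (fdom g).
Hypothesis q_adm : admissible g q.
Hypothesis eb : eigenbasis q e.
Let l n := quad q (e n).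

Let hq : Defs.symmetric_form q. Proof. by case: q_adm. Qed.
Let qg : fdom q = fdom g. Proof. by case: q_adm. Qed.
Let eo N : orthonormal_upto e N. Proof. exact: (eb_upto eb). Qed.

(* (q + C) is coercive, so every right-hand side x is attained weakly. *)
Lemma shifted_solve : exists C : R, (forall n, 0 < l n + C) /\
  forall x, exists2 v, fdom g v & forall u, fdom g u -> rq q v u + C * ip v u = ip x u.
Proof.
case: (q_adm) => _ _ [th [C [K [th0 C0 K0 hth]]]]; exists C; split.
  move=> n; have eV : fdom g (e n) by rewrite -qg; exact: (eb_dom eb).
  have /andP[h _] := hth _ eV; have := g_ge eV; rewrite (eb_n2 eb) => h1.
  rewrite (eb_n2 eb) mulr1 lerBlDr in h; apply: lt_le_trans h.
  by rewrite mulr_gt0// (lt_le_trans _ h1).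
move=> x; have hq' : Defs.symmetric_form (fadd q C (inner_form H)).
  by apply: fadd_sym => //; exact: inner_form_sym.
have [||||v vV hv] := @riesz _ _ _ hg g_ge g_closed (fadd q C (inner_form H)) th (K + C)
   (n2 x) (fun u => ip x u) hq' qg th0 (n2_ge0 x).
- move=> u uV; rewrite quad_fadd -[quad (inner_form H) u]/(n2 u).
  have /andP[h1 h2] := hth u uV; apply/andP; split; first by rewrite -lerBlDr.
  by rewrite mulrDl; apply: lerD => //; rewrite ler_wpM2l// g_ge.
- by move=> u w _ _; rewrite ipDr.
- by move=> t u _; rewrite ipZr.
- by move=> u uV; apply: (le_trans (ip_CS x u)); rewrite ler_wpM2l ?n2_ge0 ?g_ge.
by exists v => // u uV; rewrite -hv// rq_fadd.
Qed.

(** [eb_complete] covers the form domain; here x is arbitrary. The solution v of (q + C) v = x has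
    coefficients <x, e_n> / (l n + C) = 0, hence v = 0, and x is orthogonal to the dense form
    domain. *)
Lemma basis_complete x : (forall n, '[x, e n] = 0) -> x = 0.
Proof.
move=> hx; have [C [lC /(_ x)[v vV hv]]] := shifted_solve.
have v0 : v = 0.
  apply: (eb_complete eb); rewrite ?qg// => n.
  have vV' : fdom q v by rewrite qg.
  have key r : (l n + C) * ip v (r *: e n) = 0.
    have rV : fdom g (r *: e n) by rewrite -qg; apply: (fdomZ hq); exact: (eb_dom eb).
    have := hv _ rV; rewrite [in RHS]/ip innerZr hx mulr0 /= => <-.
    rewrite mulrDl; congr (_ + _); rewrite /rq (formZr hq)//; last exact: (eb_dom eb).
    rewrite (eb_eigr hq eb)// mulrCA ReM /= mul0r subr0 /ip innerZr//.
  rewrite -(linear0l (@inner R H) (e n)); apply: inner_eq => r; rewrite ip0l.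
  by have /eqP := key r; rewrite mulf_eq0 gt_eqF//= => /eqP.
have h u : fdom g u -> ip x u = 0.
  by move=> uV; rewrite -hv// v0 /rq (form0l hq) ?qg// ip0l mulr0 addr0.
apply: n2_eq0; have [u uV ux] := dense_seq x g_dense.
apply: (cvg_unique _ (ip_cvg (y := x) ux)) => //.
rewrite (_ : (fun n => _) = cst 0); first exact: cvg_cst.
by apply/funext => n; rewrite ipC h.
Qed.

Lemma basis_eq x y : (forall n, '[x, e n] = '[y, e n]) -> x = y.
Proof.
by move=> h; apply/subr0_eq/basis_complete => n; rewrite linearBl /= h subrr.
Qed.

Lemma riesz_fischer (f : nat -> R[i]) (M : R) :
  (forall N, \sum_(i < N) abs2 (f i) <= M) ->
  exists y, [/\ forall n, '[y, e n] = f n,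
    (fun N => \sum_(i < N) f i *: e i) @ \oo --> y &
    (\sum_(i < n) abs2 (f i)) @[n --> \oo] --> n2 y].
Proof.
move=> fM; pose S N := \sum_(i < N) abs2 (f i); pose yN N : H := \sum_(i < N) f i *: e i.
have Scv : cvg (S @ \oo) by exact: (nneg_sum_cvg (fun n => abs2_ge0 (f n)) fM).
have yN2 N : n2 (yN N) = S N by exact: (n2_comb (fun i => f (nat_of_ord i)) (eo (N := N))).
have inn N k : (k < N)%N -> '[yN N, e k] = f k.
  by move=> kN; rewrite (inner_comb (fun i => f (nat_of_ord i)) (Ordinal kN) (eo (N := N))).
have yNB n k : (k <= n)%N -> n2 (yN n - yN k) = S n - S k.
  move=> kn; rewrite n2B !yN2.
  have -> : ip (yN n) (yN k) = S k.
    rewrite ipC /ip inner_suml Re_sum; apply: eq_bigr => i _.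
    rewrite linearZl_LR /= innerC inn ?mulc_conj//; exact: leq_trans (ltn_ord i) kn.
  ring.
have [|y yy] := @n2_complete R H yN.
  move=> d d0; have d2 : 0 < d / 2 by rewrite divr_gt0.
  move/cvgrPdist_lt/(_ _ d2): Scv => [N _ hN]; exists N.
  have aux n k : (N <= n)%N -> (N <= k)%N -> (k <= n)%N -> n2 (yN n - yN k) < d.
    move=> Nn Nk kn; rewrite yNB//.
    have := hN n Nn; have := hN k Nk; rewrite /= !ltr_norml => /andP[a1 a2] /andP[a3 a4].
    move: a1 a2 a3 a4; move: (lim _) => L; lra.
  move=> n k Nn Nk; have [kn|nk] := leqP k n; first exact: aux.
  by rewrite -n2N opprB; apply: aux => //; exact: ltnW.
have yc := n2_cvg yy; exists y; split=> //.
  move=> n; have -> : f n = '[f n *: e n, e n] by rewrite linearZl_LR /= (eb_orth eb) eqxx mulr1.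
  apply: inner_eq => r; apply: (cvg_unique _ (ip_cvg (y := r *: e n) yy)) => //.
  apply: cvg_near_cst; exists n.+1 => // m /= nm.
  by rewrite /ip !innerZr inn// linearZl_LR /= (eb_orth eb) eqxx mulr1.
by rewrite (_ : (fun n => _) = (fun n => n2 (yN n)))//; apply/funext => n; rewrite yN2.
Qed.

Lemma bessel_le x N : \sum_(i < N) abs2 '[x, e i] <= n2 x.
Proof. exact: (bessel x (eo (N := N))). Qed.

Lemma parseval x :
  (fun N => \sum_(i < N) '[x, e i] *: e i) @ \oo --> x /\
  (\sum_(i < n) abs2 '[x, e i]) @[n --> \oo] --> n2 x.
Proof.
have [y [h1 h2 h3]] := @riesz_fischer (fun n => '[x, e n]) _ (bessel_le x).
by have yx : y = x by [exact: basis_eq]; rewrite yx in h2 h3.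
Qed.

Lemma parseval_ip x y :
  (\sum_(i < n) complex.Re ('[x, e i] * Num.conj '[y, e i])) @[n --> \oo] --> ip x y.
Proof.
have [h _] := parseval x; have := ip_cvg (y := y) h.
rewrite (_ : (fun n => ip _ _) = (fun n => \sum_(i < n) complex.Re ('[x, e i] * Num.conj '[y, e i])))//.
apply/funext => n; rewrite /ip inner_suml Re_sum; apply: eq_bigr => i _.
by rewrite linearZl_LR /= (innerC (e i)).
Qed.

Lemma inner_eq0_basis x y : (forall n, '[x, e n] = 0 \/ '[y, e n] = 0) -> '[x, y] = 0.
Proof.
move=> h; rewrite -(linear0l (@inner R H) y); apply: inner_eq => r; rewrite ip0l.
have hxy := @parseval_ip x (r *: y).
apply: (cvg_unique _ hxy) => //.
rewrite (_ : (fun n => _) = cst 0); first exact: cvg_cst.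
apply/funext => n; rewrite big1// => i _; rewrite linearZl_LR /=.
by have [->|->] := h i; rewrite ?mul0r// mulr0 rmorph0 mulr0.
Qed.

Definition spec_coef (J : set R) x n : R[i] := if `[< J (l n) >] then '[x, e n] else 0.

(** Given by its coefficients: [riesz_fischer] supplies such a vector, so the default is not taken,
    and completeness makes it unique. *)
Definition spec_proj (J : set R) x : H := xget 0 [set y | forall n, '[y, e n] = spec_coef J x n].

Lemma spec_projE J x n : '[spec_proj J x, e n] = spec_coef J x n.
Proof.
have [N|y [hy _ _]] := @riesz_fischer (spec_coef J x) (n2 x).
  apply: le_trans (bessel_le x N); apply: ler_sum => i _; rewrite /spec_coef.
  by case: asboolP => // _; rewrite /abs2 /= expr0n addr0 abs2_ge0.
by have : [set y | forall n, '[y, e n] = spec_coef J x n] (spec_proj J x) by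
  apply: xgetPex; exists y.
Qed.

Lemma spec_proj_in J x n : J (l n) -> '[spec_proj J x, e n] = '[x, e n].
Proof. by move=> Jl; rewrite spec_projE /spec_coef asboolT. Qed.

Lemma spec_proj_out J x n : ~ J (l n) -> '[spec_proj J x, e n] = 0.
Proof. by move=> Jl; rewrite spec_projE /spec_coef asboolF. Qed.

Lemma spec_proj_sym J x y : '[spec_proj J x, y] = '[x, spec_proj J y].
Proof.
transitivity '[spec_proj J x, spec_proj J y]; apply/eqP; rewrite -subr_eq0.
  rewrite -linearBr; apply/eqP/inner_eq0_basis => n.
  have [Jl|Jl] := pselect (J (l n)); [right|left]; last exact: spec_proj_out.
  by rewrite linearBl /= spec_proj_in// subrr.
rewrite -linearBl; apply/eqP/inner_eq0_basis => n.
have [Jl|Jl] := pselect (J (l n)); [left|right]; last exact: spec_proj_out.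
by rewrite linearBl /= spec_proj_in// subrr.
Qed.

Lemma spec_projI J J' x : spec_proj (J `&` J') x = spec_proj J (spec_proj J' x).
Proof.
apply: basis_eq => n; have [Jl|Jl] := pselect (J (l n)); last first.
  by rewrite !spec_proj_out// => -[].
rewrite [in RHS]spec_proj_in//; have [Jl'|Jl'] := pselect (J' (l n)).
  by rewrite !spec_proj_in.
by rewrite !spec_proj_out// => -[].
Qed.

Lemma form_op_coef x y : form_operator q (x, y) -> forall n, '[y, e n] = (l n)%:C * '[x, e n].
Proof. by move=> [/= xV h] n; rewrite -h ?(eb_eigr hq eb)//; exact: (eb_dom eb). Qed.

(** Square summability of l n <x, e_n> yields the candidate y. Solving (q + C) v = y + C x puts v
    into the form domain, and comparing coefficients gives v = x. *)
Lemma form_op_dom x M :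
  (forall N, \sum_(i < N) (l i) ^+ 2 * abs2 '[x, e i] <= M) -> op_dom (form_operator q) x.
Proof.
move=> hM; have [N|y [hy _ _]] := @riesz_fischer (fun n => (l n)%:C * '[x, e n]) M.
  by under eq_bigr do rewrite abs2M {1}/abs2 /= expr0n addr0; exact: hM.
have [C [lC hs]] := shifted_solve; have [v vV hv] := hs (y + C%:C *: x).
have vV' : fdom q v by rewrite qg.
have hv' u : fdom q u -> q v u = '[y + C%:C *: (x - v), u].
  apply: form_eq_of_rq => // w; rewrite qg => wV.
  have -> : rq q v w = ip (y + C%:C *: x) w - C * ip v w by rewrite -hv// addrK.
  by rewrite !ipDl !ipZl ipBl; ring.
have vx : v = x.
  apply: basis_eq => n; have := hv' _ (eb_dom eb n).
  rewrite (eb_eigr hq eb)// linearDl linearZl_LR linearBl /= hy -/(l n) => h.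
  have lC0 : ((l n)%:C + C%:C : R[i]) != 0.
    by rewrite -rmorphD /= gt_eqF// ltcR lC.
  apply: (mulfI lC0); rewrite mulrDl h; ring.
exists y; split=> /=; first by rewrite -vx.
by move=> u uV; rewrite -vx hv'// vx subrr scaler0 addr0.
Qed.

Definition spec_measure x : {measure set (measurableTypeR R) -> \bar R} :=
  mseries (fun n => mscale (NngNum (abs2_ge0 '[x, e n]))
    (@dirac _ (measurableTypeR R) (l n) R) : {measure set (measurableTypeR R) -> \bar R}) 0.

Lemma spec_measureE x (J : set (measurableTypeR R)) :
  (spec_measure x J = \sum_(n <oo) (abs2 (spec_coef J x n))%:E)%E.
Proof.
apply: eq_eseriesr => n _; rewrite /= /mscale /= diracE /spec_coef.
have [Jl|Jl] := pselect (J (l n)).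
  by rewrite mem_set//= asboolT// mule1.
by rewrite memNset//= asboolF// mule0 /abs2 /= expr0n addr0.
Qed.

Lemma spec_integral x (f : R -> R) : (forall t, 0 <= f t) ->
  measurable_fun (setT : set (measurableTypeR R)) f ->
  (\int[spec_measure x]_t (f t)%:E = \sum_(n <oo) (f (l n) * abs2 '[x, e n])%:E)%E.
Proof.
move=> f0 mf; rewrite ge0_integral_measure_series//; last first.
- exact/measurable_EFinP.
- by move=> t _; rewrite lee_fin.
apply: eq_eseriesr => n _; rewrite ge0_integral_mscale//; last first.
- by move=> t _; rewrite lee_fin.
- exact/measurable_EFinP.
rewrite integral_dirac//; last exact/measurable_EFinP.
by rewrite diracT mul1e /= -EFinM mulrC.
Qed.

Lemma spectral_measure_exists : spectral_measure (form_operator q) spec_proj spec_measure.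
Proof.
split.
- move=> J mJ; split.
  + move=> r x y; apply: basis_eq => n; rewrite linearDl linearZl_LR /=.
    have [Jl|Jl] := pselect (J (l n)).
      by rewrite !spec_proj_in// linearDl linearZl_LR.
    by rewrite !spec_proj_out// mulr0 addr0.
  + by move=> x; rewrite -spec_projI setIid.
  + exact: spec_proj_sym.
- split; first by move=> x; apply: basis_eq => n; rewrite spec_proj_in.
  by move=> J J' mJ mJ' x; exact: spec_projI.
- move=> x J mJ; rewrite spec_measureE.
  have -> : complex.Re '[spec_proj J x, x] = n2 (spec_proj J x).
    rewrite /n2 /ip -{2}[J]setIid spec_projI -spec_proj_sym.
    by rewrite -!spec_projI !setIid.
  apply: eseries_EFin; have [_ h] := parseval (spec_proj J x).
  by under eq_fun do under eq_bigr do rewrite -spec_projE.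
- have int2 x : (\int[spec_measure x]_t (t ^+ 2)%:E = \sum_(n <oo) ((l n) ^+ 2 * abs2 '[x, e n])%:E)%E.
    by rewrite (spec_integral x (f := fun t => t ^+ 2))// => t; exact: sqr_ge0.
  apply/seteqP; split=> x /=; rewrite int2.
    move=> [y /form_op_coef hy].
    have bnd N : \sum_(i < N) l i ^+ 2 * abs2 '[x, e i] <= n2 y.
      apply: le_trans (bessel_le y N); apply: ler_sum => i _.
      by rewrite hy abs2M {2}/abs2 /= expr0n addr0.
    have /cvg_ex[L hL] := nneg_sum_cvg (fun n => mulr_ge0 (sqr_ge0 (l n)) (abs2_ge0 '[x, e n])) bnd.
    by rewrite (eseries_EFin hL) ltry.
  set S := (\sum_(n <oo) _)%E => Slt.
  have S0 : (0 <= S)%E by apply: nneseries_ge0 => n _ _; rewrite lee_fin mulr_ge0// ?sqr_ge0 ?abs2_ge0.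
  have Sfin : S \is a fin_num by rewrite ge0_fin_numE.
  apply: (@form_op_dom x (fine S)) => N.
  rewrite -lee_fin fineK// -sumEFin -(big_mkord xpredT (fun i => (l i ^+ 2 * abs2 '[x, e i])%:E)).
  by apply: nneseries_lim_ge => n _ _; rewrite lee_fin mulr_ge0// ?sqr_ge0 ?abs2_ge0.
move=> [x y] Txy /=; have hy := form_op_coef Txy.
(* Positive and negative parts of the sum of l n |<x, e_n>|^2. The negative part converges because
   [l] is bounded below by [l 0], so the difference of the two integrals is meaningful. *)
pose P n := Num.max (l n) 0 * abs2 '[x, e n].
pose Q n := Num.max (- l n) 0 * abs2 '[x, e n].
have PQ n : P n - Q n = l n * abs2 '[x, e n].
  by rewrite -mulrBl; congr (_ * _); case: (leP (l n) 0) => h; case: leP => h'; lra.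
have Q0 n : 0 <= Q n by rewrite mulr_ge0 ?abs2_ge0// le_max lexx orbT.
have /cvg_ex[q0 hq0] : cvg ((\sum_(i < n) Q i) @[n --> \oo]).
  apply: (nneg_sum_cvg (M := `|l 0%N| * n2 x) Q0) => N.
  apply: (@le_trans _ _ (`|l 0%N| * \sum_(i < N) abs2 '[x, e i])); last first.
    by rewrite ler_wpM2l// bessel_le.
  rewrite mulr_sumr; apply: ler_sum => i _; rewrite ler_wpM2r ?abs2_ge0//.
  rewrite ge_max normr_ge0 andbT; apply: (@le_trans _ _ (- l 0%N)).
    by rewrite lerN2; exact: (eb_nondecr eb).
  by rewrite -normrN ler_norm.
have hl : (\sum_(i < n) l i * abs2 '[x, e i]) @[n --> \oo] --> ip y x.
  have := @parseval_ip y x.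
  rewrite (_ : (fun n => \sum_(i < n) complex.Re _) = (fun n => \sum_(i < n) l i * abs2 '[x, e i]))//.
  apply/funext => n; apply: eq_bigr => i _.
  by rewrite hy -mulrA mulc_conj ReM /= mul0r subr0.
have hp0 : (\sum_(i < n) P i) @[n --> \oo] --> ip y x + q0.
  rewrite (_ : (fun n => _) = (fun n => \sum_(i < n) l i * abs2 '[x, e i] + \sum_(i < n) Q i)).
    exact: cvgD.
  by apply/funext => n; rewrite -big_split; apply: eq_bigr => i _ /=; rewrite -PQ subrK.
rewrite integralE.
have mid : measurable_fun (setT : set (measurableTypeR R)) (fun t : R => t) by exact: measurable_id.
have -> : ((complex.Re '[y, x])%:E = (ip y x + q0)%:E - q0%:E)%E by rewrite -EFinB addrK.
congr (_ - _)%E.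
  rewrite -(eseries_EFin hp0) -(spec_integral x (f := fun t => Num.max t 0)).
  - by apply: eq_integral => t _; rewrite funeposE -EFin_max.
  - by move=> t; rewrite le_max lexx orbT.
  - by apply: measurable_maxr.
rewrite -(eseries_EFin hq0) -(spec_integral x (f := fun t => Num.max (- t) 0)).
- by apply: eq_integral => t _; rewrite funenegE -EFinN -EFin_max.
- by move=> t; rewrite le_max lexx orbT.
- by apply: measurable_maxr => //; exact: measurableT_comp.
Qed.

Lemma spec_neg_dim k : (forall j, (j < k)%N -> l j < 0) -> 0 <= l k ->
  has_dim (range (spec_proj [set t | t < 0])) k.
Proof.
move=> hk lk; have inJ j : [set t | t < 0] (l j) <-> (j < k)%N.
  split=> [/= lj|]; last exact: hk.
  by rewrite ltnNge; apply/negP => kj; have := eb_nondecr eb kj; rewrite leNgt (lt_le_trans lj).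
exists (fun i => e i); split; last first.
  by move=> f hf i; rewrite -(inner_comb f i (eo (N := k))) hf linear0l.
apply/seteqP; split=> [_ [x _ <-]|_ [f ->]] /=.
  exists (fun i => '[x, e i]); apply: basis_eq => n; have [nk|kn] := ltnP n k.
    rewrite spec_proj_in; last exact/inJ.
    by rewrite (inner_comb (fun i : 'I_k => '[x, e i]) (Ordinal nk) (eo (N := k))).
  rewrite spec_proj_out; last by move/inJ; rewrite ltnNge kn.
  rewrite inner_suml big1// => i _; rewrite linearZl_LR /= (eb_orth eb).
  by rewrite (ltn_eqF (leq_trans (ltn_ord i) kn)) mulr0.
exists (\sum_(i < k) f i *: e i) => //; apply: basis_eq => n; have [nk|kn] := ltnP n k.
  by rewrite spec_proj_in//; exact/inJ.
rewrite spec_proj_out; last by move/inJ; rewrite ltnNge kn.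
rewrite inner_suml big1// => i _; rewrite linearZl_LR /= (eb_orth eb).
by rewrite (ltn_eqF (leq_trans (ltn_ord i) kn)) mulr0.
Qed.

End Completeness.

(** * Integrals against a measure carried by a set *)

Section Concentrated.
Context {R : realType} (mu : {measure set (measurableTypeR R) -> \bar R}).
Variable J : set (measurableTypeR R).
Hypothesis mJ : measurable J.
Hypothesis muJ : mu (~` J) = 0%E.
Variable f : R -> R.
Hypothesis f0 : forall t, 0 <= f t.
Hypothesis mf : measurable_fun (setT : set (measurableTypeR R)) f.

Let mEf : measurable_fun (setT : set (measurableTypeR R)) (fun t => (f t)%:E).
Proof. exact/measurable_EFinP. Qed.

Lemma concentrated_integral : (\int[mu]_t (f t)%:E = \int[mu]_(t in J) (f t)%:E)%E.
Proof.
rewrite (ge0_negligible_integral (N := ~` J))//; last first.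
- by move=> t _; rewrite lee_fin.
- exact: measurableC.
by rewrite setTD setCK.
Qed.

Lemma concentrated_le (M : R) : (forall t, J t -> f t <= M) ->
  (\int[mu]_t (f t)%:E <= M%:E * mu J)%E.
Proof.
move=> h; rewrite concentrated_integral -(integral_cst mu mJ).
have [[t Jt]|J0] := pselect (exists t, J t).
  have M0 : 0 <= M by apply: le_trans (f0 t) (h _ Jt).
  apply: ge0_le_integral => //; first by move=> s _; rewrite lee_fin.
  exact: measurable_funS mEf.
have -> : J = set0 by apply/seteqP; split=> // t Jt; apply: J0; exists t.
by rewrite !integral_set0.
Qed.

Lemma concentrated_ge (M : R) : 0 <= M -> (forall t, J t -> M <= f t) ->
  (M%:E * mu J <= \int[mu]_t (f t)%:E)%E.
Proof.
move=> M0 h; rewrite concentrated_integral -(integral_cst mu mJ).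
apply: ge0_le_integral => //; exact: measurable_funS mEf.
Qed.

Lemma concentrated_eq0 : (forall t, J t -> 0 < f t) ->
  (\int[mu]_t (f t)%:E = 0)%E -> mu J = 0%E.
Proof.
move=> h; rewrite concentrated_integral => i0.
have mEJ : measurable_fun J (fun t => (f t)%:E) by exact: measurable_funS mEf.
have : (\int[mu]_(t in J) `|(f t)%:E| = 0)%E.
  by rewrite -i0; apply: eq_integral => t _; rewrite gee0_abs// lee_fin.
move/(ae_eq_integral_abs mu mJ mEJ) => [N [mN N0 sub]].
apply: (subset_measure0 mJ mN _ N0) => t Jt; apply: sub => /= /(_ Jt) [] f0'.
by have := h t Jt; rewrite f0' ltxx.
Qed.

End Concentrated.

(** * Every spectral measure yields the same kappa *)

Section KappaUnique.
Context {R : realType} {H : hilbertType R} {q : qform H} {e : nat -> H}.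
Hypothesis hq : Defs.symmetric_form q.
Hypothesis eb : eigenbasis q e.
Variables (E : set R -> H -> H) (m : H -> {measure set (measurableTypeR R) -> \bar R}).
Hypothesis sm : spectral_measure (form_operator q) E m.
Let l n := quad q (e n).
(** One unit below the lowest eigenvalue; the strict gap is what annihilates the spectral mass below
    this level. *)
Let c := l 0%N - 1.

Let mE x (J : set (measurableTypeR R)) : measurable J -> m x J = (complex.Re '[E J x, x])%:E.
Proof. by case: sm => _ _ h _ _; exact: h. Qed.

Let EE (J J' : set (measurableTypeR R)) x : measurable J -> measurable J' ->
  E J (E J' x) = E (J `&` J') x.
Proof. by case: sm => _ [_ h] _ _ _ mJ mJ'; rewrite h. Qed.

Let Esym (J : set (measurableTypeR R)) x y : measurable J -> '[E J x, y] = '[x, E J y].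
Proof. by case: sm => h _ _ _ _ mJ; have [_ _ ->] := h J mJ. Qed.

Let EK (J : set (measurableTypeR R)) x : measurable J -> E J (E J x) = E J x.
Proof. by case: sm => h _ _ _ _ mJ; have [_ -> _] := h J mJ. Qed.

Let Elin (J : set (measurableTypeR R)) : measurable J -> linear (E J).
Proof. by case: sm => h _ _ _ _ mJ; case: (h J mJ). Qed.

Let mn2 x (J : set (measurableTypeR R)) : measurable J -> m x J = (n2 (E J x))%:E.
Proof. by move=> mJ; rewrite mE// -[in LHS]EK// Esym. Qed.

Let mT x : m x setT = (n2 x)%:E.
Proof. by rewrite mn2//; case: sm => _ [-> _] _ _ _. Qed.

Let ET0 (J : set (measurableTypeR R)) x : measurable J -> E J x = 0 <-> m x J = 0%E.
Proof.
move=> mJ; rewrite mn2//; split=> [->|[] /n2_eq0 //]; by rewrite n20.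
Qed.

Let Eout (J : set (measurableTypeR R)) x : measurable J -> E J x = x -> m x (~` J) = 0%E.
Proof.
move=> mJ hx; apply/ET0; first exact: measurableC.
rewrite -hx EE//; last exact: measurableC.
by rewrite setICl; apply/ET0 => //; rewrite measure0.
Qed.

Let Ein (J : set (measurableTypeR R)) x : measurable J -> m x (~` J) = 0%E -> E J x = x.
Proof.
move=> mJ hx; apply/esym/subr0_eq/n2_eq0.
have h : n2 (E J x) = n2 x.
  have : m x (~` J `|` J) = (m x (~` J) + m x J)%E.
    exact: (measureU (m x) (measurableC mJ) mJ (setICl J)).
  by rewrite hx setvU mT add0e mn2// => -[].
rewrite n2B h; have -> : ip x (E J x) = n2 (E J x).
  by rewrite /n2 /ip [in RHS]Esym// EK.
by rewrite h; ring.
Qed.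

Let int_formula x y : form_operator q (x, y) ->
  ((ip y x)%:E = \int[m x]_t (Num.max t 0)%:E - \int[m x]_t (Num.max (- t) 0)%:E)%E.
Proof.
move=> Txy; case: sm => _ _ _ _ /(_ _ Txy) /= h; rewrite {}[LHS]h integralE.
congr (_ - _)%E; apply: eq_integral => t _; first by rewrite funeposE -EFin_max.
by rewrite funenegE -EFinN -EFin_max.
Qed.

Let mid : measurable_fun (setT : set (measurableTypeR R)) (fun t : R => t).
Proof. exact: measurable_id. Qed.

Let mpos : measurable_fun (setT : set (measurableTypeR R)) (fun t : R => Num.max t 0).
Proof. exact: measurable_maxr. Qed.

Let mneg : measurable_fun (setT : set (measurableTypeR R)) (fun t : R => Num.max (- t) 0).
Proof. by apply: measurable_maxr => //; exact: measurableT_comp. Qed.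

Let pos0 (t : R) : 0 <= Num.max t 0. Proof. by rewrite le_max lexx orbT. Qed.
Let neg0 (t : R) : 0 <= Num.max (- t) 0. Proof. by rewrite le_max lexx orbT. Qed.

Let in_dom (J : set (measurableTypeR R)) x (M : R) : measurable J -> E J x = x ->
  (forall t, J t -> t ^+ 2 <= M) -> op_dom (form_operator q) x.
Proof.
move=> mJ hx hM; case: (sm) => _ _ _ -> _ /=.
have out := Eout mJ hx.
apply: (@le_lt_trans _ _ (M%:E * m x J)%E).
  apply: (concentrated_le mJ out (f := fun t => t ^+ 2)) => //.
    by move=> t; exact: sqr_ge0.
by rewrite mn2// -EFinM ltry.
Qed.

Let lower x y : form_operator q (x, y) -> (c + 1) * n2 x <= ip y x.
Proof.
move=> [/= xV h]; rewrite /c subrK; have := eb_min eb xV (N := 0%N) (fun i => ltac:(by [])).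
by rewrite /quad h.
Qed.

(** A vector w in the range of the projection for [-n, c) lies in the operator domain; there <T w,
    w> is at most c |w|^2 by the integral formula but at least (c + 1) |w|^2, so w = 0. These sets
    exhaust the half-line. *)
Let low_null x : m x [set t | t < c] = 0%E.
Proof.
have mI (n : nat) : measurable ([set t : R | - n%:R <= t /\ t < c] : set (measurableTypeR R)).
  rewrite (_ : [set t : R | _] = `[- n%:R, c[%classic); first exact: measurable_itv.
  by apply/seteqP; split=> t /=; rewrite in_itv /=; [move=> [-> ->]|move=> /andP[]].
pose J (n : nat) : set (measurableTypeR R) := [set t : R | - n%:R <= t /\ t < c].
have EJ n v : E (J n) v = 0.
  set w := E (J n) v; have hw : E (J n) w = w by apply: EK; exact: mI.
  have out := Eout (mI n) hw.
  have [y Twy] : op_dom (form_operator q) w.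
    apply: (in_dom (M := n%:R ^+ 2 + c ^+ 2) (mI n) hw) => t [h1 h2].
    have [t0|t0] := lerP 0 t.
      have : t ^+ 2 <= c ^+ 2 by rewrite ler_sqr ?nnegrE ?(ltW h2)// (le_trans t0)// ltW.
      by have := sqr_ge0 (n%:R : R); lra.
    have nt0 : 0 <= - t by rewrite oppr_ge0 ltW.
    have ntn : - t <= n%:R by rewrite lerNl.
    have := ler_pM nt0 nt0 ntn ntn; rewrite mulrNN -!expr2 => h3.
    by apply: (le_trans h3); rewrite lerDl sqr_ge0.
  apply: n2_eq0; apply/eqP; rewrite eq_le n2_ge0 andbT.
  have h1 := lower Twy.
  suff h2 : ip y w <= c * n2 w by move: h1 h2; rewrite mulrDl mul1r; lra.
  rewrite -lee_fin (int_formula Twy).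
  have mw : m w (J n) = (n2 w)%:E by rewrite (mn2 w (mI n)) hw.
  have [c0|c0] := lerP c 0.
    have p0 : (\int[m w]_t (Num.max t 0)%:E <= 0)%E.
      have := concentrated_le (mI n) out pos0 mpos (M := 0); rewrite mul0e; apply.
      by move=> t [_ tc]; rewrite ge_max lexx andbT (le_trans (ltW tc)).
    have n1 : ((- c)%:E * m w (J n) <= \int[m w]_t (Num.max (- t) 0)%:E)%E.
      apply: (concentrated_ge (mI n) out neg0 mneg); first by rewrite oppr_ge0.
      by move=> t [_ tc]; rewrite le_max lerN2 ltW.
    rewrite mw -EFinM in n1.
    apply: (@le_trans _ _ (0%:E - (- c * n2 w)%:E)%E); first exact: leeB.
    by rewrite -EFinB lee_fin sub0r mulNr opprK.
  have p0 : (\int[m w]_t (Num.max t 0)%:E <= c%:E * m w (J n))%E.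
    apply: (concentrated_le (mI n) out pos0 mpos).
    by move=> t [_ tc]; rewrite ge_max !ltW.
  have n1 : (0 <= \int[m w]_t (Num.max (- t) 0)%:E)%E.
    by apply: integral_ge0 => t _; rewrite lee_fin.
  rewrite mw -EFinM in p0.
  apply: (@le_trans _ _ ((c * n2 w)%:E - 0%:E)%E); first exact: leeB.
  by rewrite sube0.
have -> : [set t | t < c] = \bigcup_n J n.
  apply/seteqP; split=> t /=; last by move=> [n _ []].
  move=> tc; exists (Num.truncn `|t|).+1 => //; split=> //.
  by rewrite lerNl (le_trans (ler_norm _))// normrN ltW// truncnS_gt.
apply/negligibleP; first by apply: bigcupT_measurable => n; exact: mI.
apply: negligible_bigcup => n; apply/negligibleP; first exact: mI.
by apply/ET0; [exact: mI|exact: EJ].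
Qed.

Let J0 : set (measurableTypeR R) := [set t | t < 0].

Let mlt (a : R) : measurable ([set t : R | t < a] : set (measurableTypeR R)).
Proof.
rewrite (_ : [set t : R | t < a] = `]-oo, a[%classic); first exact: measurable_itv.
by apply/seteqP; split=> t /=; rewrite in_itv.
Qed.

(** Without mass below [c] the measure of x sits on the bounded set [c, 0), which puts x into the
    operator domain. Strictness holds because a strictly positive integrand has zero integral only
    for zero mass. *)
Let range_neg x : E J0 x = x -> x != 0 -> fdom q x /\ quad q x < 0.
Proof.
move=> hx x0; have out := Eout (mlt 0) hx.
pose J1 : set (measurableTypeR R) := [set t | t < 0] `\` [set t | t < c].
have mJ1 : measurable J1 by apply: measurableD; exact: mlt.
have hx1 : E J1 x = x.
  apply: Ein => //; apply: (subset_measure0 (B := ~` J0 `|` [set t | t < c])).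
  - exact: measurableC.
  - by apply: measurableU; [apply: measurableC; exact: mlt|exact: mlt].
  - move=> t /= h; have [tc|tc] := pselect (t < c); [by right|left].
    by move=> t0; apply: h.
  - apply/negligibleP; first by apply: measurableU; [apply: measurableC; exact: mlt|exact: mlt].
    by apply: negligibleU; apply/negligibleP;
      first [exact: out|exact: low_null|exact: mlt|apply: measurableC; exact: mlt].
have [y Txy] : op_dom (form_operator q) x.
  apply: (in_dom (M := c ^+ 2) mJ1 hx1) => t [/= t0 /negP]; rewrite -leNgt => ct.
  rewrite -[leLHS]sqrrN -[leRHS]sqrrN ler_sqr ?nnegrE ?lerN2// oppr_ge0 ltW//.
  exact: le_lt_trans ct t0.
case: (Txy) => /= xV h; split=> //; rewrite /quad h// -/(ip y x).
have p0 : (\int[m x]_t (Num.max t 0)%:E = 0)%E.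
  apply/eqP; rewrite eq_le; apply/andP; split; last first.
    by apply: integral_ge0 => t _; rewrite lee_fin.
  have := concentrated_le (mlt 0) out pos0 mpos (M := 0); rewrite mul0e; apply.
  by move=> t tc; rewrite ge_max lexx andbT ltW.
have n0 : (0 <= \int[m x]_t (Num.max (- t) 0)%:E)%E.
  by apply: integral_ge0 => t _; rewrite lee_fin.
have := int_formula Txy; rewrite p0 sub0e => hy.
rewrite lt_neqAle; apply/andP; split; last first.
  by rewrite -lee_fin hy oppe_le0.
apply/eqP => ipy; rewrite ipy in hy.
have i0 : (\int[m x]_t (Num.max (- t) 0)%:E = 0)%E by rewrite -[LHS]oppeK -hy oppe0.
have := concentrated_eq0 (mlt 0) out neg0 mneg _ i0.
rewrite (mn2 x (mlt 0)) hx => h0.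
have [/n2_eq0 xx] : (n2 x)%:E = 0%E :> \bar R.
  by apply: h0 => t /= t0; rewrite lt_max oppr_gt0 t0.
by rewrite xx eqxx in x0.
Qed.

(** The range consists of negative directions, so the index is at least k. Were it larger, the
    projection would kill a nonzero combination of the first k + 1 eigenvectors; its measure would
    live on [0, oo), against its negative form value. *)
Lemma kappa_neg_dim k : has_dim (range (E J0)) k ->
  neg_dim q k /\ ~ neg_dim q k.+1.
Proof.
move=> [v [Wv fv]].
have mJ0 := mlt 0.
have vW i : range (E J0) (v i).
  rewrite Wv; exists (fun j => (j == i)%:R).
  rewrite (bigD1 i)//= eqxx scale1r big1 ?addr0// => j ji.
  by rewrite (negbTE ji) scale0r.
have inW x : range (E J0) x -> E J0 x = x by move=> [z _ <-]; apply: EK; exact: mJ0.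
have E0 : E J0 0 = 0.
  by have := Elin mJ0 (-1) 0 0; rewrite scaler0 addr0 scaleN1r addNr.
have v0 i : v i != 0.
  apply/eqP => vi; have := fv (fun j => (j == i)%:R) _ i; rewrite eqxx.
  move/(_ _)/eqP; rewrite oner_eq0 => h; have : false; last by [].
  apply: h; rewrite (bigD1 i)//= eqxx scale1r vi big1 ?addr0// => j ji.
  by rewrite (negbTE ji) scale0r.
split.
  exists v; split=> [i|f f0]; first by have [] := range_neg (inW _ (vW i)) (v0 i).
  have xW : range (E J0) (\sum_i f i *: v i) by rewrite Wv; exists f.
  have [] // := range_neg (inW _ xW); apply/eqP => x0.
  by have [i fi] := f0; move: fi; rewrite (fv f x0) eqxx.
move/(neg_dimP hq eb) => lk.
have Esum (f : 'I_k.+1 -> R[i]) : E J0 (\sum_i f i *: e i) = \sum_i f i *: E J0 (e i).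
  elim: (index_enum 'I_k.+1) => [|i r ih]; first by rewrite !big_nil E0.
  by rewrite !big_cons Elin// ih.
have /choice[M hM] : forall i : 'I_k.+1, exists f : 'I_k -> R[i], E J0 (e i) = \sum_j f j *: v j.
  move=> i; have : range (E J0) (E J0 (e i)) by exists (e i).
  by rewrite Wv.
have [f [f0 hf]] := nontrivial_kernel M (ltnSn k).
set x := \sum_i f i *: e i.
have Ex : E J0 x = 0.
  rewrite Esum; under eq_bigr do rewrite hM scaler_sumr.
  rewrite exchange_big big1// => j _ /=.
  by under eq_bigr do rewrite scalerA; rewrite -scaler_suml hf scale0r.
have xV : fdom q x by exact: (eb_comb_dom hq eb).
have Txy : form_operator q (x, \sum_i (f i * (l i)%:C) *: e i).
  split=> // u uV /=; rewrite (eb_comb hq eb)// inner_suml; apply: eq_bigr => i _.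
  by rewrite linearZl_LR /= mulrA.
have xneg : quad q x < 0.
  apply: (@le_lt_trans _ _ (l k * n2 x)).
    by apply: (quad_comb_le hq eb) => i; rewrite ltnS => /(eb_nondecr eb).
  by rewrite nmulr_rlt0//; exact: (n2_comb_gt0 eb).
have out : m x (~` ~` J0) = 0%E by rewrite setCK; apply/ET0.
have n0 : (\int[m x]_t (Num.max (- t) 0)%:E <= 0)%E.
  have := concentrated_le (measurableC mJ0) out neg0 mneg (M := 0); rewrite mul0e; apply.
  move=> t /negP; rewrite -leNgt => t0; rewrite ge_max lexx andbT oppr_le0//.
have p0 : (0 <= \int[m x]_t (Num.max t 0)%:E)%E.
  by apply: integral_ge0 => t _; rewrite lee_fin.
have := int_formula Txy => hy.
have : (0 <= (quad q x)%:E)%E.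
  case: (Txy) => _ /(_ x xV) qxx; rewrite /quad qxx -/(ip _ x) hy.
  by rewrite -[leLHS](sube0 0%E); exact: leeB.
by rewrite lee_fin leNgt xneg.
Qed.

End KappaUnique.

(** * Asymptotics *)

(** The limit e -> 0, with an explicit e; it serves where an inequality is known only strictly to
    the right of an eigenvalue. *)
Lemma quadratic_ge0 (R : realType) (A B : R) :
  (forall e, 0 < e -> 0 < A + B * e + e ^+ 2) -> 0 <= A.
Proof.
move=> h; rewrite leNgt; apply/negP => A0.
have K0 : 0 < 2 * (`|B| + 1) by rewrite mulr_gt0// ltr_wpDl.
pose e := Num.min 1 (- A / (2 * (`|B| + 1))).
have e0 : 0 < e by rewrite lt_min ltr01 divr_gt0// oppr_gt0.
have e1 : e <= 1 by rewrite ge_min lexx.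
have e2 : e * (2 * (`|B| + 1)) <= - A by rewrite -ler_pdivlMr// ge_min lexx orbT.
have := h e e0.
have h1 : B * e <= `|B| * e by rewrite ler_pM2r// ler_norm.
have h2 : e ^+ 2 <= e by rewrite expr2 ler_piMr// ltW.
move: e2 h1 h2 A0; lra.
Qed.

(* Solves 0 <= x (lambda - nu) + b x + c with x = lambda - d - b for lambda. *)
Lemma lower_asymptotics (R : realType) (b c d nu lam : R) : 0 <= b ->
  1 <= lam - d - b -> lam <= nu ->
  0 <= (lam - d - b) * (lam - nu) + b * (lam - d - b) + c ->
  2 * `|d| + 4 * b + 2 * `|c| + 2 <= nu ->
  nu - b - c / (nu - d) - 4 * `|c| * (2 * b + `|c|) / nu ^+ 2 <= lam.
Proof.
move=> b0; set x := lam - d - b => x1 lnu h nuge.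
have x0 : 0 < x by rewrite (lt_le_trans ltr01).
have c0 := normr_ge0 c; have d0 := normr_ge0 d.
have nu0 : 0 < nu by lra.
have nd : nu / 2 <= nu - d by have := ler_norm d; lra.
have nd0 : 0 < nu - d by lra.
have h1 : nu - b - c / x <= lam.
  rewrite -subr_ge0; have -> : lam - (nu - b - c / x) = (x * (lam - nu) + b * x + c) / x.
    by field; rewrite gt_eqF.
  by rewrite divr_ge0// ltW.
have cx : c / x <= `|c|.
  by rewrite ler_pdivrMr// (le_trans (ler_norm c))// ler_peMr.
(* Bootstrapping: the crude bound lam >= nu - b - |c| keeps x within 2 b + |c| of nu - d, so
   replacing c / x by c / (nu - d) costs only order nu^{-2}. *)
have xl : nu - d - 2 * b - `|c| <= x by rewrite /x; lra.
have xu : x <= nu - d by rewrite /x; lra.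
have x2 : nu / 2 <= x by have := ler_norm d; lra.
have h2 : c / x - c / (nu - d) <= 4 * `|c| * (2 * b + `|c|) / nu ^+ 2.
  have -> : c / x - c / (nu - d) = c * ((nu - d - x) / (x * (nu - d))).
    by field; rewrite !gt_eqF.
  apply: (@le_trans _ _ (`|c| * ((2 * b + `|c|) / (nu / 2 * (nu / 2))))).
    have y0 : 0 <= (nu - d - x) / (x * (nu - d)).
      by rewrite divr_ge0 ?subr_ge0// ltW// mulr_gt0.
    apply: (@le_trans _ _ (`|c| * ((nu - d - x) / (x * (nu - d))))).
      by rewrite ler_wpM2r// ler_norm.
    rewrite ler_wpM2l//; apply: ler_pM.
    - by rewrite subr_ge0.
    - by rewrite invr_ge0 ltW// mulr_gt0.
    - by move: xl; lra.
    rewrite lef_pV2 ?posrE; [|exact: mulr_gt0|by rewrite mulr_gt0// divr_gt0].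
    by apply: ler_pM => //; rewrite ltW// divr_gt0.
  rewrite le_eqVlt; apply/orP; left; apply/eqP; field; by rewrite gt_eqF.
move: h1 h2; lra.
Qed.

(* With N = nu - d and tau = t - d, the displayed quantity is
   tau^2 - N tau + N b + c - b^2, whose larger root is N - b - c / N + O(N^-2). *)
Lemma upper_asymptotics (R : realType) (b c d nu : R) : 0 <= b ->
  4 * `|d| + 4 * b + 2 * `|c| + 4 <= nu ->
  let t := nu - b - c / (nu - d) + (16 * b * `|c| + 8) / nu ^+ 2 in
  [/\ nu - b - `|c| <= t, 0 < t - d - b &
      0 < (t - d) ^+ 2 - (nu - d) * (t - d) + (nu - d) * b + (c - b ^+ 2)].
Proof.
move=> b0 nuge; set r := (16 * b * `|c| + 8) / nu ^+ 2 => t.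
have c0 := normr_ge0 c; have d0 := normr_ge0 d; have dn := ler_norm d.
have dn' := ler_norm (- d); rewrite normrN in dn'.
set N := nu - d.
have nu0 : 0 < nu by lra.
have N1 : 1 <= N by rewrite /N; lra.
have N0 : 0 < N by lra.
have K0 : 0 < 16 * b * `|c| + 8 by rewrite ltr_wpDl// mulr_ge0// mulr_ge0.
have r0 : 0 < r by rewrite divr_gt0// exprn_gt0.
have cN : c / N <= `|c|.
  by rewrite ler_pdivrMr// (le_trans (ler_norm c))// ler_peMr.
have tE : t = N - b - c / N + r + d by rewrite /t -/N /N; ring.
split.
- by rewrite /t -/N; lra.
- by rewrite tE /N; lra.
have -> : (t - d) ^+ 2 - N * (t - d) + N * b + (c - b ^+ 2) =
    r * (N - 2 * b) + 2 * b * (c / N) + (c / N - r) ^+ 2.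
  by rewrite tE; field; rewrite gt_eqF.
have s0 := sqr_ge0 (c / N - r).
have h1 : - (2 * b * (`|c| / N)) <= 2 * b * (c / N).
  rewrite lerNl -mulrN ler_wpM2l ?mulr_ge0// -mulNr ler_wpM2r ?invr_ge0 ?(ltW N0)//.
  by rewrite -normrN ler_norm.
(* Origin of 16 and 8: nu <= 2 N and N / 2 <= N - 2 b give r (N - 2 b) >= (16 b |c| + 8) / (8 N),
   just more than the cross term 2 b |c| / N. *)
have h2 : (2 * b * `|c| + 1) / N <= r * (N - 2 * b).
  have Nb : N / 2 <= N - 2 * b by rewrite /N; lra.
  apply: (@le_trans _ _ (r * (N / 2))); last by rewrite ler_pM2l.
  have nN : nu ^+ 2 <= (2 * N) ^+ 2.
    by rewrite ler_sqr ?nnegrE /N; lra.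
  apply: (@le_trans _ _ ((16 * b * `|c| + 8) / (2 * N) ^+ 2 * (N / 2))).
    by rewrite le_eqVlt; apply/orP; left; apply/eqP; field; rewrite gt_eqF.
  rewrite ler_pM2r ?divr_gt0// /r ler_pM2l// lef_pV2 ?posrE ?exprn_gt0// mulr_gt0//.
have h3 : 2 * b * (`|c| / N) < (2 * b * `|c| + 1) / N.
  by rewrite mulrA ltr_pM2r ?invr_gt0// ltrDl.
move: s0 h1 h2 h3; lra.
Qed.

Lemma card_mem_gt0 (T : Type) (S : set T) (x : T) (k : nat) :
  S x -> (S #= `I_k)%card -> (0 < k)%N.
Proof.
move=> Sx; case: k => // h; have : set0 x; last by [].
by move: h; rewrite II0 card_eq0 => /eqP <-.
Qed.

Lemma has_dim_neq0 (K : fieldType) (V : lmodType K) (W : set V) k :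
  has_dim W k -> (0 < k)%N <-> exists2 x, x != 0 & W x.
Proof.
move=> [e [We fe]]; split=> [k0|[x x0]].
  move: (Ordinal k0) => i; exists (e i).
    apply/eqP => ei; have : (1 : K) == 0; last by rewrite oner_eq0.
    have h : \sum_j (j == i)%:R *: e j = 0.
      rewrite (bigD1 i)//= ei scaler0 add0r big1// => j ji.
      by rewrite (negbTE ji) scale0r.
    by have /eqP := fe _ h i; rewrite eqxx.
  rewrite We; exists (fun j => (j == i)%:R).
  rewrite (bigD1 i)//= eqxx scale1r big1 ?addr0// => j ji.
  by rewrite (negbTE ji) scale0r.
rewrite We => -[c xE]; case: k e {We fe} c xE => // e c xE.
by rewrite xE big_ord0 eqxx in x0.
Qed.

Lemma inv_sqr_bigO (R : realType) (u : R^nat) (K : R) :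
  (fun n => K / u n ^+ 2) =O_\oo (fun n => (u n ^+ 2)^-1).
Proof.
apply/eqOP; near=> k; near=> n.
rewrite normrM ler_wpM2r//; near: k; exact: nbhs_pinfty_ge.
Unshelve. all: by end_near. Qed.

(** * The eigenvalues of [A] counted by the negative index *)

Section SpectralConsequences.
Context {R : realType} {H : hilbertType R} {A : set (H * H)} {fa : qform H} {c : R}.
Let g := fadd fa c (inner_form H).
Hypothesis formA : closed_form_of A fa.
Hypothesis hg : Defs.symmetric_form g.
Hypothesis g_ge : forall x, fdom g x -> n2 x <= quad g x.
Hypothesis g_eb : forall q, admissible g q -> exists e, eigenbasis q e.

Let hfa : Defs.symmetric_form fa := fa_sym formA.

Lemma fa_adm : admissible g fa.
Proof.
split=> //; exists 1, `|c|, (1 + `|c|); split=> // x xV.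
have qx : quad fa x = quad g x - c * n2 x by rewrite [quad g x]quad_fadd addrK.
have h1 : c * n2 x <= `|c| * n2 x by rewrite ler_wpM2r ?n2_ge0// ler_norm.
have h2 : - c * n2 x <= `|c| * n2 x by rewrite ler_wpM2r ?n2_ge0// -normrN ler_norm.
have h3 : `|c| * n2 x <= `|c| * quad g x by rewrite ler_wpM2l// g_ge.
rewrite qx; apply/andP; move: h1 h2 h3; split; lra.
Qed.

Lemma eigenspace_translate t :
  op_eigenspace A t%:C = form_kernel (fadd fa (- t) (inner_form H)).
Proof.
apply/seteqP; split=> x.
  move=> /(dom_A_fa formA)[xV h]; split=> // u uV /=.
  by rewrite h// innerZl rmorphN mulNr subrr.
move=> [/= xV h]; apply: (A_intro formA) => // u uV.
by have /eqP := h u uV; rewrite rmorphN mulNr subr_eq0 -innerZl => /eqP.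
Qed.

(** The family argument for the forms of A - t, started below the lowest eigenvalue where the index
    is 0, produces an eigenvalue sequence; by uniqueness it is [nu]. Below the starting point both
    sides are false. *)
Lemma eigenvalue_counting nu : eigenvalue_sequence A setT nu ->
  forall n t, nu n < t <-> neg_dim (fadd fa (- t) (inner_form H)) n.+1.
Proof.
move=> nuP; have [e eb] := g_eb fa_adm.
pose l0 := quad fa (e 0%N); pose gam := l0 - 1; pose mu := l0 - 2.
have mg : mu < gam by rewrite /mu /gam; lra.
have low x : fdom fa x -> l0 * n2 x <= quad fa x.
  by move=> xV; apply: (eb_min eb xV (N := 0%N)) => i; rewrite ltn0.
pose q t := fadd fa (- t) (inner_form H).
have hq t : Defs.symmetric_form (q t) by apply: fadd_sym => //; exact: inner_form_sym.
have [||||||lam [lam1 lam2 lam3 lam4 lam5]] :=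
    @fam_sequence R H g g_eb q mu _ _ _ _ gam 0%N mg _ _.
- by move=> t _; exact: (translate_adm hfa g_ge).
- by move=> t t' x _ tt' _ x0; exact: translate_mono.
- move=> t _; exists 1, 1; split=> // t' _ _ x xV; exact: (translate_cont g_ge).
- by move=> k t0; exact: (translate_unb hfa k t0 eb).
- by exists (fun=> 0); split=> [[]//|f [[]]].
- move=> [v [vV hv]].
  have f0 : exists i : 'I_1, (fun=> 1 : R[i]) i != 0 by exists ord0; rewrite oner_eq0.
  have := hv _ f0; set x := \sum_i _.
  have xV : fdom fa x by apply: (fdom_sum hfa) => i _; apply: (fdomZ hfa); exact: vV.
  rewrite quad_translate ltNge => /negP; apply; have := low x xV; have := n2_ge0 x.
  rewrite /gam mulrBl mul1r; lra.
have lamP : eigenvalue_sequence A `[gam, +oo[%classic lam.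
  split=> //; first by move=> n; rewrite /= in_itv /= andbT.
  by move=> t; rewrite /= in_itv /= andbT => /lam4[k d cd]; exists k => //; rewrite eigenspace_translate.
(* An eigenvalue of A is a Rayleigh quotient, hence at least [l0], so restricting to [gam, oo) loses
   nothing. *)
have nuP' : eigenvalue_sequence A `[gam, +oo[%classic nu.
  case: nuP => nd _ h; split=> //; last by move=> t _; exact: h.
  move=> n; rewrite /= in_itv /= andbT; have [k d cd] := h (nu n) I.
  have k0 := card_mem_gt0 (erefl (nu n) : [set m | nu m = nu n] n) cd.
  have [x x0] := (has_dim_neq0 d).1 k0.
  rewrite eigenspace_translate => -[xV hx].
  have : quad (q (nu n)) x = 0 by rewrite /quad hx.
  rewrite quad_translate => /eqP; rewrite subr_eq0 => /eqP qx.
  have := low x xV; rewrite qx ler_pM2r ?n2_gt0// /gam; lra.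
move=> n t; rewrite (eigenvalue_sequence_unique nuP' lamP).
have [gt|tg] := lerP gam t; first exact: (lam3 n t gt).
split=> [lt|[v [vV hv]]]; first by have := lam2 n; rewrite leNgt (lt_trans lt tg).
have : neg_dim (q gam) n.+1.
  exists v; split=> // f f0; apply: le_lt_trans (hv f f0).
  by rewrite !quad_translate lerD2l lerN2 ler_wpM2r ?n2_ge0// ltW.
by move/(lam3 n gam (lexx _)).2; rewrite ltNge lam2.
Qed.

Lemma eigenvalues_to_infty nu : eigenvalue_sequence A setT nu ->
  forall T : R, exists N, forall n, (N <= n)%N -> T <= nu n.
Proof.
move=> nuP T; have h := eigenvalue_counting nuP; have [nd _ _] := nuP.
have [e eb] := g_eb (translate_adm hfa g_ge T).
have hq : Defs.symmetric_form (fadd fa (- T) (inner_form H)).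
  by apply: fadd_sym => //; exact: inner_form_sym.
have [N [lN _]] := eb_first_nonneg eb 0; exists N => n Nn.
apply: (@le_trans _ _ (nu N)); last exact: nd.
rewrite leNgt; apply/negP => /h /(neg_dimP hq eb); by rewrite ltNge lN.
Qed.

End SpectralConsequences.

(* The sequences are indexed from 0: nu n and lam n are the (n+1)-st terms. *)
Theorem corollary6p2 (R : realType) (H1 H2 : hilbertType R)
    (A : set (H1 * H1)) (B : set (H2 * H1)) (D : set (H2 * H2))
    (fa : qform H1) (fd : qform H2)
    (selfadjoint_A : selfadjoint A) (below_A : bounded_from_below A)
    (linear_B : linear_operator B) (dense_B : dense (op_dom B))
    (closable_B : closable B)
    (selfadjoint_D : selfadjoint D) (above_D : bounded_from_above D)
    (form_A : closed_form_of A fa) (form_D : closed_form_of D fd)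
    (dom_fa : fdom fa `<=` op_dom (adjoint B))
    (dom_B : (op_dom B `<=` op_dom D /\ op_core D (op_dom B)) \/ fdom fd `<=` op_dom B)
    (a b delta_plus : R) (b_ge0 : 0 <= b)
    (ab : forall x, fdom fa x ->
       rnorm (op_app (adjoint B) x) ^+ 2 <= a * rnorm x ^+ 2 + b * quad fa x)
    (delta_plusP : is_max (real_spectrum D) delta_plus)
    (compact_A : compact_resolvent A) (infinite_H1 : infinite_dimensional H1)
    (nu : R^nat) (nuP : eigenvalue_sequence A setT nu) :
  let M := closure (block_operator A B (adjoint B) D) in
  let mu := delta_plus + b +
    Num.sqrt (Num.max (b * delta_plus + b ^+ 2 + a) 0) in
  (exists lam : R^nat,
     [/\ `]mu, +oo[%classic `&` real_spectrum M = range lam,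
         forall n, op_eigenvalue M (lam n)%:C &
         lam n @[n --> \oo] --> +oo]) /\
  forall gamma0 : R, mu < gamma0 ->
  (exists kappa, kappa_minus (schur_complement fa B D gamma0) kappa) /\
  forall kappa, kappa_minus (schur_complement fa B D gamma0) kappa ->
  (exists lam, eigenvalue_sequence M `[gamma0, +oo[%classic lam) /\
  forall lam, eigenvalue_sequence M `[gamma0, +oo[%classic lam ->
  (exists r : R^nat,
     r =O_\oo (fun n => (nu (kappa + n)%N ^+ 2)^-1) /\
     \forall n \near \oo,
       nu (kappa + n)%N - b
         - (b ^+ 2 + b * delta_plus + a) / (nu (kappa + n)%N - delta_plus)
         + r n <= lam n <= nu (kappa + n)%N) /\
  (forall delta_minus ahat bhat : R, bounded_operator D ->
     is_min (real_spectrum D) delta_minus -> 0 <= bhat ->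
     (forall x, fdom fa x ->
        ahat * rnorm x ^+ 2 + bhat * quad fa x
          <= rnorm (op_app (adjoint B) x) ^+ 2) ->
   exists r : R^nat,
     r =O_\oo (fun n => (nu (kappa + n)%N ^+ 2)^-1) /\
     \forall n \near \oo,
       lam n <= nu (kappa + n)%N - bhat
         - (bhat ^+ 2 + bhat * delta_minus + ahat)
             / (nu (kappa + n)%N - delta_minus)
         + r n).
Proof.
move=> M mu.
have hfa := fa_sym form_A.
have [c [hg g_ge g_closed]] := base_form_exists selfadjoint_A below_A form_A.
have g_cpt := compact_resolvent_form selfadjoint_A form_A hg g_ge g_closed compact_A.
have g_inf := base_infinite selfadjoint_A form_A hg infinite_H1.
have g_eb := eigenbasis_exists hg g_ge g_closed g_cpt g_inf.
(* The eigenbasis of [fa] serves to show that the index of s(t) becomes arbitrarily large. *)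
have [ea eba] := g_eb _ (fa_adm form_A g_ge).
set g := fadd fa c (inner_form H1) in hg g_ge g_closed g_cpt g_inf g_eb.
have ME : M = @weak_block R H1 H2 B D fa.
  exact: (closure_block form_A form_D hg g_ge g_closed dense_B dom_fa selfadjoint_D dom_B b_ge0 ab).
pose s := schur_form fa B D.
have s_adm t : mu < t -> admissible g (s t).
  exact: (schur_adm hfa g_ge dense_B dom_fa selfadjoint_D above_D b_ge0 ab delta_plusP).
have s_mono t t' x : mu < t -> t < t' -> fdom g x -> x != 0 ->
    quad (s t) x <= 0 -> quad (s t') x < 0.
  exact: (schur_mono selfadjoint_D above_D b_ge0 ab delta_plusP).
have s_cont t : mu < t -> exists C d : R, [/\ 0 <= C, 0 < d &
    forall t', mu < t' -> `|t' - t| < d -> forall x, fdom g x ->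
      `|quad (s t') x - quad (s t) x| <= C * `|t' - t| * quad g x].
  exact: (schur_cont g_ge selfadjoint_D above_D b_ge0 ab delta_plusP).
have s_unb k t0 : exists2 t, t0 < t & neg_dim (s t) k.
  exact: (schur_unb hfa selfadjoint_D above_D a b_ge0 delta_plusP k t0 eba).
have s_seq gam kap := @fam_sequence R H1 g g_eb s mu s_adm s_mono s_cont s_unb gam kap.
have e_dim t k : mu < t -> has_dim (form_kernel (s t)) k -> has_dim (op_eigenspace M t%:C) k.
  rewrite ME; exact: (eigenspace_dim form_A).
have spec t : mu < t -> real_spectrum M t <-> exists2 x, x != 0 & form_kernel (s t) x.
  move=> mt; rewrite ME.
  apply: (spectrum_kernel form_A hg g_ge g_closed dense_B dom_fa selfadjoint_D above_D b_ge0 ab delta_plusP mt).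
  exact: g_eb (s_adm _ mt).
(* Occurrences in the sequence and the dimension of the eigenspace agree in number, so a value is
   listed iff its eigenspace is nonzero. *)
have in_seq gam lam t : eigenvalue_sequence M `[gam, +oo[%classic lam -> mu < gam ->
    gam <= t -> (exists n, lam n = t) <-> exists2 x, x != 0 & op_eigenspace M t%:C x.
  move=> [_ _ h] mg gt; have [|k d cd] := h t; first by rewrite /= in_itv /= andbT.
  split=> [[n nt]|].
    by apply/(has_dim_neq0 d); exact: (card_mem_gt0 (nt : [set m | lam m = t] n) cd).
  move/(has_dim_neq0 d) => k0; apply: contrapT => /forallNP hn.
  have : ([set n | lam n = t] #= `I_0)%card.
    by rewrite II0 card_eq0; apply/eqP/seteqP; split=> n //= /hn.
  move=> c0; have : (`I_k #= `I_0)%card by apply: card_eq_trans c0; rewrite card_eq_sym.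
  by move/card_eq_II => k00; rewrite k00 in k0.
have s_sequence gam kap : mu < gam -> neg_dim (s gam) kap -> ~ neg_dim (s gam) kap.+1 ->
    exists lam : R^nat, [/\ eigenvalue_sequence M `[gam, +oo[%classic lam,
      forall n t, gam <= t -> lam n < t <-> neg_dim (s t) (kap + n).+1 &
      forall T : R, exists N, forall n, (N <= n)%N -> T <= lam n].
  move=> mg k1 k2; have [lam [l1 l2 l3 l4 l5]] := s_seq gam kap mg k1 k2.
  exists lam; split=> //; split=> //; first by move=> n; rewrite /= in_itv /= andbT.
  move=> t; rewrite /= in_itv /= andbT => gt; have [k d cd] := l4 t gt.
  by exists k => //; apply: e_dim d; exact: lt_le_trans gt.
split.
  (* No kernel occurs in (mu, t0), so the sequence started at [t0] lists all of the spectrum in (mu,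
     oo). *)
  have [t0 mt0 bot] := fam_bottom g_eb s_adm s_mono.
  have [kap [k1 k2]] := fam_index g_eb s_adm mt0.
  have [lam [lamP _ linf]] := s_sequence t0 kap mt0 k1 k2.
  have lamJ n : t0 <= lam n by case: lamP => _ h _; have := h n; rewrite /= in_itv /= andbT.
  have evalue t : mu < t -> (exists2 x, x != 0 & form_kernel (s t) x) <->
      exists2 x, x != 0 & op_eigenspace M t%:C x.
    move=> mt; have [e eb] := g_eb _ (s_adm _ mt).
    have hs : Defs.symmetric_form (s t) by case: (s_adm _ mt).
    have [k d _] := form_kernel_dim hs eb.
    by rewrite -(has_dim_neq0 d) -(has_dim_neq0 (e_dim t k mt d)).
  exists lam; split.
  - apply/seteqP; split=> t /=.
      rewrite in_itv /= andbT => -[mt /(spec t mt) [x x0 xk]].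
      have t0t : t0 <= t.
        by rewrite leNgt; apply/negP => tt0; move/eqP: x0; apply; exact: (bot t x mt tt0 xk).
      have [n <-] : exists n, lam n = t.
        by apply/(in_seq t0 lam t lamP mt0 t0t)/(evalue t mt); exists x.
      by exists n.
    move=> [n _ <-]; have mn : mu < lam n by exact: lt_le_trans (lamJ n).
    rewrite in_itv /= andbT; split=> //; apply/(spec _ mn)/(evalue _ mn).
    by apply/(in_seq t0 lam _ lamP mt0 (lamJ n)); exists n.
  - move=> n; have [x x0 xe] := (in_seq t0 lam _ lamP mt0 (lamJ n)).1 (ex_intro _ n erefl).
    by exists x.
  - apply/cvgryPge => T; have [N hN] := linf T; exists N => // n /= Nn; exact: hN.
move=> gamma0 mg.
have hs : Defs.symmetric_form (s gamma0) by case: (s_adm _ mg).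
have [e eb] := g_eb _ (s_adm _ mg).
split.
  (* The number of negative eigenvalues of s(gamma0), witnessed by the spectral measure built from
     its eigenbasis. *)
  have [k [lk hk]] := eb_first_nonneg eb 0; exists k.
  have g_dense : dense (fdom g).
    move=> O O0 oO; have [x [Ox [y Axy]]] := dense_A selfadjoint_A O0 oO.
    by exists x; split=> //; have [] := dom_A_fa form_A Axy.
  exists (@spec_proj R H1 (s gamma0) e), (@spec_measure R H1 (s gamma0) e); split.
    exact: (spectral_measure_exists hg g_ge g_closed g_dense (s_adm _ mg) eb).
  exact: (spec_neg_dim hg g_ge g_closed g_dense (s_adm _ mg) eb hk lk).
move=> kap [E [m [sm hdim]]].
(* Whichever spectral measure witnesses kappa, it is the negative index of s(gamma0). *)
have [k1 k2] := kappa_neg_dim hs eb sm hdim.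
have [lam0 [lam0P lam0lt lam0inf]] := s_sequence gamma0 kap mg k1 k2.
split; first by exists lam0.
move=> lam lamP; have {lam lamP}-> : lam = lam0 by exact: eigenvalue_sequence_unique lamP lam0P.
have lam0J n : gamma0 <= lam0 n.
  by case: lam0P => _ h _; have := h n; rewrite /= in_itv /= andbT.
have nu_lt := eigenvalue_counting form_A g_ge g_eb nuP.
have nu_inf T : exists N, forall n, (N <= n)%N -> T <= nu (kap + n)%N.
  have [N hN] := eigenvalues_to_infty form_A g_ge g_eb nuP T; exists N => n Nn.
  by apply: hN; rewrite (leq_trans Nn)// leq_addl.
have comb_dom (q : qform H1) k (v : 'I_k -> H1) (f : 'I_k -> R[i]) : fdom q = fdom fa ->
    (forall i, fdom q (v i)) -> fdom fa (\sum_i f i *: v i).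
  by move=> qE vV; apply: (fdom_sum hfa) => i _; apply: (fdomZ hfa); rewrite -qE.
(* As s(t) <= fa - t, the index of A - t is at most that of s(t); a [nu] below lam0 n would give
   s(lam0 n) the index kap + n + 1 too early. *)
have lam_le_nu n : lam0 n <= nu (kap + n)%N.
  rewrite leNgt; apply/negP => lt.
  have mt : mu < lam0 n by exact: lt_le_trans (lam0J n).
  have [v [vV hv]] := (nu_lt _ _).1 lt.
  have : neg_dim (s (lam0 n)) (kap + n).+1.
    exists v; split=> // f f0; apply: le_lt_trans (hv f f0).
    by rewrite quad_translate; exact: (schur_le selfadjoint_D above_D b_ge0 delta_plusP _ mt).
  by move/(lam0lt n _ (lam0J n)).2; rewrite ltxx.
set c0 := b ^+ 2 + b * delta_plus + a.
(* The index reaches kap + n + 1 only beyond lam0 n, so t = lam0 n + eps is used. The negative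
   directions of s(t) give nu < F; clearing the denominator leaves a quadratic in eps, and eps tends
   to 0. *)
have key n : 0 <= (lam0 n - delta_plus - b) * (lam0 n - nu (kap + n)%N) +
    b * (lam0 n - delta_plus - b) + c0.
  set L := lam0 n; set N := nu _.
  have mL : mu < L by exact: lt_le_trans (lam0J n).
  have xL : 0 < L - delta_plus - b.
    by have h : delta_plus + b < L := mu_dp mL; rewrite -addrA -opprD subr_gt0.
  apply: (@quadratic_ge0 _ _ (2 * L - delta_plus - N)) => eps eps0.
  set t := L + eps; have Lt : L < t by rewrite /t ltrDl.
  have mt : mu < t by exact: lt_trans Lt.
  have x0 : 0 < t - delta_plus - b by rewrite /t; lra.
  have [v [vV hv]] : neg_dim (s t) (kap + n).+1.
    by apply/lam0lt => //; apply: (le_trans (lam0J n)); exact: ltW.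
  (* Obtained by inserting the bound of [schur_nonpos_bound] on the D-term into s(t)[x] < 0, which
     becomes fa[x] < F |x|^2. *)
  pose F := t + (a + b * t) / (t - delta_plus - b).
  have ndF : neg_dim (fadd fa (- F) (inner_form H1)) (kap + n).+1.
    exists v; split=> // f f0; have := hv f f0; set x := \sum_i _ => sx.
    have xV : fdom fa x by exact: (comb_dom (s t)).
    have h := schur_nonpos_bound selfadjoint_D above_D b_ge0 ab delta_plusP mt xV (ltW sx).
    rewrite quad_translate subr_lt0 -(ltr_pM2l x0).
    have -> : (t - delta_plus - b) * (F * n2 x) =
        (t - delta_plus - b) * (t * n2 x) + (a + b * t) * n2 x.
      by rewrite /F; field; rewrite gt_eqF.
    apply: lt_le_trans (lerD (lexx _) h); rewrite -mulrDr ltr_pM2l//.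
    by move: sx; rewrite quad_schur; lra.
  have NF := (nu_lt _ _).2 ndF; rewrite -/N in NF.
  have : (t - delta_plus - b) * N < (t - delta_plus - b) * F by rewrite ltr_pM2l.
  have -> : (t - delta_plus - b) * F = (t - delta_plus - b) * t + (a + b * t).
    by rewrite /F; field; rewrite gt_eqF.
  by rewrite -subr_gt0 /t /c0 => h; apply: (lt_le_trans h); rewrite le_eqVlt; apply/orP; left; apply/eqP; ring.
split.
  pose K := 4 * `|c0| * (2 * b + `|c0|).
  exists (fun n => - K / nu (kap + n)%N ^+ 2); split.
    exact: (inv_sqr_bigO (fun n => nu (kap + n)%N)).
  have [N1 hN1] := nu_inf (2 * `|delta_plus| + 4 * b + 2 * `|c0| + 2).
  have [N2 hN2] := lam0inf (1 + delta_plus + b).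
  exists (maxn N1 N2) => // n /=; rewrite geq_max => /andP[n1 n2'].
  rewrite lam_le_nu andbT mulNr.
  apply: (lower_asymptotics b_ge0 _ (lam_le_nu n) (key n) (hN1 n n1)).
  by have := hN2 n n2'; lra.
move=> dm ah bh bD dmP bh0 abh.
set c1 := bh ^+ 2 + bh * dm + ah.
pose K := 16 * bh * `|c1| + 8.
exists (fun n => K / nu (kap + n)%N ^+ 2); split.
  exact: (inv_sqr_bigO (fun n => nu (kap + n)%N)).
have [N1 hN1] := nu_inf (4 * `|dm| + 4 * bh + 2 * `|c1| + 4).
have [N2 hN2] := nu_inf (gamma0 + bh + `|c1|).
exists (maxn N1 N2) => // n /=; rewrite geq_max => /andP[n1 n2'].
(* The claimed bound is named t below. That lam0 n < t follows once s(t) has kap + n + 1 negative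
   directions, and [t3] is the inequality that makes them negative. *)
have [t1 t2 t3] := upper_asymptotics bh0 (hN1 n n1).
set N := nu _ in t1 t2 t3 *; set t := N - bh - c1 / (N - dm) + K / N ^+ 2.
rewrite -/K -/t in t1 t2 t3.
have gt : gamma0 <= t by have := hN2 n n2'; rewrite -/N; move: t1; lra.
have mt : mu < t by exact: lt_le_trans gt.
apply: ltW; apply/(lam0lt n t gt).
have dt : delta_plus < t := mu_dp' b_ge0 mt.
(* Expanded, h0 = (t - dm) t - (t - dm - bh) N + ah. For fa[x] <= N |x|^2 the two lower bounds give
   (t - dm) s(t)[x] <= - h0 |x|^2. *)
set h0 := (t - dm) ^+ 2 - _ + _ + _ in t3.
have tau0 : 0 < t - dm by lra.
(* Counting eigenvalues requires the strict inequality nu < N', so N is raised slightly; this spends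
   half of [h0]. *)
pose N' := N + h0 / (2 * (t - dm - bh)).
have NN' : N < N' by rewrite /N' ltrDl divr_gt0// mulr_gt0.
have [v [vV hv]] := (nu_lt _ _).1 NN'.
exists v; split=> // f f0; have := hv f f0; set x := \sum_i _.
have xV : fdom fa x by exact: (comb_dom (fadd fa (- N') (inner_form H1))).
rewrite quad_translate subr_lt0 => fx.
have x0 : 0 < n2 x.
  rewrite lt_def n2_ge0 andbT; apply/eqP => nx0; have := hv f f0; rewrite -/x.
  by rewrite (n2_eq0 nx0) quad_translate (quad0 hfa) n20 mulr0 subr0 ltxx.
have w1 := abh x xV; rewrite !rnorm2 in w1.
have w2 := Dres_lower selfadjoint_D above_D delta_plusP (op_app (adjoint B) x) dt bD dmP.
rewrite -(pmulr_rlt0 _ tau0) quad_schur.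
have w3 : (t - dm - bh) * quad fa x < (t - dm - bh) * (N' * n2 x) by rewrite ltr_pM2l.
have w4 : (t - dm - bh) * (N' * n2 x) - (t - dm) * (t * n2 x) - ah * n2 x = - (h0 / 2) * n2 x.
  by rewrite /N' /h0 /c1; field; rewrite gt_eqF.
have w5 : 0 < h0 * n2 x by rewrite mulr_gt0.
set r := ip _ _ in w2 *.
have -> : (t - dm) * (quad fa x - t * n2 x + r) =
   (t - dm) * quad fa x - (t - dm) * (t * n2 x) - (t - dm) * (- r) by ring.
have -> : (t - dm) * quad fa x = (t - dm - bh) * quad fa x + bh * quad fa x by ring.
move: w1 w2 w3 w4 w5; move: (n2 (op_app _ _)) => W; rewrite mulNr => w1 w2 w3 w4 w5; lra.
Qed.
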